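(* Let $d\in\{2,3\}$ and let $\Omega\subset\mathbb{R}^d$ be a bounded convex domain. Let $T>0$, $0<\theta_1,\ldots,\theta_s\le 1$, $a_1>0$, $a_r\ge 0$ for $r=2,\ldots,s$, $1<\alpha_l\le 2$, and let $\varepsilon^{+}_{\alpha_l},\varepsilon^{-}_{\alpha_l}\ge 0$ be constants ($l=1,\ldots,d$). Let $u(\mathbf{x},t)$ be the exact solution, smooth enough with regard to $t$ (in the sense made precise in the context), of $$\sum_{r=1}^{s}a_r\,{}^{C}_{0}D^{\theta_r}_tu-\sum_{l=1}^d\varepsilon^+_{\alpha_l}\frac{\partial^{\alpha_l}_+u}{\partial x^{\alpha_l}_{l,+}}-\sum_{l=1}^d\varepsilon^-_{\alpha_l}\frac{\partial^{\alpha_l}_-u}{\partial x^{\alpha_l}_{l,-}}=f\ \text{ in }\Omega\times(0,T],$$ with $u(\cdot,0)=u_0$ in $\Omega$ and $u=g$ on $\partial\Omega\times(0,T]$, and write $u^n=u(\cdot,t_n)$, $t_n=n\tau$, $\tau=T/N$. Let $U^n$, $n=0,\ldots,N$, be the approximate solution given by $U^0=u_0$, $U^n=g(\cdot,t_n)$ on $\partial\Omega$, and $$\sum_{r=1}^{s}\frac{a_r\omega^{\theta_r}_0}{\tau^{\theta_r}}U^n-\sum_{l=1}^d\varepsilon^+_{\alpha_l}\frac{\partial^{\alpha_l}_+U^n}{\partial x^{\alpha_l}_{l,+}}-\sum_{l=1}^d\varepsilon^-_{\alpha_l}\frac{\partial^{\alpha_l}_-U^n}{\partial x^{\alpha_l}_{l,-}}=f(\cdot,t_n)-\sum_{r=1}^{s}\frac{a_r}{\tau^{\theta_r}}\sum_{k=1}^{n-1}\omega^{\theta_r}_kU^{n-k}+\sum_{r=1}^{s}\frac{a_r}{\tau^{\theta_r}}\sum_{k=0}^{n-1}\omega^{\theta_r}_kU^0$$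 in $\Omega$ for $n=1,\ldots,N$. Then there is a constant $C$, independent of $\tau$ and $n$, such that $$\|u^n-U^n\|_{0,\Omega}\le C\tau,\qquad n=1,2,\ldots,N.$$
   Context: Notation: $\mathbf{x}=(x_1,\ldots,x_d)$, $(u,v)=\int_\Omega uv\,d\Omega$, $\|u\|_{0,\Omega}=\sqrt{(u,u)}$. Time-fractional (Caputo) derivative: for $0<\theta<1$, ${}^{C}_{0}D^{\theta}_tu(\mathbf{x},t)=\frac{1}{\Gamma(1-\theta)}\int_0^t\frac{\partial_\xi u(\mathbf{x},\xi)}{(t-\xi)^{\theta}}d\xi$; for $\theta=1$ it is $\partial_tu$. Coefficients: $\omega^{\theta}_0=1$, $\omega^{\theta}_k=\left(1-\frac{\theta+1}{k}\right)\omega^{\theta}_{k-1}$ for $k\ge1$ (the first-order, $q=1$, Lubich/Grünwald-Letnikov coefficients). Spatial fractional derivatives: for $\mathbf{x}\in\Omega$ let $X_{l,L}$ and $X_{l,R}$ be the minimum and maximum of the $l$-th coordinate over the points of $\overline\Omega$ whose other coordinates agree with those of $\mathbf{x}$. For $1<\alpha<2$, $$\frac{\partial^{\alpha}_+v}{\partial x^{\alpha}_{l,+}}(\mathbf{x})=\frac{1}{\Gamma(2-\alpha)}\int_{X_{l,L}}^{x_l}\frac{\partial^2_{x_l}v|_{x_l=\xi}}{(x_l-\xi)^{\alpha-1}}\,d\xi,\qquad \frac{\partial^{\alpha}_-v}{\partial x^{\alpha}_{l,-}}(\mathbf{x})=\frac{1}{\Gamma(2-\alpha)}\int_{x_l}^{X_{l,R}}\frac{\partial^2_{x_l}v|_{x_l=\xi}}{(\xi-x_l)^{\alpha-1}}\,d\xi$$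 (Caputo derivatives); for $\alpha=2$ both equal $\partial^2_{x_l}v$. Smooth enough in $t$: the time truncation errors $$R^n=\sum_{r=1}^s a_r\left({}^{C}_{0}D^{\theta_r}_tu(\cdot,t_n)-\frac{1}{\tau^{\theta_r}}\sum_{k=0}^{n-1}\omega^{\theta_r}_k\left(u(\cdot,t_{n-k})-u(\cdot,0)\right)\right)$$ satisfy $\|R^n\|_{0,\Omega}\le C_R\tau$ for all $n=1,\ldots,N$, with $C_R$ independent of $\tau$ and $n$. Standing assumption (zero gradient on $\partial\Omega$): solutions are assumed to have zero gradient on $\partial\Omega$, so that the errors $\vartheta^n=u^n-U^n$, $n\ge 1$, vanish together with their gradient on $\partial\Omega$. Precisely, for $n\ge1$ and every $l$, $\vartheta^n$ belongs to the closures $J^{\alpha_l}_{L,0}(\Omega)$ and $J^{\alpha_l}_{R,0}(\Omega)$ of $C_0^\infty(\Omega)$ in the norms $\left(\|v\|^2_{0,\Omega}+\|D_{l,+}^{\alpha_l}v\|^2_{0,\Omega}\right)^{1/2}$ and $\left(\|v\|^2_{0,\Omega}+\|D_{l,-}^{\alpha_l}v\|^2_{0,\Omega}\right)^{1/2}$. Here $D^{\alpha}_{l,\pm}$ are the left/right Riemann-Liouville derivatives in $x_l$ with base points $X_{l,L}$, $X_{l,R}$: for $1<\alpha<2$, $D^{\alpha}_{l,+}v=\frac{1}{\Gamma(2-\alpha)}\partial^2_{x_l}\int_{X_{l,L}}^{x_l}\frac{v|_{x_l=\xi}}{(x_l-\xi)^{\alpha-1}}d\xi$ and $D^{\alpha}_{l,-}v=\frac{1}{\Gamma(2-\alpha)}\partial^2_{x_l}\int_{x_l}^{X_{l,R}}\frac{v|_{x_l=\xi}}{(\xi-x_l)^{\alpha-1}}d\xi$,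 and $D^2_{l,\pm}=\partial^2_{x_l}$. On such functions the Caputo derivatives above coincide with $D^{\alpha_l}_{l,\pm}$. *)

(* Defs.v *)
From HB Require Import structures.
From mathcomp Require Import all_boot all_order all_algebra.
From mathcomp Require Import all_classical all_reals all_analysis.
Set Implicit Arguments.
Unset Strict Implicit.
Unset Printing Implicit Defensive.
Import Order.TTheory GRing.Theory Num.Theory.
Import numFieldNormedType.Exports.
Local Open Scope classical_set_scope.
Local Open Scope ring_scope.

(* Lebesgue measure on R^d.  The library has it on R only; it is transported to
   d-tuples by iterated products. *)
Section lebesgue_tuple.
Context {R : realType}.
Notation mR := (measurableTypeR R).

Definition tcons n (p : mR * n.-tuple mR) : n.+1.-tuple mR := [tuple of p.1 :: p.2].

Definition tuncons n (t : n.+1.-tuple mR) : mR * n.-tuple mR :=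
  (thead t, [tuple of behead t]).

Lemma measurable_tcons n : measurable_fun setT (@tcons n).
Proof. exact: (measurable_cons measurable_fst measurable_snd). Qed.

Lemma measurable_tuncons n : measurable_fun setT (@tuncons n).
Proof.
apply/measurable_fun_pairP; split; last exact: measurable_behead.
exact: measurable_tnth.
Qed.

Lemma tconsK n : cancel (@tcons n) (@tuncons n).
Proof. by move=> [x t]; congr pair; apply/val_inj. Qed.

Section step.
Variables (n : nat) (m : {sigma_finite_measure set (n.-tuple mR) -> \bar R}).

Definition leb_step : set (n.+1.-tuple mR) -> \bar R :=
  pushforward (lebesgue_measure \x m)%E (@tcons n).

Let mpre (A : set (n.+1.-tuple mR)) : measurable A -> measurable (@tcons n @^-1` A).
Proof. by move=> mA; rewrite -[X in measurable X]setTI; exact: measurable_tcons. Qed.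

Let leb_step0 : leb_step set0 = 0%E.
Proof. by rewrite /leb_step /pushforward preimage_set0 measure0. Qed.

Let leb_step_ge0 A : (0 <= leb_step A)%E.
Proof. exact: (measure_ge0 (lebesgue_measure \x m)%E). Qed.

Let leb_step_sigma_additive : semi_sigma_additive leb_step.
Proof.
move=> F mF tF mUF; rewrite /leb_step /pushforward preimage_bigcup.
apply: measure_semi_sigma_additive.
- by move=> i; exact: mpre.
- apply/trivIsetP => /= i j _ _ ij; rewrite -preimage_setI.
  by move/trivIsetP : tF => /(_ _ _ _ _ ij) ->//; rewrite preimage_set0.
- by rewrite -preimage_bigcup; exact: mpre.
Qed.

HB.instance Definition _ := isMeasure.Build _ _ _ leb_step
  leb_step0 leb_step_ge0 leb_step_sigma_additive.

Let leb_step_sigma_finite : sigma_finite setT leb_step.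
Proof.
have /sigma_finiteP[F [TF ndF Foo]] := sigma_finiteT (@lebesgue_measure R).
have /sigma_finiteP[G [TG ndG Goo]] := sigma_finiteT m.
exists (fun i => @tuncons n @^-1` (F i `*` G i)).
  rewrite -preimage_bigcup (_ : \bigcup_i _ = setT) ?preimage_setT//.
  rewrite -setXTT TF TG predeqE => -[x y]; split.
    by move=> [i _ []/= ? ?]; split; exists i.
  move=> [/= [i _ Fix] [k _ Gky]]; exists (maxn i k) => //; split.
  - by move: x Fix; exact/subsetPset/ndF/leq_maxl.
  - by move: y Gky; exact/subsetPset/ndG/leq_maxr.
move=> i; have [? ?] := Foo i; have [? ?] := Goo i; split.
  by rewrite -[X in measurable X]setTI; apply: measurable_tuncons => //; exact: measurableX.
rewrite /leb_step /pushforward -comp_preimage.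
rewrite (_ : _ \o _ = id) ?preimage_id; last exact/funext/tconsK.
by rewrite product_measure1E// lte_mul_pinfty// ge0_fin_numE.
Qed.

HB.instance Definition _ := Measure_isSigmaFinite.Build _ _ _ leb_step
  leb_step_sigma_finite.

End step.

Fixpoint lebesgue_tuple n : {sigma_finite_measure set (n.-tuple mR) -> \bar R} :=
  match n with
  | 0 => dirac [tuple]
  | n'.+1 => leb_step (lebesgue_tuple n')
  end.

Lemma lebesgue_tuple_box n (l r : 'I_n -> R) : (forall i, l i <= r i) ->
  lebesgue_tuple n [set t | forall i, l i <= tnth t i <= r i] =
  (\prod_(i < n) (r i - l i))%:E.
Proof.
elim: n l r => [|n IHn] l r lr.
  rewrite big_ord0 /= diracE mem_set//= => -[].
  by [].
rewrite big_ord_recl EFinM.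
transitivity (leb_step (lebesgue_tuple n)
  [set t | forall i, l i <= tnth t i <= r i]) => //.
rewrite /leb_step /pushforward.
have -> : @tcons n @^-1` [set t | forall i, l i <= tnth t i <= r i] =
    `[l ord0, r ord0]%classic `*`
    [set t | forall i, l (lift ord0 i) <= tnth t i <= r (lift ord0 i)].
  apply/seteqP; split => -[x t] /=.
    move=> H; split => [|i]; first by have := H ord0; rewrite in_itv.
    by have := H (lift ord0 i); rewrite tnthS.
  rewrite in_itv/= => -[x01 H] i.
  by case: (unliftP ord0 i) => [j|] ->; rewrite ?tnthS.
rewrite product_measure1E//; last first.
  rewrite (_ : [set _ | _] = \bigcap_(i in [set: 'I_n])
      ((@tnth _ mR ^~ i) @^-1` `[l (lift ord0 i), r (lift ord0 i)]%classic)).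
    apply: fin_bigcap_measurable => // i _.
    by rewrite -[X in measurable X]setTI; exact: measurable_tnth.
  apply/seteqP; split => t /= H i; first by move=> _; rewrite /= in_itv; exact: H.
  by have := H i Logic.I; rewrite /= in_itv.
rewrite IHn => [|i]; last exact: lr.
congr (_ * _)%E; rewrite [LHS](lebesgue_measure_itv `[l ord0, r ord0])/= lte_fin.
by case: ltgtP (lr ord0) => // ->; rewrite subrr.
Qed.

End lebesgue_tuple.

Section euclidean.
Context {R : realType} {d : nat}.
Notation Rd := 'rV[R]_d.
Notation mu := (@lebesgue_measure R).
Implicit Types (Omega : set Rd) (v : Rd -> R) (x : Rd) (l : 'I_d).

Definition bounded_convex_domain Omega :=
  [/\ open Omega, Omega !=set0, bounded_set Omega & convex_set Omega].

Definition boundary Omega : set Rd := closure Omega `\` Omega°.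

(* Integrals over a set of row vectors are taken through this identification of
   d-tuples with row vectors. *)
Definition row_of_tuple (t : d.-tuple (measurableTypeR R)) : Rd :=
  \row_i tnth t i.

Definition L2norm Omega v : \bar R :=
  ((\int[lebesgue_tuple d]_(t in row_of_tuple @^-1` Omega)
      ((v (row_of_tuple t)) ^+ 2)%:E) `^ 2^-1)%E.

Definition inL2 Omega v :=
  measurable_fun (row_of_tuple @^-1` Omega) (v \o row_of_tuple) /\
  (L2norm Omega v < +oo)%E.

Definition pderiv l v : Rd -> R := fun x => 'D_(delta_mx 0 l) v x.

(* [smooth] is C^oo on R^d: all iterated partial derivatives exist and are
   continuous. *)
Definition smooth v := forall s : seq 'I_d,
  continuous (foldr pderiv v s) /\
  forall l x, derivable (foldr pderiv v s) x (delta_mx 0 l).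

Definition test_function Omega v :=
  [/\ smooth v, compact (closure [set x | v x != 0]) &
      closure [set x | v x != 0] `<=` Omega].

Definition Gamma (z : R) : R :=
  \int[mu]_(t in `]0, +oo[) (t `^ (z - 1) * expR (- t)).

Definition on_line x l (xi : R) : Rd :=
  \row_j (if j == l then xi else x ord0 j).

(* X_{l,L} and X_{l,R}: the set below is compact and nonempty when [Omega] is
   bounded and x is in [Omega], so that inf and sup are min and max. *)
Definition XL Omega l x : R := inf [set xi | closure Omega (on_line x l xi)].
Definition XR Omega l x : R := sup [set xi | closure Omega (on_line x l xi)].

Definition caputo_integrand_left (alpha : R) l v x (xi : R) : R :=
  pderiv l (pderiv l v) (on_line x l xi) / (x ord0 l - xi) `^ (alpha - 1).

Definition caputo_integrand_right (alpha : R) l v x (xi : R) : R :=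
  pderiv l (pderiv l v) (on_line x l xi) / (xi - x ord0 l) `^ (alpha - 1).

Definition caputo_left Omega (alpha : R) l v x : R :=
  if alpha == 2 then pderiv l (pderiv l v) x else
  (Gamma (2 - alpha))^-1 *
  \int[mu]_(xi in `]XL Omega l x, x ord0 l[) caputo_integrand_left alpha l v x xi.

Definition caputo_right Omega (alpha : R) l v x : R :=
  if alpha == 2 then pderiv l (pderiv l v) x else
  (Gamma (2 - alpha))^-1 *
  \int[mu]_(xi in `]x ord0 l, XR Omega l x[) caputo_integrand_right alpha l v x xi.

Definition RL_left Omega (alpha : R) l v : Rd -> R :=
  if alpha == 2 then pderiv l (pderiv l v) else fun x =>
  (Gamma (2 - alpha))^-1 * pderiv l (pderiv l (fun y =>
    \int[mu]_(xi in `]XL Omega l y, y ord0 l[)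
      (v (on_line y l xi) / (y ord0 l - xi) `^ (alpha - 1)))) x.

Definition RL_right Omega (alpha : R) l v : Rd -> R :=
  if alpha == 2 then pderiv l (pderiv l v) else fun x =>
  (Gamma (2 - alpha))^-1 * pderiv l (pderiv l (fun y =>
    \int[mu]_(xi in `]y ord0 l, XR Omega l y[)
      (v (on_line y l xi) / (xi - y ord0 l) `^ (alpha - 1)))) x.

Definition graph_norm Omega v w : \bar R :=
  ((L2norm Omega v `^ 2 + L2norm Omega w `^ 2) `^ 2^-1)%E.

(* Membership of v in the closure of C_0^oo(Omega) in the norm
   (|v|^2 + |D v|^2)^(1/2).  The second term is D v - D phi and not
   D (v - phi): they agree where v has the derivatives, while elsewhere the
   default value of a derivative cannot make a non-member pass, since D v is
   then still the limit in L^2 of derivatives of test functions. *)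
Definition J0 Omega (D : (Rd -> R) -> Rd -> R) v :=
  [/\ inL2 Omega v, inL2 Omega (D v) &
   forall e : R, 0 < e -> exists phi, test_function Omega phi /\
     (graph_norm Omega (v \- phi)%R (D v \- D phi)%R < e%:E)%E].

(* v is defined on [closure Omega]; its gradient, which is a pointwise object
   in [Omega] only, is extended to the boundary by continuity. *)
Definition vanishes_with_gradient Omega v :=
  forall p, boundary Omega p -> v p = 0 /\
    forall l, pderiv l v @ within Omega (nbhs p) --> (0 : R).

(* The regularity under which the boundary values and the spatial derivatives
   of the equation make sense for v. *)
Definition space_regular Omega (alpha : 'I_d -> R) v :=
  [/\ {within closure Omega, continuous v},
   forall l x, Omega x ->
     [/\ derivable v x (delta_mx 0 l),
         derivable (pderiv l v) x (delta_mx 0 l) &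
         {for x, continuous (pderiv l (pderiv l v))}] &
   forall l x, Omega x -> alpha l < 2 ->
     mu.-integrable `]XL Omega l x, x ord0 l[
       (EFin \o caputo_integrand_left (alpha l) l v x) /\
     mu.-integrable `]x ord0 l, XR Omega l x[
       (EFin \o caputo_integrand_right (alpha l) l v x)].

Definition space_term Omega (alpha epsp epsm : 'I_d -> R) v x : R :=
  \sum_l epsp l * caputo_left Omega (alpha l) l v x +
  \sum_l epsm l * caputo_right Omega (alpha l) l v x.

End euclidean.

Section time.
Context {R : realType}.
Notation mu := (@lebesgue_measure R).

(* Derivative of a function given on [0, T]: one-sided at t = T. *)
Definition tquotient (T : R) (w : R -> R) (t : R) : set_system R :=
  (fun h => h^-1 * (w (t + h) - w t)) @ within [set h | 0 <= t + h <= T] 0^'.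

Definition tderivable T w t := cvg (tquotient T w t).

Definition tderiv T w t : R := lim (tquotient T w t).

Definition caputo_integrand_time T (theta : R) w (t xi : R) : R :=
  tderiv T w xi / (t - xi) `^ theta.

Definition caputo_time T (theta : R) (w : R -> R) (t : R) : R :=
  if theta == 1 then tderiv T w t else
  (Gamma (1 - theta))^-1 *
  \int[mu]_(xi in `]0, t[) caputo_integrand_time T theta w t xi.

Definition time_regular T s (theta : 'I_s.+1 -> R) (w : R -> R) :=
  {within `[0, T], continuous w} /\
  forall t : R, 0 < t <= T -> tderivable T w t /\
    forall r, theta r < 1 ->
      mu.-integrable `]0, t[ (EFin \o caputo_integrand_time T (theta r) w t).

Fixpoint GLcoef (theta : R) (k : nat) : R :=
  match k with
  | 0 => 1
  | k'.+1 => (1 - (theta + 1) / k'.+1%:R) * GLcoef theta k'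
  end.

End time.

(* The terms r = 1, ..., s of the time derivative are indexed by 'I_s.+1, so
   that [a ord0] is the coefficient required to be positive. *)
Section problem.
Context {R : realType} {d s : nat}.
Notation Rd := 'rV[R]_d.
Variables (Omega : set Rd) (T : R) (theta a : 'I_s.+1 -> R).
Variables (alpha epsp epsm : 'I_d -> R).
Variables (f g : Rd -> R -> R) (u0 : Rd -> R).

Definition exact_solution (u : Rd -> R -> R) :=
  [/\ (forall x, Omega x -> time_regular T theta (u x)) /\
      (forall t : R, 0 < t <= T -> space_regular Omega alpha (u ^~ t)),
      forall x (t : R), Omega x -> 0 < t <= T ->
        \sum_r a r * caputo_time T (theta r) (u x) t
        - space_term Omega alpha epsp epsm (u ^~ t) x = f x t,
      forall x, Omega x -> u x 0 = u0 x &
      forall x (t : R), boundary Omega x -> 0 < t <= T -> u x t = g x t].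

Definition tau (N : nat) : R := T / N%:R.
Definition tgrid (N n : nat) : R := n%:R * tau N.

Definition time_residual (u : Rd -> R -> R) (N n : nat) (x : Rd) : R :=
  \sum_r a r * (caputo_time T (theta r) (u x) (tgrid N n)
    - (tau N `^ theta r)^-1 *
      \sum_(0 <= k < n) GLcoef (theta r) k * (u x (tgrid N (n - k)) - u x 0)).

Definition smooth_enough_in_time (u : Rd -> R -> R) :=
  exists CR : R, forall N n : nat, (0 < n <= N)%N ->
    (L2norm Omega (time_residual u N n) <= (CR * tau N)%:E)%E.

Definition scheme_solution (N : nat) (U : nat -> Rd -> R) :=
  [/\ forall x, Omega x -> U 0 x = u0 x,
      forall n, (0 < n <= N)%N -> space_regular Omega alpha (U n),
      forall n x, (0 < n <= N)%N -> boundary Omega x -> U n x = g x (tgrid N n) &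
      forall n x, (0 < n <= N)%N -> Omega x ->
        \sum_r a r * GLcoef (theta r) 0 / tau N `^ theta r * U n x
        - space_term Omega alpha epsp epsm (U n) x =
        f x (tgrid N n)
        - \sum_r a r / tau N `^ theta r *
            \sum_(1 <= k < n) GLcoef (theta r) k * U (n - k)%N x
        + \sum_r a r / tau N `^ theta r *
            \sum_(0 <= k < n) GLcoef (theta r) k * U 0 x].

Definition error (u : Rd -> R -> R) (N : nat) (U : nat -> Rd -> R) (n : nat)
  (x : Rd) : R := u x (tgrid N n) - U n x.

Definition zero_gradient_errors (u : Rd -> R -> R) (N : nat)
    (U : nat -> Rd -> R) :=
  forall n, (0 < n <= N)%N ->
    vanishes_with_gradient Omega (error u N U n) /\
    forall l, J0 Omega (RL_left Omega (alpha l) l) (error u N U n) /\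
              J0 Omega (RL_right Omega (alpha l) l) (error u N U n).

End problem.

(* Main.v *)
(* Subtracting the scheme from the equation, the errors e^n = u^n - U^n satisfy
   sum_r a_r tau^(-theta_r) sum_{k<n} w_k e^(n-k) = S e^n - R^n on Omega, S being
   the space operator.  Pair this with e^n in L^2.

   S is dissipative.  On e^n, which vanishes with its gradient on the boundary,
   the Caputo derivatives are Riemann-Liouville derivatives, so by density
   (S phi, phi) <= 0 is needed for test functions phi only.  There
   D^alpha phi(x) is the integral of d^2 phi(x -+ s e_l) s^(1-alpha) / Gamma(2-alpha)
   over s > 0, so by Fubini (D^alpha phi, phi) is the integral of
   H''(s) s^(1-alpha) / Gamma(2-alpha), where H(s) = int phi(x) phi(x -+ s e_l) dx is the
   autocorrelation of phi.  As H has its maximum at 0 and vanishes for large s,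
   two integrations by parts make this nonpositive.

   The weights w_k are nonpositive for k >= 1, so Cauchy-Schwarz leaves
   sum_r a_r tau^(-theta_r) sum_{k<n} w_k |e^(n-k)| <= C_R tau.  Since w_0 = 1 and
   the w_k are nonpositive otherwise, a solution of this recursion is dominated by
   any positive supersolution: a constant one if theta_1 < 1, where
   sum_{k<n} w_k >= (1 - theta_1) n^(-theta_1), and t_n if theta_1 = 1. *)

(* Two gaps in regularity shape the proof. The errors have second derivatives only inside Omega,
   with no bound near the boundary, while [J0] speaks of Riemann-Liouville derivatives; so the two
   kinds of derivative are identified pointwise along each chord, from the convergence of value and
   gradient to zero at its ends. And each of the 2d one-sided derivatives has its own approximating
   test functions, so the sign passes to the limit for each derivative separately, before the
   weighted sum is formed.

   For a test function all rays are extended to one common length M, larger than the width of Omega,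
   so that Fubini meets a product domain. Subtracting H(0) from H makes it O(s^2) at 0, which
   removes the boundary terms at the singular end; at s = M the derivative of H vanishes and the
   remaining boundary term has the right sign.

   For C_R >= 0 the constant is C_R T / a_1 if theta_1 = 1 and C_R T^theta_1 / (a_1 (1 - theta_1))
   otherwise. The latter blows up as theta_1 tends to 1, which is why there are two
   supersolutions. *)
Require Import Defs.
From HB Require Import structures.
From mathcomp Require Import all_boot all_order all_algebra.
From mathcomp Require Import all_classical all_reals all_analysis.
From mathcomp Require Import measurable_realfun.
From mathcomp Require Import ring lra.
Set Implicit Arguments.
Unset Strict Implicit.
Unset Printing Implicit Defensive.
Import Order.TTheory GRing.Theory Num.Theory.
Import numFieldNormedType.Exports.
Local Open Scope classical_set_scope.
Local Open Scope ring_scope.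

(** * Grunwald-Letnikov weights *)

Section GL.
Context {R : realType}.
Implicit Types theta : R.

(** The sign is that of w_1 = -theta: from k = 2 on the recursion factor 1 - (theta + 1)/k is
    nonnegative, because theta + 1 <= 2. *)
Lemma GLcoef_le0 theta k : 0 < theta <= 1 -> (0 < k)%N -> GLcoef theta k <= 0.
Proof.
move=> /andP[t0 t1]; case: k => // k _; elim: k => [|k IHk] /=.
  by rewrite mulr1 divr1; lra.
rewrite -/(GLcoef theta k.+1) mulr_ge0_le0 //.
rewrite subr_ge0 ler_pdivrMr ?ltr0n// mul1r.
by rewrite (@le_trans _ _ 2)//; [lra|rewrite ler_nat].
Qed.

(** The weights are the coefficients of (1 - z)^theta, so their partial sums are those of (1 -
    z)^(theta - 1). *)
Lemma sum_GLcoef theta n :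
  \sum_(0 <= k < n.+1) GLcoef theta k = \prod_(1 <= j < n.+1) (1 - theta / j%:R).
Proof.
(* The induction carries along a closed form of the next weight, the term that the next partial sum
   gains. *)
suff H m : \sum_(0 <= k < m.+1) GLcoef theta k =
    \prod_(1 <= j < m.+1) (1 - theta / j%:R) /\
    m.+1%:R * GLcoef theta m.+1 = - theta * \prod_(1 <= j < m.+1) (1 - theta / j%:R).
  by have [] := H n.
elim: m => [|m [IH1 IH2]].
  by rewrite big_nat1 big_geq //= divr1 mulr1; split => //; ring.
have mn0 : m.+1%:R != 0 :> R by rewrite pnatr_eq0.
have P : GLcoef theta m.+1 = - (theta / m.+1%:R) * \prod_(1 <= j < m.+1) (1 - theta / j%:R).
  by apply: (mulfI mn0); rewrite IH2; field.
split.
  by rewrite big_nat_recr//= -/(GLcoef theta m.+1) IH1 P [RHS]big_nat_recr//=; ring.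
rewrite [GLcoef theta m.+2](_ : _ = (1 - (theta + 1) / m.+2%:R) * GLcoef theta m.+1)//.
rewrite P [in RHS]big_nat_recr//=.
have mn2 : m.+2%:R != 0 :> R by rewrite pnatr_eq0.
rewrite -(natr1 m.+1) in mn2 *; move: mn0 mn2.
by move: (m.+1%:R : R) => x mn0 mn2; field; rewrite mn0 mn2.
Qed.

Lemma sum_GLcoef_ge0 theta n : 0 < theta <= 1 -> 0 <= \sum_(0 <= k < n) GLcoef theta k.
Proof.
case: n => [|n] t01; first by rewrite big_geq.
rewrite sum_GLcoef prodr_ge0 //= => -[|j] _.
  (* The index 0 lies outside the product, but [prodr_ge0] asks for it all the same; there theta / 0
     = 0. *)
  by rewrite invr0 mulr0 subr0.
move/andP: t01 => [t0 t1].
by rewrite subr_ge0 ler_pdivrMr ?ltr0n// mul1r (le_trans t1)// ler1n.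
Qed.

(* Bernoulli's inequality [(1 - 1/j)^theta <= 1 - theta/j], factor by factor. *)
Lemma sum_GLcoef_ge theta n : 0 < theta < 1 ->
  (1 - theta) / n.+1%:R `^ theta <= \sum_(0 <= k < n.+1) GLcoef theta k.
Proof.
move=> /andP[t0 t1]; case: n => [|n].
  by rewrite big_nat1/= powR1 divr1; lra.
rewrite sum_GLcoef.
(* The factors telescope to a power of n + 1, one less than the number n + 2 of summands, which is
   more than the claim asks. *)
suff H : (1 - theta) / n.+1%:R `^ theta <= \prod_(1 <= j < n.+2) (1 - theta / j%:R).
  apply: le_trans H; rewrite ler_pM2l ?subr_gt0//.
  rewrite lef_pV2 ?posrE ?powR_gt0 ?ltr0n//.
  by rewrite ge0_ler_powR ?nnegrE ?ler_nat//; lra.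
elim: n => [|n IHn].
  by rewrite big_nat1 powR1 !divr1.
rewrite big_nat_recr//=.
have n10 : 0 < n.+1%:R :> R by rewrite ltr0n.
have n20 : 0 < n.+2%:R :> R by rewrite ltr0n.
have B : n.+1%:R `^ theta / n.+2%:R `^ theta <= 1 - theta / n.+2%:R :> R.
  have -> : n.+1%:R `^ theta / n.+2%:R `^ theta = (n.+1%:R / n.+2%:R) `^ theta.
    rewrite powRM ?invr_ge0 ?ltW//; congr (_ * _).
    by rewrite -powRN -[in RHS]powR_inv1 ?ltW// -powRrM mulN1r.
  have n12 : 0 <= n.+1%:R / n.+2%:R :> R by rewrite divr_ge0 ?ltW.
  (* Bernoulli from Young's inequality with exponents 1/theta and 1/(1 - theta), applied to x^theta
     and 1 with x = (n + 1)/(n + 2): x^theta <= theta x + 1 - theta. *)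
  have := @conjugate_powR R ((n.+1%:R / n.+2%:R) `^ theta) 1 theta^-1 (1 - theta)^-1
    (powR_ge0 _ _) ler01.
  rewrite !invr_gt0 subr_gt0 !invrK => /(_ t0 t1).
  rewrite -powRrM divff ?gt_eqF// powRr1// mulr1 [1 `^ _](_ : _ = 1) ?powR1// mul1r.
  rewrite addrC subrK => /(_ erefl) /le_trans; apply.
  rewrite le_eqVlt; apply/orP; left; apply/eqP; rewrite -(natr1 n.+1) in n20 *.
  by move: n20; move: (n.+1%:R : R) => x x0; field; rewrite gt_eqF.
apply: le_trans (ler_pM _ _ IHn B).
- by rewrite mulrA divfK// ?gt_eqF ?powR_gt0//.
- by rewrite divr_ge0 ?powR_ge0//; lra.
- by rewrite divr_ge0 ?powR_ge0.
Qed.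

(** When n grows by one the value grows by a partial sum of weights, so it does not decrease, and it
    starts at 1. This makes multiples of y_n = n supersolutions when theta_1 = 1. *)
Lemma sum_GLcoef_linear_ge1 theta n : 0 < theta <= 1 ->
  1 <= \sum_(0 <= k < n.+1) GLcoef theta k * (n.+1 - k)%:R.
Proof.
move=> t01; elim: n => [|n IHn]; first by rewrite big_nat1/= subn0 mulr1.
apply: le_trans IHn _; rewrite [leRHS]big_nat_recr//= -subr_ge0 -/(GLcoef theta n.+1).
rewrite [X in 0 <= X](_ : _ = \sum_(0 <= k < n.+2) GLcoef theta k); last first.
  rewrite [RHS]big_nat_recr//= -/(GLcoef theta n.+1) subSnn mulr1 addrAC -sumrB; congr (_ + _).
  apply: eq_big_nat => k /andP[_ kn].
  by rewrite -mulrBr (subSn (ltnW kn)) -natr1 addrAC subrr add0r mulr1.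
exact: sum_GLcoef_ge0.
Qed.

(** Comparison principle: if e <= y at all earlier indices, the terms with k >= 1 of the operator
    applied to e - y are products of two nonpositive factors, so w_0 = 1 leaves (sum_r A_r)(e_m -
    y_m) <= 0. *)
Lemma GL_comparison s (theta A : 'I_s.+1 -> R) (e y : nat -> R) (rho : R) N :
  (forall r, 0 < theta r <= 1) -> (forall r, 0 <= A r) -> 0 < A ord0 ->
  (forall n, (0 < n <= N)%N ->
    \sum_r A r * \sum_(0 <= k < n) GLcoef (theta r) k * e (n - k)%N <= rho) ->
  (forall n, (0 < n <= N)%N ->
    rho <= \sum_r A r * \sum_(0 <= k < n) GLcoef (theta r) k * y (n - k)%N) ->
  forall n, (0 < n <= N)%N -> e n <= y n.
Proof.
move=> t01 A0 A00 He Hy.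
have sumA : 0 < \sum_r A r.
  by rewrite big_ord_recl ltr_pwDl// sumr_ge0.
suff H n m : (m < n)%N -> (0 < m <= N)%N -> e m <= y m by move=> n; exact: H.
elim: n m => // n IHn m; rewrite ltnS => mn /andP[m0 mN].
rewrite -subr_le0 -(pmulr_rle0 _ sumA).
have := le_trans (He m _) (Hy m _); rewrite m0 mN => /(_ isT isT).
move=> ey; rewrite -subr_le0 -sumrB in ey; apply: le_trans ey.
rewrite mulr_suml; apply: ler_sum => r _.
rewrite -mulrBr -sumrB ler_wpM2l// big_ltn//= !mul1r subn0 lerDl.
rewrite big_nat_cond sumr_ge0// => k /andP[/andP[k0 km] _].
rewrite -mulrBr mulr_le0// ?GLcoef_le0// subr_le0 IHn ?subn_gt0 ?km//.
  by rewrite (leq_trans _ mn)// ltn_subrL k0.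
by rewrite (leq_trans (leq_subr _ _)).
Qed.

(** In both cases the first summand alone makes the chosen sequence a supersolution, the other
    summands being nonnegative. *)
Lemma GL_stability s (T CR : R) (theta a : 'I_s.+1 -> R) :
  0 < T -> (forall r, 0 < theta r <= 1) -> 0 < a ord0 ->
  (forall r, r != ord0 -> 0 <= a r) -> 0 <= CR ->
  exists C : R, forall N (e : nat -> R), (0 < N)%N ->
    (forall n, (0 < n <= N)%N ->
      \sum_r a r / tau T N `^ theta r *
        \sum_(0 <= k < n) GLcoef (theta r) k * e (n - k)%N <= CR * tau T N) ->
    forall n, (0 < n <= N)%N -> e n <= C * tau T N.
Proof.
move=> T0 t01 a0 a_ge0 CR0.
have tau_gt0 N : (0 < N)%N -> 0 < tau T N by move=> N0; rewrite divr_gt0// ltr0n.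
have age0 r : 0 <= a r by have [->|/a_ge0//] := eqVneq r ord0; exact: ltW.
have A0 N r : 0 <= a r / tau T N `^ theta r by rewrite divr_ge0// powR_ge0.
have A00 N : (0 < N)%N -> 0 < a ord0 / tau T N `^ theta ord0.
  by move=> N0; rewrite divr_gt0// powR_gt0// tau_gt0.
have /andP[t0] := t01 ord0; rewrite le_eqVlt => /predU1P[t1|t1].
  exists (CR * T / a ord0) => N e N0 He n nN.
  have tN := tau_gt0 _ N0.
  (* With this slope the first summand, whose factor is a_1 / tau, is at least CR tau; N tau = T
     then bounds the supersolution by a multiple of tau. *)
  pose lam := CR * tau T N * tau T N / a ord0.
  have lam0 : 0 <= lam by apply: divr_ge0; [apply: mulr_ge0; [apply: mulr_ge0|]|] => //; exact: ltW.
  apply: (@le_trans _ _ (lam * n%:R)); last first.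
    rewrite /lam [X in _ <= X](_ : _ = CR * tau T N * tau T N / a ord0 * N%:R).
      by rewrite ler_wpM2l// ler_nat; case/andP: nN.
    by rewrite /tau; field; rewrite pnatr_eq0 -lt0n N0 gt_eqF.
  apply: (GL_comparison (y := fun n => lam * n%:R) t01 (A0 N) (A00 N N0) He) nN => m /andP[m0 mN].
  rewrite big_ord_recl; apply: ler_wpDr.
    apply: sumr_ge0 => r _; apply: mulr_ge0 => //.
    rewrite (eq_bigr _ (fun _ _ => mulrCA _ _ _)) -mulr_sumr mulr_ge0//.
    by rewrite -(prednK m0) (le_trans ler01)// sum_GLcoef_linear_ge1.
  rewrite (eq_bigr _ (fun _ _ => mulrCA _ _ _)) -mulr_sumr [leRHS]mulrA.
  rewrite [leLHS](_ : _ = a ord0 / tau T N `^ theta ord0 * lam * 1).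
    apply: ler_wpM2l; first exact: mulr_ge0.
    by rewrite -(prednK m0) sum_GLcoef_linear_ge1.
  rewrite t1 powRr1 ?ltW// mulr1 /lam; field.
  by rewrite !gt_eqF.
set th := theta ord0 in t0 t1 *.
(* A lower bound, uniform in m <= N, for a_1 tau^(-theta) times the m-th partial sum of weights:
   this product is at least a_1 (1 - theta) (m tau)^(-theta), and m tau <= T. *)
pose c := a ord0 * (1 - th) / T `^ th.
have c0 : 0 < c by rewrite divr_gt0 ?powR_gt0// mulr_gt0// subr_gt0.
exists (CR / c) => N e N0 He n nN.
have tN := tau_gt0 _ N0.
have lam0 : 0 <= CR / c * tau T N by rewrite mulr_ge0 ?(ltW tN)// divr_ge0// ltW.
apply: (GL_comparison (y := fun=> CR / c * tau T N) t01 (A0 N) (A00 N N0) He) nN => m /andP[m0 mN].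
rewrite big_ord_recl; apply: ler_wpDr.
  apply: sumr_ge0 => r _; apply: mulr_ge0 => //.
  by rewrite -mulr_suml mulr_ge0// sum_GLcoef_ge0.
rewrite -mulr_suml [leRHS]mulrA.
rewrite [leLHS](_ : _ = c * (CR / c * tau T N)); last by field; rewrite gt_eqF.
rewrite ler_wpM2r// -(prednK m0).
have b := @sum_GLcoef_ge th m.-1; rewrite t0 t1 in b.
apply: (@le_trans _ _ (a ord0 / tau T N `^ th * ((1 - th) / m.-1.+1%:R `^ th))); last first.
  by rewrite ler_wpM2l ?b// divr_ge0 ?powR_ge0.
rewrite prednK// mulrACA -invfM -powRM ?(ltW tN)// ?ler0n//.
apply: ler_wpM2l; first by rewrite mulr_ge0 ?(ltW a0)// subr_ge0 ltW.
have tm0 : 0 < tau T N * m%:R by rewrite mulr_gt0 ?ltr0n.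
rewrite lef_pV2 ?posrE ?powR_gt0//.
apply: ge0_ler_powR; rewrite ?nnegrE; [exact: ltW..|].
by rewrite /tau mulrAC ler_pdivrMr ?ltr0n// ler_pM2l// ler_nat.
Qed.

End GL.

(** * Square-integrable functions *)

Section integrable_real.
Context d (T : measurableType d) (R : realType) (mu : {measure set T -> \bar R}).
Variables (D : set T) (mD : measurable D).
Implicit Types f g : T -> R.

Lemma integrable_EFinD f g : mu.-integrable D (EFin \o f) ->
  mu.-integrable D (EFin \o g) -> mu.-integrable D (EFin \o (fun x => f x + g x)).
Proof. by move=> fi gi; rewrite (_ : _ \o _ = (EFin \o f) \+ (EFin \o g))%E//; exact: integrableD. Qed.

Lemma integrable_EFinB f g : mu.-integrable D (EFin \o f) ->
  mu.-integrable D (EFin \o g) -> mu.-integrable D (EFin \o (fun x => f x - g x)).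
Proof. by move=> fi gi; rewrite (_ : _ \o _ = (EFin \o f) \- (EFin \o g))%E//; exact: integrableB. Qed.

Lemma integrable_EFinZ (c : R) f : mu.-integrable D (EFin \o f) ->
  mu.-integrable D (EFin \o (fun x => c * f x)).
Proof.
move=> fi; rewrite (_ : _ \o _ = fun x => c%:E * (EFin \o f) x)%E//.
exact: integrableZl.
Qed.

Lemma integrable_bounded f (C : R) : (mu D < +oo)%E -> measurable_fun D f ->
  (forall x, D x -> `|f x| <= C) -> mu.-integrable D (EFin \o f).
Proof.
move=> Doo mf fC; apply: measurable_bounded_integrable => //.
by exists C; split; [exact: num_real|move=> x Cx y Dy; exact: le_trans (fC y Dy) (ltW Cx)].
Qed.

End integrable_real.

Section square_integrable.
Context d (T : measurableType d) (R : realType) (mu : {measure set T -> \bar R}).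
Variables (D : set T) (mD : measurable D).
Implicit Types f g h : T -> R.

(** These are functions and not classes modulo null sets, so [nrm] is a seminorm only and
    [cauchy_schwarz] treats a factor of norm 0 separately. *)
Definition sqint f :=
  measurable_fun D f /\ mu.-integrable D (EFin \o (fun x => f x ^+ 2)).

Definition inner f g : R := \int[mu]_(x in D) (f x * g x).

Lemma sqint_mul f g : sqint f -> sqint g ->
  mu.-integrable D (EFin \o (fun x => f x * g x)).
Proof.
move=> [mf f2] [mg g2].
apply: (@le_integrable _ _ _ mu D _ _ (EFin \o (fun x => f x ^+ 2 + g x ^+ 2))) => //.
- by apply/measurable_EFinP; exact: measurable_funM.
- move=> x _ /=; rewrite lee_fin normrM (ger0_norm (addr_ge0 (sqr_ge0 _) (sqr_ge0 _))).
  rewrite -(real_normK (num_real (f x))) -(real_normK (num_real (g x))).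
  have := normr_ge0 (f x); have := normr_ge0 (g x).
  by move: `|f x| `|g x| => a b a0 b0; nra.
- exact: integrable_EFinD.
Qed.

Lemma sqintD f g : sqint f -> sqint g -> sqint (fun x => f x + g x).
Proof.
move=> qf qg; have qfg := sqint_mul qf qg.
case: qf qg => [mf f2] [mg g2]; split; first exact: measurable_funD.
rewrite (_ : (fun x => _) = fun x => f x ^+ 2 + 2 * (f x * g x) + g x ^+ 2).
  apply: integrable_EFinD => //; apply: integrable_EFinD => //.
  exact: integrable_EFinZ.
by apply/funext => x; ring.
Qed.

Lemma sqintZ (c : R) f : sqint f -> sqint (fun x => c * f x).
Proof.
move=> [mf f2]; split; first exact: measurable_funM.
under [X in _ \o X]eq_fun do rewrite exprMn.
exact: integrable_EFinZ.
Qed.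

Lemma sqintB f g : sqint f -> sqint g -> sqint (fun x => f x - g x).
Proof.
move=> qf qg; have := sqintD qf (sqintZ (-1) qg).
by rewrite (_ : (fun x => _ + _) = (fun x => f x - g x))//; apply/funext => x; rewrite mulN1r.
Qed.

Lemma sqint0 : sqint (fun=> 0).
Proof.
split; first exact: measurable_cst.
rewrite (_ : EFin \o _ = cst 0%E); first exact: integrable0.
by apply/funext => x /=; rewrite expr0n.
Qed.

Lemma sqint_sum I (r : seq I) (F : I -> T -> R) :
  (forall i, sqint (F i)) -> sqint (fun x => \sum_(i <- r) F i x).
Proof.
move=> qF; elim: r => [|i r IHr].
  by under eq_fun do rewrite big_nil; exact: sqint0.
by under eq_fun do rewrite big_cons; exact: sqintD.
Qed.

Lemma eq_sqint f g : {in D, f =1 g} -> sqint f -> sqint g.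
Proof.
move=> fg [mf f2]; split; first exact: (eq_measurable_fun f).
by apply: eq_integrable f2 => // x xD /=; rewrite fg.
Qed.

Lemma eq_inner f f' g : {in D, f =1 f'} -> inner f g = inner f' g.
Proof. by move=> ff'; apply: eq_Rintegral => x xD; rewrite ff'. Qed.

Lemma innerC f g : inner f g = inner g f.
Proof. by apply: eq_Rintegral => x _; rewrite mulrC. Qed.

Lemma innerDl f g h : sqint f -> sqint g -> sqint h ->
  inner (fun x => f x + g x) h = inner f h + inner g h.
Proof.
move=> qf qg qh; rewrite -RintegralD//; [|exact: sqint_mul..].
by apply: eq_Rintegral => x _; rewrite mulrDl.
Qed.

Lemma innerZl c f g : sqint f -> sqint g ->
  inner (fun x => c * f x) g = c * inner f g.
Proof.
move=> qf qg; rewrite -RintegralZl//; last exact: sqint_mul.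
by apply: eq_Rintegral => x _; rewrite mulrA.
Qed.

Lemma innerBl f g h : sqint f -> sqint g -> sqint h ->
  inner (fun x => f x - g x) h = inner f h - inner g h.
Proof.
move=> qf qg qh; rewrite -RintegralB//; [|exact: sqint_mul..].
by apply: eq_Rintegral => x _; rewrite mulrBl.
Qed.

Lemma inner0l g : inner (fun=> 0) g = 0.
Proof.
rewrite /inner; under eq_Rintegral do rewrite mul0r.
by rewrite Rintegral_cst// mul0r.
Qed.

Lemma inner_suml I (r : seq I) (F : I -> T -> R) g :
  (forall i, sqint (F i)) -> sqint g ->
  inner (fun x => \sum_(i <- r) F i x) g = \sum_(i <- r) inner (F i) g.
Proof.
move=> qF qg; elim: r => [|i r IHr].
  by rewrite big_nil -[RHS](inner0l g); apply: eq_inner => x _; rewrite big_nil.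
rewrite big_cons -IHr -innerDl//; last exact: sqint_sum.
by apply: eq_inner => x _; rewrite big_cons.
Qed.

Lemma inner_ge0 f : 0 <= inner f f.
Proof. by apply: Rintegral_ge0 => x _; rewrite -expr2 sqr_ge0. Qed.

Definition nrm f := Num.sqrt (inner f f).

Lemma nrm_ge0 f : 0 <= nrm f. Proof. exact: sqrtr_ge0. Qed.

Lemma nrm_sqr f : nrm f ^+ 2 = inner f f.
Proof. by rewrite sqr_sqrtr// inner_ge0. Qed.

Lemma inner_comb_ge0 f g s t : sqint f -> sqint g ->
  0 <= s ^+ 2 * inner f f + s * t * inner f g *+ 2 + t ^+ 2 * inner g g.
Proof.
move=> qf qg; have := inner_ge0 (fun x => s * f x + t * g x).
have qs := sqintZ s qf; have qt := sqintZ t qg.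
have qst := sqintD qs qt.
rewrite innerDl// !innerZl// ![inner _ (fun x => _ + _)]innerC.
rewrite !innerDl// !innerZl// [inner g f]innerC.
by congr (0 <= _); ring.
Qed.

Lemma cauchy_schwarz f g : sqint f -> sqint g -> `|inner f g| <= nrm f * nrm g.
Proof.
move=> qf qg; rewrite -ler_sqr ?nnegrE ?mulr_ge0 ?nrm_ge0// exprMn !nrm_sqr.
rewrite real_normK ?num_real//.
have := inner_ge0 g; rewrite le_eqVlt => /predU1P[g0|g0]; last first.
  have := inner_comb_ge0 (inner g g) (- inner f g) qf qg.
  rewrite [X in 0 <= X](_ : _ = inner g g * (inner f f * inner g g - inner f g ^+ 2)); last by ring.
  by rewrite pmulr_rge0// subr_ge0.
have [->|p0] := eqVneq (inner f g) 0; first by rewrite expr0n/= mulr_ge0 ?inner_ge0.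
(* For (g,g) = 0 the quadratic form is affine in t, and this t makes it equal to -(f,f) - 2, which
   is negative. *)
have := inner_comb_ge0 1 (- (inner f f + 1) / inner f g) qf qg.
rewrite -g0 [X in 0 <= X](_ : _ = - inner f f - 2); last by field.
have := inner_ge0 f; lra.
Qed.

End square_integrable.

(** * Lebesgue measure on tuples *)

Section lebesgue_affine.
Context {R : realType}.
Notation mR := (measurableTypeR R).
Notation mu := (@lebesgue_measure R).

Lemma measurable_addr (c : R) : measurable_fun setT (fun x : mR => x + c : mR).
Proof. exact: measurable_funD. Qed.

(** By uniqueness of Lebesgue measure it is enough to compare on half-open intervals. *)
Lemma lebesgue_measureD (c : R) (A : set R) : measurable A ->
  pushforward mu (fun x : mR => x + c : mR) A = mu A.
Proof.
move=> mA; apply/esym/lebesgue_measure_unique => //=.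
  exact: measurable_addr.
move=> _ _ [[a b]] _ <-.
rewrite /pushforward (_ : _ @^-1` _ = `]a - c, b - c]%classic); last first.
  by apply/seteqP; split => x /=; rewrite !in_itv/= ltrBlDr lerBrDr.
by rewrite !lebesgue_measure_itv/= !lte_fin ltrD2r -!EFinB [b - c - _](_ : _ = b - a)//; ring.
Qed.

Lemma ge0_integral_addr (c : R) (f : R -> \bar R) : measurable_fun setT f ->
  (forall x, 0 <= f x)%E -> (\int[mu]_x f (x + c)%R = \int[mu]_x f x)%E.
Proof.
move=> mf f0.
rewrite -[LHS](@ge0_integral_pushforward _ _ _ _ _ (fun x : mR => x + c : mR)
  (measurable_addr c) mu setT f)//.
apply: eq_measure_integral => /=; first exact: measurable_addr.
by move=> _ A mA _; exact: lebesgue_measureD.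
Qed.

End lebesgue_affine.

Section tuple_shift.
Context {R : realType}.
Notation mR := (measurableTypeR R).
Notation mu := (@lebesgue_measure R).

Definition tshift n (c : 'I_n -> R) (t : n.-tuple mR) : n.-tuple mR :=
  [tuple (tnth t i + c i : mR) | i < n].

Lemma measurable_tshift n (c : 'I_n -> R) : measurable_fun setT (tshift c).
Proof.
apply/measurable_fun_tnthP => i.
rewrite (_ : _ \o _ = fun t => tnth t i + c i).
  by apply: measurable_funD => //; exact: measurable_tnth.
by apply/funext => t /=; rewrite tnth_mktuple.
Qed.

(** Induction on n: Tonelli splits off the first coordinate, on which translation invariance on the
    line applies. *)
Lemma ge0_integral_tshift n (c : 'I_n -> R) (F : n.-tuple mR -> \bar R) :
  measurable_fun setT F -> (forall t, 0 <= F t)%E ->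
  (\int[lebesgue_tuple n]_t F (tshift c t) = \int[lebesgue_tuple n]_t F t)%E.
Proof.
elim: n c F => [|n IHn] c F mF F0.
  by apply: eq_integral => t _; congr F; rewrite tuple0; apply/esym/tuple0.
have tonelli (G : n.+1.-tuple mR -> \bar R) : measurable_fun setT G ->
    (forall t, 0 <= G t)%E ->
    (\int[lebesgue_tuple n.+1]_t G t =
     \int[mu]_x \int[lebesgue_tuple n]_t G (tcons (x, t)))%E.
  move=> mG G0.
  transitivity (\int[leb_step (lebesgue_tuple n)]_t G t)%E => //.
  rewrite [LHS](@ge0_integral_pushforward _ _ _ _ _ (@tcons R n)
    (@measurable_tcons R n) (mu \x lebesgue_tuple n)%E setT G)//.
  rewrite preimage_setT fubini_tonelli1//.
  by apply: measurableT_comp => //; exact: measurable_tcons.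
  by move=> x; exact: G0.
have mFc : measurable_fun setT (F \o tcons (n:=n)).
  by apply: measurableT_comp => //; exact: measurable_tcons.
rewrite !tonelli//; last by apply: measurableT_comp => //; exact: measurable_tshift.
pose G x := (\int[lebesgue_tuple n]_t F (tcons (x, t)))%E.
rewrite -[RHS](@ge0_integral_addr _ (c ord0) G); last 2 first.
- by apply: (measurable_fun_fubini_tonelli_F (F \o tcons (n:=n))) => // p; exact: F0.
- by move=> x; exact: integral_ge0.
apply: eq_integral => x _.
rewrite /G -(IHn (fun i => c (lift ord0 i)) (fun t => F (tcons (x + c ord0, t))))//.
  apply: eq_integral => t _; congr F; apply: eq_from_tnth => i.
  rewrite tnth_mktuple; case: (unliftP ord0 i) => [j|] -> //=.
  by rewrite !tnthS/= tnth_mktuple.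
exact: (measurableT_comp mFc (pair1_measurable _)).
Qed.

End tuple_shift.

Section row_measurable.
Context {R : realType} {d : nat}.
Notation mR := (measurableTypeR R).
Notation Rd := 'rV[R]_d.
Notation lam := (@lebesgue_tuple R d).

(** The sigma-algebra on tuples is a product, while the topology on rows comes from the maximum
    norm. An open set is a countable union of balls with rational centre and radius 1/(k + 1), and
    each ball is a box. *)
Lemma measurable_row_open (U : set Rd) : open U ->
  measurable ((@row_of_tuple R d) @^-1` U).
Proof.
move=> oU.
pose q (p : 'rV[rat]_d * nat) : Rd := map_mx ratr p.1.
pose e (p : 'rV[rat]_d * nat) : R := p.2.+1%:R^-1.
pose F p : set (d.-tuple mR) :=
  if pselect (ball (q p) (e p) `<=` U) then (@row_of_tuple R d) @^-1` (ball (q p) (e p))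
  else set0.
have -> : (@row_of_tuple R d) @^-1` U = \bigcup_p F p.
  apply/seteqP; split => [t /= Ut|t [p _]]; last first.
    by rewrite /F; case: pselect => // pU /pU.
  have /nbhs_ballP[r /= r0 rU] : nbhs (row_of_tuple t) U by exact: open_nbhs_nbhs.
  (* Radii below r/2: a ball that contains the point then lies in the ball of radius r around it. *)
  have r20 : 0 < r / 2 by rewrite divr_gt0.
  have [k _ kr] := near_infty_natSinv_lt (PosNum r20).
  have /choice[s Hs] : forall i : 'I_d, exists s : rat, ball (tnth t i : R) (k.+1%:R^-1) (ratr s : R).
    move=> i; have [||x [] bx [s _ sx]] := @dense_rat R (ball (tnth t i : R) (k.+1%:R^-1)).
    - by exists (tnth t i); apply: ballxx; rewrite invr_gt0 ltr0n.
    - exact: ball_open.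
    by exists s; rewrite sx.
  have k0 : 0 < k.+1%:R^-1 :> R by rewrite invr_gt0 ltr0n.
  have qt : ball (q (\row_i s i, k)) (k.+1%:R^-1) (row_of_tuple t).
    by split => // i j; rewrite !mxE; apply: ball_sym.
  exists (\row_i s i, k) => //; rewrite /F; case: pselect => // -[].
  move=> y qy; apply: rU; apply: (@le_ball _ _ _ (k.+1%:R^-1 + k.+1%:R^-1)).
    have : k.+1%:R^-1 < r / 2 := kr k (leqnn k).
    by move: (k.+1%:R^-1) => x; lra.
  by apply: ball_triangle qy; exact: ball_sym.
apply: countable_bigcupT_measurable => [|p]; first exact: countableP.
rewrite /F; case: pselect => [pU|npU]; last exact: measurable0.
rewrite (_ : _ @^-1` _ = \bigcap_(i in [set: 'I_d])
    ((@tnth _ mR ^~ i) @^-1` (ball (q p 0 i) (e p)))); last first.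
  apply/seteqP; split => t /=.
    by move=> [e0 H] i Ti; have := H 0 i; rewrite [row_of_tuple t 0 i]mxE.
  move=> H; split; first by rewrite invr_gt0 ltr0n.
  by move=> i j; rewrite [row_of_tuple t i j]mxE ord1; exact: H.
apply: fin_bigcap_measurable => // i _.
rewrite -[X in measurable X]setTI; apply: measurable_tnth => //.
exact: measurable_ball.
Qed.

Lemma measurable_row_continuous (v : Rd -> R) : continuous v ->
  measurable_fun setT (v \o @row_of_tuple R d).
Proof.
move=> cv; apply: (measurability _ (RGenOpens.measurableE R)).
move=> _ [_ [a [b ->] <-]].
rewrite setTI comp_preimage; apply: measurable_row_open.
by move/continuousP : cv; apply; exact: itv_open.
Qed.

Lemma lebesgue_row_bounded (A : set Rd) : bounded_set A ->
  measurable ((@row_of_tuple R d) @^-1` A) ->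
  (lam ((@row_of_tuple R d) @^-1` A) < +oo)%E.
Proof.
move=> [M [_ MA]] mA.
(* [bounded_set] gives a bound only by numbers strictly above M, hence the 1. *)
pose B := `|M| + 1.
have B0 : 0 <= B by rewrite addr_ge0.
apply: (@le_lt_trans _ _ (lam [set t | forall i : 'I_d, - B <= tnth t i <= B])).
  apply: le_measure; rewrite ?inE//.
    rewrite (_ : [set _ | _] = \bigcap_(i in [set: 'I_d])
        ((@tnth _ mR ^~ i) @^-1` `[- B, B]%classic)).
      apply: fin_bigcap_measurable => // i _.
      by rewrite -[X in measurable X]setTI; exact: measurable_tnth.
    apply/seteqP; split => t /= H i; first by move=> _; rewrite /= in_itv; exact: H.
    by have := H i Logic.I; rewrite /= in_itv.
  move=> t /= At i.
  have : `|row_of_tuple t| <= B.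
    by apply: MA => //; rewrite /B (le_lt_trans (ler_norm _))// ltrDl.
  rewrite [`|_|]mx_normrE => nB.
  rewrite -ler_norml (le_trans _ nB)//.
  have := @le_bigmax _ _ _ (0 : R) (fun ij : 'I_1 * 'I_d => `|(row_of_tuple t) ij.1 ij.2|) (0, i).
  by rewrite /= mxE.
rewrite (lebesgue_tuple_box (l := fun=> - B) (r := fun=> B)) ?ltry//.
by move=> i; rewrite ge0_cp.
Qed.

End row_measurable.

(** * One-variable calculus with a singular kernel *)

Section derive_under.
Context {R : realType}.

(** A bounded factor times a fixed integrable kernel, so C |k| dominates both the integrand and its
    derivative. The kernel will be a singular power, a function on an interval, or a test
    function. *)
Lemma derive_under_kernel d (Y : measurableType d)
  (nu : {measure set Y -> \bar R}) (f df : R -> Y -> R) (D : set Y) (k : Y -> R)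
  (C x0 u v : R) :
  measurable D -> u < x0 < v ->
  nu.-integrable D (EFin \o k) ->
  (forall x, u < x < v -> measurable_fun D (f x)) ->
  (forall x y, u < x < v -> D y ->
    [/\ is_derive x 1 (f ^~ y) (df x y), `|f x y| <= C & `|df x y| <= C]) ->
  is_derive x0 1 (fun x => \int[nu]_(y in D) (f x y * k y))
    (\int[nu]_(y in D) (df x0 y * k y)).
Proof.
move=> mD /andP[ux xv] ik mf H.
have Ix0 : `]u, v[%classic x0 by rewrite /= in_itv/= ux.
pose h x y := f x y * k y.
have dh x y : `]u, v[%classic x -> D y -> is_derive x 1 (h ^~ y) (df x y * k y).
  rewrite /= in_itv/= => xuv Dy; have [fx _ _] := H x y xuv Dy.
  rewrite (_ : h ^~ y = (k y \*: (f ^~ y)))%R; last first.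
    by apply/funext => z; rewrite /h /= mulrC.
  by rewrite mulrC; exact: is_deriveZ.
have intG : nu.-integrable D (EFin \o (fun y => C * `|k y|)).
  by apply: integrable_EFinZ => //; exact: integrable_norm.
have inth x : `]u, v[%classic x -> nu.-integrable D (EFin \o h x).
  rewrite /= in_itv/= => xuv.
  apply: (le_integrable mD _ _ intG).
    apply/measurable_EFinP; apply: measurable_funM; first exact: mf.
    by move/integrableP : ik => [/measurable_EFinP].
  move=> y Dy /=; have [_ fC _] := H x y xuv Dy.
  by rewrite lee_fin !normrM normr_id ler_wpM2r// (le_trans fC)// ler_norm.
have Gge0 y : 0 <= `|C * `|k y| | by [].
have G_ub x y : `]u, v[%classic x -> D y -> `|partial1of2 h x y| <= `|C * `|k y| |.
  move=> xI Dy; rewrite partial1of2E.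
  have dhx := dh x y xI Dy.
  rewrite derive_val !normrM normr_id ler_wpM2r//.
  have [_ _ dfC] := H x y xI Dy.
  by rewrite (le_trans dfC)// ler_norm.
have dh' x y : `]u, v[%classic x -> D y -> derivable (h ^~ y) x 1.
  by move=> xI Dy; have [] := dh x y xI Dy.
have := derivable_under_integral mD Ix0 inth dh' Gge0 (integrable_norm intG) G_ub.
have := differentiation_under_integral mD Ix0 inth dh' Gge0 (integrable_norm intG) G_ub.
move=> E dF; apply: DeriveDef => //; rewrite -derive1E E.
apply: eq_Rintegral => y; rewrite inE => Dy.
have dhx := dh x0 y Ix0 Dy.
by rewrite partial1of2E derive_val.
Qed.

End derive_under.

Section one_variable.
Context {R : realType}.
Notation mu := (@lebesgue_measure R).
Implicit Types (f F : R -> R) (a b c p x z : R).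

Lemma is_derive_powRN z p : 0 < z ->
  is_derive z 1 (fun z => z `^ (- p)) (- p * z `^ (- (p + 1))).
Proof. by move=> z0; rewrite opprD; exact: is_derive1_powR. Qed.

Lemma is_derive_continuous f x (df : R) : is_derive x 1 f df -> {for x, continuous f}.
Proof. by move=> [fx _]; exact/differentiable_continuous/derivable1_diffP. Qed.

Lemma is_derive_eq0_cst f a b : (forall x, a < x < b -> is_derive x 1 f 0) ->
  forall x y, a < x < b -> a < y < b -> f x = f y.
Proof.
move=> f0 x y; wlog xy : x y / x < y.
  move=> H xab yab; have [xy|yx|->//] := ltgtP x y; first exact: H.
  by apply/esym; exact: H.
move=> /andP[ax xb] /andP[ay yb].
have [||c cxy] := @MVT _ f (fun=> 0) _ _ xy; last by rewrite mul0r => /eqP; rewrite subr_eq0 => /eqP.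
  move=> z; rewrite in_itv/= => /andP[xz zy]; apply: f0.
  by rewrite (lt_trans ax)// (lt_trans zy).
apply: continuous_in_subspaceT => z; rewrite inE/= in_itv/= => /andP[xz zy].
apply: (@is_derive_continuous _ _ 0); apply: f0.
by rewrite (lt_le_trans ax)// (le_lt_trans zy).
Qed.

Lemma near_is_derive f F x (df : R) : {near x, f =1 F} ->
  is_derive x 1 f df -> is_derive x 1 F df.
Proof.
move=> E [d1 d2]; apply: DeriveDef; first exact: (@near_eq_derivable _ _ _ f F x 1 E).
by rewrite -(near_eq_derive _ E).
Qed.

(** Fundamental theorem on an open interval: f may be unbounded at the ends, where F has only
    one-sided limits. F is compared with the indefinite integral G of f, which is continuous up to
    the ends; F - G has zero derivative inside. *)
Lemma integral_derive_oo f F a b (la lb : R) : a < b ->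
  mu.-integrable `]a, b[ (EFin \o f) ->
  (forall x, a < x < b -> {for x, continuous f}) ->
  (forall x, a < x < b -> is_derive x 1 F (f x)) ->
  F x @[x --> a^'+] --> la -> F x @[x --> b^'-] --> lb ->
  \int[mu]_(x in `]a, b[) f x = lb - la.
Proof.
move=> ab intf cf dF Fa Fb.
(* Extension by zero, since the indefinite integral is taken over closed intervals. *)
pose g := f \_ `]a, b[.
have intg : mu.-integrable setT (EFin \o g).
  by rewrite -restrict_EFin; apply/integrable_restrict => //=; rewrite setTI.
have intgab : mu.-integrable `[a, b] (EFin \o g) by exact: integrableS intg.
pose G x := \int[mu]_(t in `[a, x]) g t.
have [_ Ga Gb] := (continuous_within_itvP G ab).1 (parameterized_integral_continuous (ltW ab) intgab).
have dG x : a < x < b -> is_derive x 1 G (f x).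
  move=> /andP[ax xb].
  have cg : {for x, continuous g}.
    have xab : x \in `]a, b[ by rewrite in_itv/= ax.
    have gE z : z \in `]a, b[ -> g z = f z by move=> zab; rewrite /g patchE mem_set.
    change (g z @[z --> x] --> g x); rewrite (gE x xab).
    apply: cvg_trans (cf x _); last by rewrite ax.
    apply: near_eq_cvg; near=> z; apply/esym/gE.
    by near: z; exact: near_in_itvoo.
  have [dGx Gx] := continuous_FTC1_closed xb intgab ax cg.
  apply: DeriveDef => //; rewrite -derive1E Gx /g patchE mem_set//=.
  by rewrite in_itv/= ax.
have d0 x : a < x < b -> is_derive x 1 (F - G)%R 0.
  move=> xab; have := dF x xab; have := dG x xab => dGx dFx.
  by rewrite -(subrr (f x)); exact: is_deriveB.
pose m := (a + b) / 2.
have mab : a < m < b by rewrite /m; apply/andP; split; lra.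
have cst_near x : a < x < b -> F x - G x = F m - G m.
  by move=> xab; exact: (is_derive_eq0_cst d0 xab mab).
have Ga0 : G a = 0 by rewrite /G set_itv1 Rintegral_set1.
have ca : F m - G m = la - G a.
  have h1 : F x - G x @[x --> a^'+] --> F m - G m.
    apply: cvg_trans (@cvg_cst _ (F m - G m) _ (a^'+) _).
    apply: near_eq_cvg; near=> z; apply/esym/cst_near; apply/andP; split; near: z.
      exact: nbhs_right_gt.
    exact: nbhs_right_lt.
  have h2 : F x - G x @[x --> a^'+] --> la - G a by exact: cvgB.
  by rewrite -(cvg_lim (@Rhausdorff R) h1) (cvg_lim (@Rhausdorff R) h2).
have cb : F m - G m = lb - G b.
  have h1 : F x - G x @[x --> b^'-] --> F m - G m.
    apply: cvg_trans (@cvg_cst _ (F m - G m) _ (b^'-) _).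
    apply: near_eq_cvg; near=> z; apply/esym/cst_near; apply/andP; split; near: z.
      exact: nbhs_left_gt.
    exact: nbhs_left_lt.
  have h2 : F x - G x @[x --> b^'-] --> lb - G b by exact: cvgB.
  by rewrite -(cvg_lim (@Rhausdorff R) h1) (cvg_lim (@Rhausdorff R) h2).
have -> : \int[mu]_(x in `]a, b[) f x = G b.
  rewrite /G -Rintegral_itv_obnd_cbnd; last exact: integrableS intg.
  rewrite -Rintegral_itv_bndo_bndc; last exact: integrableS intg.
  by apply: eq_Rintegral => x xab; rewrite /g patchE xab.
by move: cb; rewrite ca Ga0; lra.
Unshelve. all: by end_near. Qed.

(** Monotone convergence: the antiderivative z^(1-p)/(1-p) is nonnegative, so its value at M bounds
    the integral over every interval that stays away from 0. *)
Lemma integrable_powRN p (M : R) : 0 < p < 1 ->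
  mu.-integrable `]0, M[ (EFin \o (fun z => z `^ (- p))).
Proof.
move=> /andP[p0 p1]; have [M0|M0] := leP M 0.
  by rewrite set_itv_ge ?bnd_simp -?leNgt//; exact: integrable_set0.
pose f z := z `^ (- p); pose F z := z `^ (- (p - 1)) / (1 - p).
have dF z : 0 < z -> is_derive z 1 F (f z).
  move=> z0; have d1 := is_derive_powRN (p - 1) z0.
  rewrite /F; apply: is_derive_eq; rewrite /GRing.scale/= subrK /f.
  by field; rewrite subr_eq0 gt_eqF.
(* With n + 2 the left end is strictly below M already for n = 0. *)
pose A n := `](M / n.+2%:R), M[%classic : set R.
have A0 n : 0 < M / n.+2%:R by rewrite divr_gt0.
have AM n : M / n.+2%:R < M by rewrite ltr_pdivrMr// ltr_pMr// ltr1n.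
have fA n x : A n x -> 0 < x.
  by rewrite /A/= in_itv/= => /andP[/(lt_trans (A0 n))].
have UA : `]0, M[%classic = \bigcup_n A n.
  apply/seteqP; split => [x|x [n _]] /=; rewrite !in_itv/=; last first.
    by move=> Ax; rewrite (fA _ _ Ax); move: Ax; rewrite /A /= in_itv/= => /andP[].
  move=> /andP[x0 xM].
  have xM0 : 0 < x / M by rewrite divr_gt0.
  have [k _ kx] := near_infty_natSinv_lt (PosNum xM0).
  exists k => //; rewrite /A /= in_itv/= xM andbT.
  have : k.+2%:R^-1 < x / M := kx k.+1 (leqnSn k).
  by rewrite ltr_pdivlMr// mulrC.
have cf z : 0 < z -> {for z, continuous f}.
  by move=> z0; exact: is_derive_continuous (is_derive_powRN p z0).
have mf : measurable_fun `]0, M[ f.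
  apply: open_continuous_measurable_fun; first exact: itv_open.
  by move=> x; rewrite inE/= in_itv/= => /andP[/cf].
have intA n : mu.-integrable (A n) (EFin \o f).
  apply: (@integrableS _ _ _ mu `[M / n.+2%:R, M]) => //.
    exact: measurable_itv.
    exact: subset_itv_oo_cc.
  apply: continuous_compact_integrable; first exact: segment_compact.
  apply: continuous_in_subspaceT => x; rewrite inE/= in_itv/= => /andP[nx _].
  by apply: cf; exact: lt_le_trans nx.
have ubA n : (\int[mu]_(x in A n) (f x)%:E <= (F M)%:E)%E.
  have fin : (\int[mu]_(x in A n) (f x)%:E)%E \is a fin_num.
    by apply: integrable_fin_num; [exact: measurable_itv|exact: intA].
  rewrite -(fineK fin).
  rewrite lee_fin [leLHS](_ : _ = F M - F (M / n.+2%:R)).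
    by rewrite lerBlDr lerDl /F divr_ge0 ?powR_ge0// subr_ge0 ltW.
  apply: (integral_derive_oo (AM n) (intA n)).
  - by move=> x /andP[nx _]; apply: cf; exact: lt_trans nx.
  - by move=> x /andP[nx _]; apply: dF; exact: lt_trans nx.
  - by apply: cvg_at_right_filter; exact: is_derive_continuous (dF _ (A0 n)).
  - by apply: cvg_at_left_filter; exact: is_derive_continuous (dF _ M0).
apply/integrableP; split; first exact/measurable_EFinP.
under eq_integral do rewrite gee0_abs ?lee_fin ?powR_ge0//.
apply: (@le_lt_trans _ _ (F M)%:E); last by rewrite ltry.
rewrite UA.
have cvgA : (\int[mu]_(x in A i) (f x)%:E @[i --> \oo] --> \int[mu]_(x in \bigcup_i A i) (f x)%:E)%E.
  apply: (@ge0_nondecreasing_set_cvg_integral _ (measurableTypeR R) _ A (EFin \o f) mu).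
  - apply/nondecreasing_seqP => n; rewrite subsetEset; apply: subset_itvr.
    by rewrite bnd_simp ler_pM2l// lef_pV2 ?posrE// ler_nat.
  - by move=> n; exact: measurable_itv.
  - move=> n; apply/measurable_EFinP; apply: measurable_funS mf => //.
    by move=> x Ax; rewrite UA; exists n.
  - by move=> n x _; rewrite lee_fin powR_ge0.
by apply: cvge_le cvgA; apply: nearW => n; exact: ubA.
Qed.

Lemma ge0_integral_reflect (g : R -> \bar R) c : measurable_fun setT g ->
  (forall x, 0 <= g x)%E -> (\int[mu]_x g (c - x)%R = \int[mu]_x g x)%E.
Proof.
move=> mg g0; rewrite -[RHS](ge0_integral_addr c)//.
pose gc x := g (x + c).
transitivity (\int[mu]_x gc (- x)%R)%E.
  by apply: eq_integral => x _; rewrite /gc addrC.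
have mgc : measurable_fun setT gc.
  by apply: measurableT_comp => //; exact: measurable_addr.
rewrite -[LHS](@ge0_integral_pushforward _ _ _ _ _ (-%R : measurableTypeR R -> measurableTypeR R)
  _ mu setT gc)//; last by move=> x _; exact: g0.
apply: eq_measure_integral => /=.
by move=> A mA _; exact: lebesgue_measureN.
Qed.

Lemma integral_reflect (f : R -> R) c : measurable_fun setT f ->
  \int[mu]_x f (c - x) = \int[mu]_x f x.
Proof.
move=> mf.
rewrite /Rintegral; congr fine; rewrite integralE [RHS]integralE; congr (_ - _)%E.
  rewrite -[RHS](ge0_integral_reflect c)//; last by apply: measurable_funepos; exact/measurable_EFinP.
  by apply: eq_integral => x _; rewrite [LHS]funeposE [RHS]funeposE.
rewrite -[RHS](ge0_integral_reflect c)//; last by apply: measurable_funeneg; exact/measurable_EFinP.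
by apply: eq_integral => x _; rewrite [LHS]funenegE [RHS]funenegE.
Qed.

Lemma integral_reflect_itv (f : R -> R) a b c : measurable_fun `]a, b[ f ->
  \int[mu]_(x in `]a, b[) f x = \int[mu]_(x in `]c - b, c - a[) f (c - x).
Proof.
move=> mf; rewrite [LHS]Rintegral_mkcond [RHS]Rintegral_mkcond -(integral_reflect c).
  apply: eq_Rintegral => x _; rewrite !patchE; congr (if _ then _ else _).
  by apply/idP/idP; rewrite !inE/= !in_itv/= => /andP[? ?]; apply/andP; split; lra.
exact: (measurable_restrictT _ _).1.
Qed.

Lemma integrable_reflect_itv (f : R -> R) a b c :
  mu.-integrable `]c - b, c - a[ (EFin \o f) ->
  mu.-integrable `]a, b[ (EFin \o (fun x => f (c - x))).
Proof.
move=> /integrableP[/measurable_EFinP mf foo].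
have mrefl : measurable_fun setT (fun x : R => c - x) by exact: measurable_funB.
have mab : measurable_fun `]a, b[ (fun x => f (c - x)).
  apply/(measurable_restrictT _ _).2 => //.
  rewrite (_ : _ \_ _ = (f \_ `]c - b, c - a[) \o (fun x => c - x)).
    by apply: measurableT_comp => //; exact/(measurable_restrictT _ _).1.
  apply/funext => x /=; rewrite !patchE; congr (if _ then _ else _).
  by apply/idP/idP; rewrite !inE/= !in_itv/= => /andP[? ?]; apply/andP; split; lra.
apply/integrableP; split; first exact/measurable_EFinP.
apply: le_lt_trans foo; rewrite integral_mkcond [leRHS]integral_mkcond.
rewrite -(ge0_integral_reflect c); last 2 first.
- apply/(measurable_restrictT _ _).1 => //.
  by apply/measurable_EFinP; exact: measurableT_comp.
- by move=> x; apply: erestrict_ge0.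
rewrite le_eqVlt; apply/orP; left; apply/eqP.
apply: eq_integral => x _; rewrite !patchE; congr (if _ then _ else _).
  by apply/idP/idP; rewrite !inE/= !in_itv/= => /andP[? ?]; apply/andP; split; lra.
by rewrite /= opprB addrC subrK.
Qed.

Lemma continuous_bounded_itv f a b : {within `[a, b], continuous f} ->
  exists2 C : R, 0 <= C & forall x, a <= x <= b -> `|f x| <= C.
Proof.
move=> cf.
have /compact_bounded[M [_ HM]] : compact (f @` `[a, b]).
  by apply: continuous_compact => //; exact: segment_compact.
exists (`|M| + 1); first by rewrite addr_ge0.
move=> x xab; apply: (HM (`|M| + 1)); first by rewrite (le_lt_trans (ler_norm _))// ltrDl.
by exists x => //=; rewrite in_itv.
Qed.

Lemma mulr_powRN x p : 0 < x -> x * x `^ (- (p + 1)) = x `^ (- p).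
Proof.
move=> x0; rewrite -[X in X * _](powRr1 (ltW x0)) -powRD; last by rewrite (gt_eqF x0) implybT.
by congr (_ `^ _); ring.
Qed.

Lemma powRN_continuous p x : 0 < x -> {for x, continuous (fun z => z `^ (- p))}.
Proof. by move=> x0; exact: is_derive_continuous (is_derive_powRN p x0). Qed.

Lemma measurable_fun_oo f a b : (forall x, a < x < b -> {for x, continuous f}) ->
  measurable_fun `]a, b[ f.
Proof.
move=> cf; apply: open_continuous_measurable_fun; first exact: itv_open.
by move=> x; rewrite inE/= in_itv/= => /cf.
Qed.

(** Two integrations by parts turn the integral into p (p + 1) times that of K x^(-p-2), plus
    boundary terms. Since K has maximum 0 at 0, K1 is O(x) and K is O(x^2) there, which makes the
    new integrand integrable and the terms at 0 vanish. *)
Lemma integral_second_derive_powRN_le0 (K K1 K2 : R -> R) p (M : R) :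
  0 < p < 1 -> 0 < M ->
  (forall x, is_derive x 1 K (K1 x)) -> (forall x, is_derive x 1 K1 (K2 x)) ->
  continuous K2 -> (forall x, K x <= 0) -> K 0 = 0 -> K1 M = 0 ->
  \int[mu]_(x in `]0, M[) (K2 x * x `^ (- p)) <= 0.
Proof.
move=> p01 M0 dK dK1 cK2 K_le0 K0 K1M; have /andP[p0 p1] := p01.
have cK x : {for x, continuous K} by exact: is_derive_continuous (dK x).
have cK1 x : {for x, continuous K1} by exact: is_derive_continuous (dK1 x).
have K10 : K1 0 = 0.
  have d0 : is_derive (0 : R) 1 K 0.
    apply: (@derive1_at_max _ K (-1) 1); first by lra.
    - by move=> t _; have [] := dK t.
    - by rewrite in_itv/=; lra.
    - by move=> t _; rewrite K0.
  by have dK0 := dK 0; rewrite -(@derive_val _ _ _ _ _ _ _ dK0) (@derive_val _ _ _ _ _ _ _ d0).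
have [C C0 K2C] : exists2 C : R, 0 <= C & forall x, 0 <= x <= M -> `|K2 x| <= C.
  by apply: continuous_bounded_itv; exact: continuous_subspaceT.
have K1C x : 0 <= x <= M -> `|K1 x| <= C * x.
  move=> /andP[x0 xM].
  have [|y] := @MVT_segment _ K1 K2 0 x x0 (fun x _ => dK1 x).
    by apply: continuous_subspaceT => z; exact: cK1.
  rewrite in_itv/= K10 !subr0 => /andP[y0 yx] ->.
  by rewrite normrM (ger0_norm x0) ler_wpM2r// K2C// y0 (le_trans yx).
have KC x : 0 <= x <= M -> `|K x| <= C * x * x.
  move=> /andP[x0 xM].
  have [|y] := @MVT_segment _ K K1 0 x x0 (fun x _ => dK x).
    by apply: continuous_subspaceT => z; exact: cK.
  rewrite in_itv/= K0 !subr0 => /andP[y0 yx] ->.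
  rewrite normrM (ger0_norm x0) ler_wpM2r// (le_trans (K1C y _))// ?ler_wpM2l//.
  by rewrite y0 (le_trans yx).
pose q x := K2 x * x `^ (- p) - p * (p + 1) * (K x * x `^ (- (p + 1 + 1))).
(* The boundary terms of both integrations by parts at once; [q] is the derivative of [P]. *)
pose P x := K1 x * x `^ (- p) + K x * (p * x `^ (- (p + 1))).
have dP x : 0 < x < M -> is_derive x 1 P (q x).
  move=> /andP[x0 xM].
  have d1 := is_derive_powRN p x0; have d2 := is_derive_powRN (p + 1) x0.
  have dKx := dK x; have dK1x := dK1 x.
  rewrite /P; apply: is_derive_eq.
  by rewrite /q /GRing.scale/=; ring.
have cq x : 0 < x < M -> {for x, continuous q}.
  move=> /andP[x0 xM]; apply: cvgB; first by apply: cvgM; [exact: cK2|exact: powRN_continuous].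
  by apply: cvgM; [exact: cvg_cst|apply: cvgM; [exact: cK|exact: powRN_continuous]].
have ik := @integrable_powRN p M p01.
have kbound x : 0 < x < M -> `|K x * x `^ (- (p + 1 + 1))| <= C * x `^ (- p).
  move=> /andP[x0 xM]; rewrite normrM (ger0_norm (powR_ge0 _ _)).
  rewrite -[x `^ (- p)]mulr_powRN// -[x `^ (- (p + 1))]mulr_powRN// !mulrA.
  by rewrite ler_wpM2r ?powR_ge0// KC// !ltW.
have iq : mu.-integrable `]0, M[ (EFin \o q).
  apply: (@le_integrable _ _ _ mu _ _ _ (EFin \o (fun x => (C + p * (p + 1) * C) * x `^ (- p)))) => //.
  - by apply/measurable_EFinP; exact: measurable_fun_oo.
  - move=> x; rewrite /= in_itv/= => xM; rewrite lee_fin /q.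
    apply: (le_trans (ler_normB _ _)); rewrite [leRHS]ger0_norm; last first.
      by rewrite mulr_ge0 ?powR_ge0// addr_ge0// !mulr_ge0//; lra.
    rewrite mulrDl; apply: lerD.
      rewrite normrM (ger0_norm (powR_ge0 _ _)) ler_wpM2r ?powR_ge0// K2C//.
      by case/andP : xM => /ltW -> /ltW ->.
    rewrite normrM ger0_norm; last by rewrite mulr_ge0//; lra.
    by rewrite -[leRHS]mulrA ler_wpM2l ?kbound// mulr_ge0//; lra.
  - exact: integrable_EFinZ.
have iK2 : mu.-integrable `]0, M[ (EFin \o (fun x => K2 x * x `^ (- p))).
  apply: (@le_integrable _ _ _ mu _ _ _ (EFin \o (fun x => C * x `^ (- p)))) => //.
  - apply/measurable_EFinP; apply: measurable_fun_oo => x /andP[x0 xM].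
    by apply: cvgM; [exact: cK2|exact: powRN_continuous].
  - move=> x; rewrite /= in_itv/= => /andP[x0 xM]; rewrite lee_fin !normrM ler_wpM2r//.
    by rewrite (le_trans (K2C _ _)) ?ler_norm// !ltW.
  - exact: integrable_EFinZ.
have P0 : P x @[x --> 0^'+] --> (0 : R).
  apply: norm_cvg0.
  (* The bounds on K1 and K give |P x| <= C (1 + p) x^(1-p), which tends to 0 because p < 1. *)
  pose B x : R := C * (1 + p) * x `^ (- (p - 1)).
  have B0 : B x @[x --> 0^'+] --> (0 : R).
    suff : B x @[x --> 0^'+] --> C * (1 + p) * 0 by rewrite mulr0.
    apply: cvgM; first exact: cvg_cst.
    by apply: powR_cvg0; rewrite opprB subr_gt0.
  apply: (@squeeze_cvgr _ _ _ _ (cst 0) B) B0; last exact: cvg_cst.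
  near=> x; rewrite normr_ge0/=.
  have x0 : 0 < x by near: x; exact: nbhs_right_gt.
  have xM : x < M by near: x; exact: nbhs_right_lt.
  have xx : 0 <= x <= M by rewrite !ltW.
  rewrite /P /B (le_trans (ler_normD _ _))// -(mulr_powRN (p - 1) x0) subrK.
  rewrite !normrM (ger0_norm (ltW p0)) !(ger0_norm (powR_ge0 _ _)).
  rewrite [leRHS](_ : _ = C * x * x `^ (- p) + C * x * (p * x `^ (- p))); last by ring.
  apply: lerD; first by rewrite ler_wpM2r ?powR_ge0// K1C.
  rewrite -(mulr_powRN p x0) [leRHS](_ : _ = C * x * x * (p * x `^ (- (p + 1)))); last by ring.
  by rewrite ler_wpM2r ?KC// mulr_ge0 ?powR_ge0// ltW.
have PM : P x @[x --> M^'-] --> P M.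
  apply: cvg_at_left_filter; apply: cvgD.
    by apply: cvgM; [exact: cK1|exact: powRN_continuous].
  by apply: cvgM; [exact: cK|apply: cvgM; [exact: cvg_cst|exact: powRN_continuous]].
have := integral_derive_oo M0 iq cq dP P0 PM.
rewrite subr0 /P K1M mul0r add0r => intq.
(* As K <= 0, [q] dominates the integrand; its integral is P M = K M p M^(-p-1) <= 0. *)
apply: (@le_trans _ _ (\int[mu]_(x in `]0, M[) q x)).
  apply: le_Rintegral => // x _; rewrite /q lerDl oppr_ge0.
  by rewrite mulr_ge0_le0 ?mulr_le0_ge0 ?powR_ge0//; rewrite mulr_ge0//; lra.
by rewrite intq mulr_le0_ge0// mulr_ge0 ?powR_ge0 ?ltW.
Unshelve. all: by end_near. Qed.

(** Truncated powers are the building blocks of the cutoff; an exponent of at least 2 makes them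
    differentiable at 0 too. *)
Lemma is_derive_pospow n (x : R) : is_derive x 1 (fun x => Num.max x 0 ^+ n.+2)
  (n.+2%:R * Num.max x 0 ^+ n.+1).
Proof.
pose f (x : R) := Num.max x 0 ^+ n.+2.
have [x0|x0|->] := ltgtP x 0.
- have E : {near x, (fun=> 0) =1 f}.
    near=> z; rewrite /f max_r ?expr0n//; apply: ltW; near: z.
    exact: lt_nbhsl.
  rewrite expr0n mulr0; apply: DeriveDef.
    by apply: (@near_eq_derivable _ _ _ (fun=> 0) f x 1 E); exact: derivable_cst.
  by rewrite -(near_eq_derive _ E) derive_cst.
- have E : {near x, (fun z => z ^+ n.+2) =1 f}.
    near=> z; rewrite /f max_l//; apply: ltW; near: z.
    exact: lt_nbhsr.
  have d : is_derive x 1 (fun z : R => z ^+ n.+2) (n.+2%:R * x ^+ n.+1).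
    have -> : (fun z : R => z ^+ n.+2) = (@id R) ^+ n.+2.
      by apply/funext => z; rewrite exprfctE.
    by apply: is_derive_eq; rewrite scaler1.
  have [d1 d2] := d; apply: DeriveDef.
    exact: (@near_eq_derivable _ _ _ (fun z => z ^+ n.+2) f x 1 E).
  by rewrite -(near_eq_derive _ E).
- rewrite expr0n/= mulr0.
  (* The difference quotient at 0 is bounded by |h| for |h| <= 1. *)
  have H : h^-1 *: (f (h *: 1 + 0) - f 0) @[h --> 0^'] --> (0 : R).
    apply: norm_cvg0.
    apply: (@squeeze_cvgr _ _ _ _ (cst 0) (fun h => `|h|)).
    - near=> h; rewrite normr_ge0/= addr0 /f maxxx expr0n subr0.
      have h0 : h != 0 by near: h; exact: nbhs_dnbhs_neq.
      have h1 : `|h| <= 1 by near: h; apply: dnbhs0_le.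
      rewrite /GRing.scale/= mulr1 normrM normfV ler_pdivrMl ?normr_gt0// normrX.
      apply: (@le_trans _ _ (`|h| ^+ n.+2)).
        rewrite lerXn2r ?nnegrE// maxEle; case: ifP => _ //.
        by rewrite normr0.
      by rewrite exprS ler_wpM2l// exprS ler_piMr// exprn_ile1.
    - exact: cvg_cst.
    - rewrite -[X in _ --> X](@normr0 _ R); apply: cvg_norm.
      by apply: cvg_trans (@cvg_id _ (nbhs (0 : R))); apply: cvg_app; exact: nbhs_dnbhs.
  apply: DeriveDef; first by apply/cvg_ex; exists 0.
  exact: cvg_lim H.
Unshelve. all: by end_near. Qed.

(** With s = (x - a)/(b - a), the cutoff is 1 - (1 - (s_+)^3)_+^3. Truncated cubes are of class C^2;
    the inner bracket is 1 for s <= 0 and nonpositive for s >= 1. *)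
Lemma cutoff_exists a b : a < b ->
  exists chi chi1 chi2 : R -> R,
  [/\ forall x, is_derive x 1 chi (chi1 x),
      forall x, is_derive x 1 chi1 (chi2 x),
      continuous chi2,
      forall x, x <= a -> [/\ chi x = 0, chi1 x = 0 & chi2 x = 0] &
      forall x, b <= x -> [/\ chi x = 1, chi1 x = 0 & chi2 x = 0]].
Proof.
move=> ab.
pose m (x : R) := Num.max x 0.
pose s (x : R) := (x - a) / (b - a).
pose t x := 1 - m (s x) ^+ 3.
pose t1 x := - (3 * m (s x) ^+ 2) / (b - a).
pose t2 x := - (6 * m (s x)) / (b - a) ^+ 2.
have cm : continuous m by move=> x; apply: continuous_max; [exact: cvg_id|exact: cvg_cst].
have cs : continuous s.
  by move=> x; apply: cvgM; [apply: cvgB; [exact: cvg_id|exact: cvg_cst]|exact: cvg_cst].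
have ba : b - a != 0 by rewrite subr_eq0 gt_eqF.
have ds x : is_derive x 1 s (b - a)^-1.
  by rewrite /s; apply: is_derive_eq; rewrite /GRing.scale/=; field.
have dt x : is_derive x 1 t (t1 x).
  have d3 := is_derive_pospow 1 (s x); have dsx := ds x.
  have d := is_derive1_comp d3 dsx.
  rewrite /t; apply: is_derive_eq.
  by rewrite /t1 /m; field.
have dt1 x : is_derive x 1 t1 (t2 x).
  have d3 := is_derive_pospow 0 (s x); have dsx := ds x.
  have d := is_derive1_comp d3 dsx.
  rewrite /t1; apply: is_derive_eq.
  by rewrite /t2 /m /GRing.scale/=; field.
have cms : continuous (m \o s) by move=> x; apply: continuous_comp; [exact: cs|exact: cm].
have ct2 : continuous t2.
  by move=> x; apply: cvgM; [apply: cvgN; apply: cvgM; [exact: cvg_cst|exact: cms]|exact: cvg_cst].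
have ct x : {for x, continuous t} by exact: is_derive_continuous (dt x).
have ct1 x : {for x, continuous t1} by exact: is_derive_continuous (dt1 x).
pose chi x := 1 - m (t x) ^+ 3.
pose chi1 x := - (3 * m (t x) ^+ 2) * t1 x.
pose chi2 x := - (6 * m (t x)) * t1 x ^+ 2 - 3 * m (t x) ^+ 2 * t2 x.
exists chi, chi1, chi2; split.
- move=> x; have d3 := is_derive_pospow 1 (t x); have dtx := dt x.
  have d := is_derive1_comp d3 dtx.
  rewrite /chi; apply: is_derive_eq.
  by rewrite /chi1 /m; ring.
- move=> x; have d3 := is_derive_pospow 0 (t x); have dtx := dt x; have dt1x := dt1 x.
  have d := is_derive1_comp d3 dtx.
  rewrite /chi1; apply: is_derive_eq.
  by rewrite /chi2 /m /GRing.scale/=; ring.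
- have cmt : continuous (m \o t) by move=> x; apply: continuous_comp; [exact: ct|exact: cm].
  move=> x; apply: cvgB.
    apply: cvgM; first by apply: cvgN; apply: cvgM; [exact: cvg_cst|exact: cmt].
    by apply: cvgM; exact: ct1.
  apply: cvgM; last exact: ct2.
  by apply: cvgM; [exact: cvg_cst|apply: cvgM; exact: cmt].
- move=> x xa.
  have ms : m (s x) = 0.
    by rewrite /m max_r// /s mulr_le0_ge0 ?subr_le0// invr_ge0 subr_ge0 ltW.
  have tx : t x = 1 by rewrite /t ms expr0n subr0.
  have t1x : t1 x = 0 by rewrite /t1 ms expr0n mulr0 oppr0 mul0r.
  have t2x : t2 x = 0 by rewrite /t2 ms mulr0 oppr0 mul0r.
  rewrite /chi /chi1 /chi2 tx t1x t2x /m max_l//.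
  by rewrite !expr1n expr0n/= !mulr0 !subrr.
- move=> x bx.
  have ms : 1 <= m (s x).
    by rewrite /m le_max /s ler_pdivlMr ?subr_gt0// mul1r lerD2r bx.
  have mt : m (t x) = 0.
    by rewrite /m max_r// /t subr_le0 exprn_ege1.
  by rewrite /chi /chi1 /chi2 mt; split; ring.
Qed.

Lemma is_derive_powRN_subl x y p : y < x ->
  is_derive x 1 (fun x => (x - y) `^ (- p)) (- p * (x - y) `^ (- (p + 1))).
Proof.
move=> yx; have xy0 : 0 < x - y by rewrite subr_gt0.
have d1 := is_derive_powRN p xy0.
have d2 : is_derive x 1 (fun x => x - y) 1 by apply: is_derive_eq; rewrite subr0.
by have := @is_derive1_comp _ (fun z => z `^ (- p)) (fun x => x - y) x _ _ d1 d2; rewrite mulr1.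
Qed.

Lemma is_derive_powRN_subr x y p : y < x ->
  is_derive y 1 (fun y => (x - y) `^ (- p)) (p * (x - y) `^ (- (p + 1))).
Proof.
move=> yx; have xy0 : 0 < x - y by rewrite subr_gt0.
have d1 := is_derive_powRN p xy0.
have d2 : is_derive y 1 (fun y => x - y) (-1) 
    by rewrite -[-1]add0r; apply: is_deriveB.
by have := @is_derive1_comp _ (fun z => z `^ (- p)) (fun y => x - y) y _ _ d1 d2; rewrite mulrN1 mulNr opprK.
Qed.

Lemma is_derive_subl F (dF : R) x y : is_derive (x - y) 1 F dF ->
  is_derive x 1 (fun x => F (x - y)) dF.
Proof.
move=> d1.
have d2 : is_derive x 1 (fun x => x - y) 1 by apply: is_derive_eq; rewrite subr0.
by have := @is_derive1_comp _ F (fun x => x - y) x _ _ d1 d2; rewrite mulr1.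
Qed.

Lemma powRN_ub p (delta z : R) : 0 <= p -> 0 < delta -> delta <= z -> z `^ (- p) <= delta `^ (- p).
Proof.
move=> p0 d0 dz; have z0 := lt_le_trans d0 dz.
rewrite !powRN lef_pV2 ?posrE ?powR_gt0//.
by rewrite ge0_ler_powR ?nnegrE// ltW.
Qed.

Lemma cvg_right_bounded f a b (l : R) : a < b -> f x @[x --> a^'+] --> l ->
  (forall x, a < x <= b -> {for x, continuous f}) ->
  exists2 C : R, 0 <= C & forall x, a < x <= b -> `|f x| <= C.
Proof.
move=> ab fa cf.
pose g x := if x <= a then l else f x.
have gf x : a < x -> g x = f x by move=> ax; rewrite /g leNgt ax.
have near_gf x : a < x -> f @ x --> f x -> g @ x --> g x.
  move=> ax; rewrite gf//; apply: cvg_trans; apply: near_eq_cvg; near=> z.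
  by apply/esym/gf; near: z; exact: lt_nbhsr.
have [C C0 gC] : exists2 C : R, 0 <= C & forall x, a <= x <= b -> `|g x| <= C.
  apply: continuous_bounded_itv; apply/(continuous_within_itvP _ ab); split.
  - by move=> x; rewrite in_itv/= => /andP[ax xb]; apply: near_gf => //; apply: cf; rewrite ax ltW.
  - rewrite {2}/g lexx; apply: cvg_trans fa; apply: near_eq_cvg; near=> z.
    by apply/esym/gf; near: z; exact: nbhs_right_gt.
  - by apply: cvg_at_left_filter; apply: near_gf => //; apply: cf; rewrite ab lexx.
by exists C => // x /andP[ax xb]; rewrite -gf// gC// xb ltW.
Unshelve. all: by end_near. Qed.

Lemma integrable_bounded_powRN f a b p x (C : R) : 0 < p < 1 -> b <= x ->
  (forall y, a < y < b -> {for y, continuous f}) ->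
  (forall y, a < y < b -> `|f y| <= C) ->
  mu.-integrable `]a, b[ (EFin \o (fun y => f y * (x - y) `^ (- p))).
Proof.
move=> p01 bx cf fC.
have ik : mu.-integrable `]a, b[ (EFin \o (fun y => (x - y) `^ (- p))).
  apply: (@integrable_reflect_itv (fun z => z `^ (- p))).
  apply: integrableS (integrable_powRN (x - a) p01) => //.
  by apply: subset_itvr; rewrite bnd_simp subr_ge0.
apply: (@le_integrable _ _ _ mu _ _ _ (EFin \o (fun y => C * (x - y) `^ (- p)))) => //.
- apply/measurable_EFinP; apply: measurable_funM; first exact: measurable_fun_oo.
  by move/integrableP : ik => [/measurable_EFinP].
- move=> y; rewrite /= in_itv/= => yab; rewrite lee_fin !normrM ler_wpM2r//.
  by rewrite (le_trans (fC _ yab))// ler_norm.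
- exact: integrable_EFinZ.
Qed.

End one_variable.

(** * Riemann-Liouville and Caputo derivatives *)

Section riemann_liouville.
Context {R : realType}.
Notation mu := (@lebesgue_measure R).
Implicit Types (f F : R -> R) (a b c p x y z : R).

Lemma integrable_bounded_oo f a b (C : R) : measurable_fun `]a, b[ f ->
  (forall x, a < x < b -> `|f x| <= C) -> mu.-integrable `]a, b[ (EFin \o f).
Proof.
move=> mf fC; apply: (@integrable_bounded _ (measurableTypeR R) _ mu _ _ f C) => //.
  by rewrite [X in (X < _)%E](lebesgue_measure_itv `]a, b[)/=; case: ifP => _; rewrite -?EFinD ltry.
Qed.

Lemma RintegralZl_oo f a b c : mu.-integrable `]a, b[ (EFin \o f) ->
  \int[mu]_(x in `]a, b[) (c * f x) = c * \int[mu]_(x in `]a, b[) f x.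
Proof. by move=> intf; exact: RintegralZl. Qed.

Lemma RintegralB_oo f F a b : mu.-integrable `]a, b[ (EFin \o f) ->
  mu.-integrable `]a, b[ (EFin \o F) ->
  \int[mu]_(x in `]a, b[) (f x - F x) =
  \int[mu]_(x in `]a, b[) f x - \int[mu]_(x in `]a, b[) F x.
Proof. by move=> intf intF; exact: RintegralB. Qed.

Lemma RintegralD_oo f F a b : mu.-integrable `]a, b[ (EFin \o f) ->
  mu.-integrable `]a, b[ (EFin \o F) ->
  \int[mu]_(x in `]a, b[) (f x + F x) =
  \int[mu]_(x in `]a, b[) f x + \int[mu]_(x in `]a, b[) F x.
Proof. by move=> intf intF; exact: RintegralD. Qed.

Lemma integrable_smooth_kernel (V : R -> R) A c q x : c < x -> 0 <= q ->
  mu.-integrable `]A, c[ (EFin \o V) ->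
  mu.-integrable `]A, c[ (EFin \o (fun y => (x - y) `^ (- q) * V y)).
Proof.
move=> cx q0 iV.
apply: (@le_integrable _ _ _ mu _ _ _ (EFin \o (fun y => (x - c) `^ (- q) * V y))) => //.
- apply/measurable_EFinP; apply: measurable_funM.
    apply: measurable_fun_oo => y /andP[Ay yc].
    exact: is_derive_continuous (is_derive_powRN_subr _ (lt_trans yc cx)).
  by move/integrableP : iV => [/measurable_EFinP].
- move=> y; rewrite /= in_itv/= => /andP[Ay yc]; rewrite lee_fin !normrM ler_wpM2r//.
  rewrite !ger0_norm ?powR_ge0//; apply: powRN_ub => //; first by rewrite subr_gt0.
  by rewrite lerD2l lerN2 ltW.
- exact: integrable_EFinZ.
Qed.

(** The singularity stays outside ]A, c[, so every exponent q >= 0 is admissible and the rule can be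
    iterated, with q = p and then q = p + 1. *)
Lemma is_derive_smooth_kernel (V : R -> R) A c q x : c < x -> 0 <= q ->
  mu.-integrable `]A, c[ (EFin \o V) ->
  is_derive x 1 (fun x => \int[mu]_(y in `]A, c[) ((x - y) `^ (- q) * V y))
    (- q * \int[mu]_(y in `]A, c[) ((x - y) `^ (- (q + 1)) * V y)).
Proof.
move=> cx q0 iV.
have q10 : 0 <= q + 1 by rewrite addr_ge0.
have E : \int[mu]_(y in `]A, c[) (- q * (x - y) `^ (- (q + 1)) * V y) =
    - q * \int[mu]_(y in `]A, c[) ((x - y) `^ (- (q + 1)) * V y).
  rewrite -(RintegralZl_oo _ (integrable_smooth_kernel cx q10 iV)).
  by apply: eq_Rintegral => y _; rewrite mulrA.
rewrite -E {E}.
(* For points of ]u, v[ the distance to ]A, c[ is at least u - c > 0; this bounds the kernel and its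
   derivative, and [D] adds both bounds. *)
pose u := (c + x) / 2; pose v := x + 1.
have cu : c < u by rewrite /u; lra.
have uxv : u < x < v by rewrite /u /v; apply/andP; split; lra.
have uc : 0 < u - c by rewrite subr_gt0.
clearbody u v.
pose D := (u - c) `^ (- q) + q * (u - c) `^ (- (q + 1)).
have D1 : 0 <= (u - c) `^ (- q) by exact: powR_ge0.
have D2 : 0 <= q * (u - c) `^ (- (q + 1)) by rewrite mulr_ge0 ?powR_ge0.
apply: (@derive_under_kernel _ _ _ mu (fun x y => (x - y) `^ (- q))
   (fun x y => - q * (x - y) `^ (- (q + 1))) `]A, c[ V D x u v) => //.
- move=> z /andP[uz zv]; apply: measurable_fun_oo => y /andP[Ay yc].
  apply: is_derive_continuous (is_derive_powRN_subr _ _).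
  exact: lt_trans yc (lt_trans cu uz).
- move=> z y /andP[uz zv]; rewrite /= in_itv/= => /andP[Ay yc].
  have zy : u - c <= z - y by rewrite lerB// ltW.
  split; first by apply: is_derive_powRN_subl; exact: lt_trans yc (lt_trans cu uz).
    rewrite ger0_norm ?powR_ge0//; apply: (le_trans (powRN_ub _ _ zy)) => //.
    by rewrite /D lerDl.
  rewrite normrM normrN !ger0_norm ?powR_ge0//.
  apply: (@le_trans _ _ (q * (u - c) `^ (- (q + 1)))); last by rewrite /D lerDr.
  by rewrite ler_wpM2l// powRN_ub.
Qed.

(** In the variable x - y the derivative falls on G and the singular kernel is fixed, as is the
    interval of integration. The bounds reach down to minus infinity because x - y may fall below
    the original interval. *)
Lemma is_derive_convolution (G G1 : R -> R) p u v M C x : 0 < p < 1 -> u < x < v ->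
  (forall y, y <= v -> is_derive y 1 G (G1 y)) ->
  (forall y, y <= v -> `|G y| <= C) -> (forall y, y <= v -> `|G1 y| <= C) ->
  is_derive x 1
    (fun x => \int[mu]_(y in `]0, M[) (G (x - y) * y `^ (- p)))
    (\int[mu]_(y in `]0, M[) (G1 (x - y) * y `^ (- p))).
Proof.
move=> p01 xuv dG GC G1C.
have zyv z y : z < v -> 0 < y -> z - y <= v.
  by move=> zv y0; rewrite lerBlDr (le_trans (ltW zv))// lerDl ltW.
apply: (@derive_under_kernel _ _ _ mu (fun x y => G (x - y)) (fun x y => G1 (x - y))
  `]0, M[ (fun y => y `^ (- p)) C x u v) => //.
- exact: integrable_powRN.
- move=> z /andP[uz zv]; apply: measurable_fun_oo => y /andP[y0 yM].
  apply: continuous_comp; first by apply: cvgB; [exact: cvg_cst|exact: cvg_id].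
  exact: is_derive_continuous (dG _ (zyv _ _ zv y0)).
- move=> z y /andP[uz zv]; rewrite /= in_itv/= => /andP[y0 yM].
  have zy := zyv _ _ zv y0.
  by split; [apply: is_derive_subl; exact: dG|exact: GC|exact: G1C].
Qed.

(** This removes x from the limits of integration: V vanishes right of c, so its integral stops at
    c; W vanishes left of a, so after reflection its interval can be enlarged to ]0, v - A[. *)
Lemma split_convolution (g V W : R -> R) p A a c x v C : 0 < p < 1 ->
  A < a -> c < x -> x < v ->
  (forall y, A < y < x -> g y = V y + W y) ->
  (forall y, c <= y < x -> V y = 0) -> (forall y, y <= a -> W y = 0) ->
  (forall y, A < y < x -> {for y, continuous W}) ->
  (forall y, A < y < x -> `|W y| <= C) ->
  mu.-integrable `]A, c[ (EFin \o (fun y => (x - y) `^ (- p) * V y)) ->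
  \int[mu]_(y in `]A, x[) (g y * (x - y) `^ (- p)) =
  \int[mu]_(y in `]A, c[) ((x - y) `^ (- p) * V y) +
  \int[mu]_(y in `]0, v - A[) (W (x - y) * y `^ (- p)).
Proof.
move=> p01 Aa cx xv gE V0 W0 cW WC iV.
have iW : mu.-integrable `]A, x[ (EFin \o (fun y => W y * (x - y) `^ (- p))).
  exact: (integrable_bounded_powRN (C := C)).
pose h (y : R) := (x - y) `^ (- p) * V y.
have E : h \_ `]A, c[ = h \_ `]A, x[.
  apply/funext => y; rewrite !patchE; case: ifPn => yc; case: ifPn => yx //.
    case/negP: yx; move: yc; rewrite !inE/= !in_itv/= => /andP[-> yc].
    exact: lt_trans yc cx.
  transitivity (0 : R) => //; apply/esym.
  move: yx; rewrite inE/= in_itv/= => /andP[Ay yx].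
  rewrite /h V0 ?mulr0// yx andbT leNgt; apply/negP => yc'.
  by case/negP: yc; rewrite inE/= in_itv/= Ay.
have iVx : mu.-integrable `]A, x[ (EFin \o h).
  have : mu.-integrable setT (EFin \o (h \_ `]A, c[)).
    by rewrite -restrict_EFin; apply/integrable_restrict => //=; rewrite setTI.
  by rewrite E -restrict_EFin => /integrable_restrict; rewrite setTI; apply.
transitivity (\int[mu]_(y in `]A, x[) (h y + W y * (x - y) `^ (- p))).
  apply: eq_Rintegral => y; rewrite inE/= in_itv/= => Ayx.
  by rewrite gE// mulrDl /h [V y * _]mulrC.
rewrite (RintegralD_oo iVx iW); congr (_ + _).
  by rewrite [LHS]Rintegral_mkcond [RHS]Rintegral_mkcond E.
rewrite (integral_reflect_itv x); last first.
  by move/integrableP : iW => [/measurable_EFinP].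
rewrite subrr [LHS]Rintegral_mkcond [RHS]Rintegral_mkcond; apply: eq_Rintegral => y _.
rewrite !patchE; case: ifPn => yc; case: ifPn => yM //.
- by rewrite subKr.
- case/negP: yM; move: yc; rewrite !inE/= !in_itv/= => /andP[-> yc].
  by rewrite (lt_trans yc)// ltrD2r.
- transitivity (0 : R) => //; apply/esym.
  move: yM; rewrite inE/= in_itv/= => /andP[y0 yM].
  rewrite W0 ?mul0r//; apply: (@le_trans _ _ A); last exact: ltW.
  rewrite lerBlDr -lerBlDl leNgt; apply/negP => yc'.
  by case/negP: yc; rewrite inE/= in_itv/= y0.
Qed.

(** Both integrations by parts are done through one primitive P of the difference; its limits at A
    and c are zero. *)
Lemma parts_smooth_kernel (V V1 V2 : R -> R) p A c x : A < c -> c < x -> 0 <= p ->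
  (forall y, A < y <= c -> is_derive y 1 V (V1 y)) ->
  (forall y, A < y <= c -> is_derive y 1 V1 (V2 y)) ->
  (forall y, A < y <= c -> {for y, continuous V2}) ->
  V y @[y --> A^'+] --> (0 : R) -> V1 y @[y --> A^'+] --> (0 : R) ->
  V c = 0 -> V1 c = 0 ->
  mu.-integrable `]A, c[ (EFin \o V) ->
  mu.-integrable `]A, c[ (EFin \o (fun y => (x - y) `^ (- p) * V2 y)) ->
  \int[mu]_(y in `]A, c[) ((x - y) `^ (- p) * V2 y) =
  p * (p + 1) * \int[mu]_(y in `]A, c[) ((x - y) `^ (- (p + 1 + 1)) * V y).
Proof.
move=> Ac cx p0 dV dV1 cV2 VA V1A Vc V1c iV iV2.
have p20 : 0 <= p + 1 + 1 by rewrite !addr_ge0.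
have ik2 := integrable_smooth_kernel cx p20 iV.
have ik2' : mu.-integrable `]A, c[
    (EFin \o (fun y => p * (p + 1) * ((x - y) `^ (- (p + 1 + 1)) * V y))).
  exact: integrable_EFinZ.
apply/eqP; rewrite -(RintegralZl_oo _ ik2) -subr_eq0 -(RintegralB_oo iV2 ik2'); apply/eqP.
pose P (y : R) := V1 y * (x - y) `^ (- p) + V y * (- p * (x - y) `^ (- (p + 1))).
have ck (q y : R) : y <= c -> {for y, continuous (fun y => (x - y) `^ (- q))}.
  by move=> yc; exact: is_derive_continuous (is_derive_powRN_subr _ (le_lt_trans yc cx)).
have cA (q : R) : (x - y) `^ (- q) @[y --> A^'+] --> (x - A) `^ (- q).
  by apply: cvg_at_right_filter; apply: ck; exact: ltW.
transitivity (0 - 0 : R); last by rewrite subr0.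
apply: (@integral_derive_oo _ _ P) => //.
- exact: integrable_EFinB.
- move=> y /andP[Ay yc]; have Ayc : A < y <= c by rewrite Ay ltW.
  apply: cvgB; first by apply: cvgM; [exact/ck/ltW|exact: cV2].
  apply: cvgM; [exact: cvg_cst|apply: cvgM; [exact/ck/ltW|]].
  exact: is_derive_continuous (dV _ Ayc).
- move=> y /andP[Ay yc]; have Ayc : A < y <= c by rewrite Ay ltW.
  have yx := lt_trans yc cx.
  have d1 := dV _ Ayc; have d2 := dV1 _ Ayc.
  have d3 := is_derive_powRN_subr p yx; have d4 := is_derive_powRN_subr (p + 1) yx.
  by rewrite /P; apply: is_derive_eq; rewrite /GRing.scale/=; ring.
- rewrite -[X in _ --> X](_ : 0 * (x - A) `^ (- p) + 0 * (- p * (x - A) `^ (- (p + 1))) = 0); last by ring.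
  apply: cvgD; first by apply: cvgM => //; exact: cA.
  by apply: cvgM => //; apply: cvgM; [exact: cvg_cst|exact: cA].
- rewrite -[X in _ --> X](_ : P c = 0); last by rewrite /P Vc V1c; ring.
  have Acc : A < c <= c by rewrite Ac lexx.
  apply: cvg_at_left_filter; apply: cvgD; apply: cvgM.
  + exact: is_derive_continuous (dV1 _ Acc).
  + exact: ck.
  + exact: is_derive_continuous (dV _ Acc).
  + by apply: cvgM; [exact: cvg_cst|exact: ck].
Qed.

(* Only integrability of [w2] against the kernel is known near [A], so [w] is cut
   into [W], which vanishes near [A] and is convolved with the kernel, and
   [V = w - W], which vanishes near [x0]: there the kernel is smooth and two
   integrations by parts apply. *)
Lemma RL_caputo_left (w w1 w2 : R -> R) p A B x0 : 0 < p < 1 -> A < x0 < B ->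
  (forall x, A < x < B -> is_derive x 1 w (w1 x)) ->
  (forall x, A < x < B -> is_derive x 1 w1 (w2 x)) ->
  (forall x, A < x < B -> {for x, continuous w2}) ->
  w x @[x --> A^'+] --> (0 : R) -> w1 x @[x --> A^'+] --> (0 : R) ->
  mu.-integrable `]A, x0[ (EFin \o (fun y => w2 y * (x0 - y) `^ (- p))) ->
  exists (F1 : R -> R) (u v : R), [/\ u < x0 < v,
    forall x, u < x < v -> is_derive x 1
      (fun x => \int[mu]_(y in `]A, x[) (w y * (x - y) `^ (- p))) (F1 x) &
    is_derive x0 1 F1 (\int[mu]_(y in `]A, x0[) (w2 y * (x0 - y) `^ (- p)))].
Proof.
move=> p01 /andP[Ax0 x0B] dw dw1 cw2 wA w1A iw2.
have /andP[p0 p1] := p01.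
(* The order is A < a < c < u < x0 < v < B: the cutoff rises on [a, c], and x varies in ]u, v[, away
   from c and B. *)
pose a := (2 * A + x0) / 3; pose c := (A + 2 * x0) / 3.
pose u := (c + x0) / 2; pose v := (x0 + B) / 2.
have Aa : A < a by rewrite /a; lra.
have ac : a < c by rewrite /a /c; lra.
have cu : c < u by rewrite /u /c; lra.
have ux0 : u < x0 by rewrite /u /c; lra.
have x0v : x0 < v by rewrite /v; lra.
have vB : v < B by rewrite /v; lra.
have Ac : A < c by lra.
have cx0 : c < x0 by lra.
have cB : c < B by lra.
clearbody a c u v.
have [chi [chi1 [chi2 [dchi dchi1 cchi2 chi_a chi_c]]]] := cutoff_exists ac.
pose W x := chi x * w x.
pose W1 x := chi1 x * w x + chi x * w1 x.
pose W2 x := chi2 x * w x + 2 * (chi1 x * w1 x) + chi x * w2 x.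
have W_a x : x <= a -> [/\ W x = 0, W1 x = 0 & W2 x = 0].
  by move=> /chi_a[h0 h1 h2]; rewrite /W /W1 /W2 h0 h1 h2; split; ring.
have cw x : A < x < B -> {for x, continuous w}.
  by move=> xAB; exact: is_derive_continuous (dw x xAB).
have cw1 x : A < x < B -> {for x, continuous w1}.
  by move=> xAB; exact: is_derive_continuous (dw1 x xAB).
have cchi x : {for x, continuous chi} by exact: is_derive_continuous (dchi x).
have cchi1 x : {for x, continuous chi1} by exact: is_derive_continuous (dchi1 x).
have nearW0 x : x < a -> [/\ {near x, (fun=> 0) =1 W}, {near x, (fun=> 0) =1 W1} &
    {near x, (fun=> 0) =1 W2}].
  move=> xa; split; near=> z.
  - have za : z <= a by apply: ltW; near: z; exact: lt_nbhsl.
    by have [-> _ _] := W_a z za.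
  - have za : z <= a by apply: ltW; near: z; exact: lt_nbhsl.
    by have [_ -> _] := W_a z za.
  - have za : z <= a by apply: ltW; near: z; exact: lt_nbhsl.
    by have [_ _ ->] := W_a z za.
have dW x : x < B -> is_derive x 1 W (W1 x).
  move=> xB; have [xa|ax] := ltP x a.
    have [E _ _] := nearW0 x xa; have [_ -> _] := W_a x (ltW xa).
    apply: DeriveDef; first by apply: (@near_eq_derivable _ _ _ (fun=> 0) W x 1 E); exact: derivable_cst.
    by rewrite -(near_eq_derive _ E) derive_cst.
  have xAB : A < x < B by rewrite xB andbT; lra.
  have d1 := dw x xAB; have d2 := dchi x.
  by rewrite /W; apply: is_derive_eq; rewrite /W1 /GRing.scale/=; ring.
have dW1 x : x < B -> is_derive x 1 W1 (W2 x).
  move=> xB; have [xa|ax] := ltP x a.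
    have [_ E _] := nearW0 x xa; have [_ _ ->] := W_a x (ltW xa).
    apply: DeriveDef; first by apply: (@near_eq_derivable _ _ _ (fun=> 0) W1 x 1 E); exact: derivable_cst.
    by rewrite -(near_eq_derive _ E) derive_cst.
  have xAB : A < x < B by rewrite xB andbT; lra.
  have d1 := dw x xAB; have d2 := dchi x; have d3 := dw1 x xAB; have d4 := dchi1 x.
  by rewrite /W1; apply: is_derive_eq; rewrite /W2 /GRing.scale/=; ring.
have cW2 x : x < B -> {for x, continuous W2}.
  move=> xB; have [xa|ax] := ltP x a.
    have [_ _ E] := nearW0 x xa; have [_ _ W20] := W_a x (ltW xa).
    change (W2 z @[z --> x] --> W2 x); rewrite W20.
    by apply: cvg_trans (@cvg_cst _ (0 : R) _ (nbhs x) _); exact: near_eq_cvg.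
  have xAB : A < x < B by rewrite xB andbT; lra.
  apply: cvgD; last by apply: cvgM; [exact: cchi|exact: cw2].
  apply: cvgD; first by apply: cvgM; [exact: cchi2|exact: cw].
  by apply: cvgM; [exact: cvg_cst|apply: cvgM; [exact: cchi1|exact: cw1]].
have cW x : x < B -> {for x, continuous W} by move=> /dW; exact: is_derive_continuous.
have cW1 x : x < B -> {for x, continuous W1} by move=> /dW1; exact: is_derive_continuous.
(* One bound on the whole half-line up to v: the three functions vanish left of a and are continuous
   on [a, v]. *)
have [C [C0 WC W1C W2C]] : exists C : R, [/\ 0 <= C, forall x, x <= v -> `|W x| <= C,
    forall x, x <= v -> `|W1 x| <= C & forall x, x <= v -> `|W2 x| <= C].
  have bd f : (forall x, x < B -> {for x, continuous f}) ->
      exists2 C : R, 0 <= C & forall x, a <= x <= v -> `|f x| <= C.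
    move=> cf; apply: continuous_bounded_itv; apply: continuous_in_subspaceT => x.
    by rewrite inE/= in_itv/= => /andP[_ xv]; apply: cf; lra.
  have [[C C0 HC] [C1 C10 HC1] [C2 C20 HC2]] := And3 (bd _ cW) (bd _ cW1) (bd _ cW2).
  exists (C + C1 + C2); split; first by lra.
  - move=> x xv; have [/ltW/W_a[-> _ _]|ax] := ltP x a; first by rewrite normr0; lra.
    by have := HC x; rewrite ax xv => /(_ isT); lra.
  - move=> x xv; have [/ltW/W_a[_ -> _]|ax] := ltP x a; first by rewrite normr0; lra.
    by have := HC1 x; rewrite ax xv => /(_ isT); lra.
  - move=> x xv; have [/ltW/W_a[_ _ ->]|ax] := ltP x a; first by rewrite normr0; lra.
    by have := HC2 x; rewrite ax xv => /(_ isT); lra.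
pose V x := w x - W x; pose V1 x := w1 x - W1 x; pose V2 x := w2 x - W2 x.
have V_c x : c <= x -> [/\ V x = 0, V1 x = 0 & V2 x = 0].
  by move=> /chi_c[h0 h1 h2]; rewrite /V /V1 /V2 /W /W1 /W2 h0 h1 h2; split; ring.
have dV x : A < x < B -> is_derive x 1 V (V1 x).
  by move=> xAB; have /andP[_ xB] := xAB; have d1 := dw x xAB; have d2 := dW x xB; exact: is_deriveB.
have dV1 x : A < x < B -> is_derive x 1 V1 (V2 x).
  by move=> xAB; have /andP[_ xB] := xAB; have d1 := dw1 x xAB; have d2 := dW1 x xB; exact: is_deriveB.
have cV x : A < x < B -> {for x, continuous V} by move=> /dV; exact: is_derive_continuous.
have cV1 x : A < x < B -> {for x, continuous V1} by move=> /dV1; exact: is_derive_continuous.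
have cV2 x : A < x < B -> {for x, continuous V2}.
  by move=> xAB; apply: cvgB; [exact: cw2|apply: cW2; case/andP : xAB].
have VA : V x @[x --> A^'+] --> (0 : R).
  apply: cvg_trans wA; apply: near_eq_cvg; near=> z.
  have za : z <= a by near: z; exact: nbhs_right_le.
  by rewrite /V; have [-> _ _] := W_a z za; rewrite subr0.
have V1A : V1 x @[x --> A^'+] --> (0 : R).
  apply: cvg_trans w1A; apply: near_eq_cvg; near=> z.
  have za : z <= a by near: z; exact: nbhs_right_le.
  by rewrite /V1; have [_ -> _] := W_a z za; rewrite subr0.
have [CV CV0 VC] : exists2 C : R, 0 <= C & forall x, A < x <= c -> `|V x| <= C.
  apply: (cvg_right_bounded Ac VA) => x /andP[Ax xc]; apply: cV; rewrite Ax/=; lra.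
have mV : measurable_fun `]A, c[ V.
  by apply: measurable_fun_oo => x /andP[Ax xc]; apply: cV; rewrite Ax/=; lra.
have iV : mu.-integrable `]A, c[ (EFin \o V).
  apply: (@integrable_bounded_oo V A c CV) => // x /andP[Ax xc].
  by rewrite VC// Ax ltW.
have iV2 : mu.-integrable `]A, c[ (EFin \o (fun y => (x0 - y) `^ (- p) * V2 y)).
  have iw2c : mu.-integrable `]A, c[ (EFin \o (fun y => w2 y * (x0 - y) `^ (- p))).
    by apply: integrableS iw2 => //; apply: subset_itvl; rewrite bnd_simp ltW.
  have iW2c : mu.-integrable `]A, c[ (EFin \o (fun y => W2 y * (x0 - y) `^ (- p))).
    apply: (integrable_bounded_powRN (C := C)) => //; first exact: ltW.
    - by move=> y /andP[_ yc]; apply: cW2; lra.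
    - by move=> y /andP[_ yc]; apply: W2C; lra.
  rewrite (_ : (fun y => _) = fun y => w2 y * (x0 - y) `^ (- p) - W2 y * (x0 - y) `^ (- p)).
    exact: integrable_EFinB.
  by apply/funext => y; rewrite /V2; ring.
have Vc := V_c c (lexx c).
have parts : \int[mu]_(y in `]A, c[) ((x0 - y) `^ (- p) * V2 y) =
    p * (p + 1) * \int[mu]_(y in `]A, c[) ((x0 - y) `^ (- (p + 1 + 1)) * V y).
  have [Vc0 V1c0 _] := Vc.
  apply: (parts_smooth_kernel (V1 := V1) Ac cx0 (ltW p0)) => //.
  - by move=> y /andP[Ay yc]; apply: dV; rewrite Ay (le_lt_trans yc).
  - by move=> y /andP[Ay yc]; apply: dV1; rewrite Ay (le_lt_trans yc).
  - by move=> y /andP[Ay yc]; apply: cV2; rewrite Ay (le_lt_trans yc).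
have dWv y : y <= v -> is_derive y 1 W (W1 y) by move=> yv; exact: dW (le_lt_trans yv vB).
have dW1v y : y <= v -> is_derive y 1 W1 (W2 y) by move=> yv; exact: dW1 (le_lt_trans yv vB).
(* The derivative acts on the kernel in the V part and on W in the convolution part. *)
exists (fun x => - p * \int[mu]_(y in `]A, c[) ((x - y) `^ (- (p + 1)) * V y) +
  \int[mu]_(y in `]0, v - A[) (W1 (x - y) * y `^ (- p))), u, v; split.
- by rewrite ux0.
- move=> x xuv; have /andP[ux xv] := xuv.
  have d1 := is_derive_smooth_kernel (lt_trans cu ux) (ltW p0) iV.
  have d2 := is_derive_convolution (v - A) p01 xuv dWv WC W1C.
  apply: near_is_derive (is_deriveD d1 d2).
  near=> z; have uz : u < z by near: z; exact: lt_nbhsr.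
  have zv : z < v by near: z; exact: lt_nbhsl.
  apply/esym; apply: (split_convolution (a := a) (C := C)) => //.
  - exact: lt_trans uz.
  - by move=> y _; rewrite /V subrK.
  - by move=> y /andP[/V_c[]].
  - by move=> y /W_a[].
  - by move=> y /andP[_ yz]; apply: cW; rewrite (lt_trans yz)// (lt_trans zv).
  - by move=> y /andP[_ yz]; apply: WC; rewrite ltW// (lt_trans yz).
  - by apply: integrable_smooth_kernel => //; [exact: lt_trans uz|exact: ltW].
- rewrite (@split_convolution w2 V2 W2 p A a c x0 v C) //.
  (* The V part now has the form that differentiating the kernel twice produces. *)
  + rewrite parts.
    have d1 := is_derive_smooth_kernel (lt_trans cu ux0) (addr_ge0 (ltW p0) ler01) iV.
    have x0uv : u < x0 < v by rewrite ux0.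
    have d2 := is_derive_convolution (v - A) p01 x0uv dW1v W1C W2C.
    have d3 : is_derive x0 1 (fun x => - p * \int[mu]_(y in `]A, c[) ((x - y) `^ (- (p + 1)) * V y))
        (- p * (- (p + 1) * \int[mu]_(y in `]A, c[) ((x0 - y) `^ (- (p + 1 + 1)) * V y))).
      exact: is_deriveZ.
    rewrite [p * (p + 1) * _](_ : _ = - p * (- (p + 1) *
      \int[mu]_(y in `]A, c[) ((x0 - y) `^ (- (p + 1 + 1)) * V y))); last by ring.
    exact: is_deriveD.
  + by move=> y _; rewrite /V2 subrK.
  + by move=> y /andP[/V_c[]].
  + by move=> y /W_a[].
  + by move=> y /andP[_ yz]; apply: cW2; exact: lt_trans yz x0B.
  + by move=> y /andP[_ yz]; apply: W2C; rewrite ltW// (lt_trans yz).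
Unshelve. all: by end_near. Qed.

End riemann_liouville.

Section riemann_liouville_right.
Context {R : realType}.
Notation mu := (@lebesgue_measure R).
Implicit Types (f F : R -> R) (a b c p x y z : R).

Lemma is_derive_compN f (df : R) x : is_derive (- x) 1 f df ->
  is_derive x 1 (fun x => f (- x)) (- df).
Proof.
move=> d1; have d2 : is_derive x 1 (-%R : R -> R) (-1) by exact: is_deriveNid.
by have := @is_derive1_comp _ f -%R x _ _ d1 d2; rewrite mulrN1.
Qed.

Lemma continuous_compN f x : {for - x, continuous f} -> {for x, continuous (fun x => f (- x))}.
Proof. by move=> cf; apply: continuous_comp => //; exact: opp_continuous. Qed.

Lemma integral_oppr_itv f a b : measurable_fun `]a, b[ f ->
  \int[mu]_(x in `]a, b[) f x = \int[mu]_(x in `](- b), (- a)[) f (- x).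
Proof.
move=> mf; rewrite (integral_reflect_itv 0 mf) !sub0r.
by apply: eq_Rintegral => x _; rewrite sub0r.
Qed.

(** The reflection x -> -x reduces this to the left case. Each derivative changes the sign, so the
    second one keeps it. *)
Lemma RL_caputo_right (w w1 w2 : R -> R) p A B x0 : 0 < p < 1 -> A < x0 < B ->
  (forall x, A < x < B -> is_derive x 1 w (w1 x)) ->
  (forall x, A < x < B -> is_derive x 1 w1 (w2 x)) ->
  (forall x, A < x < B -> {for x, continuous w2}) ->
  w x @[x --> B^'-] --> (0 : R) -> w1 x @[x --> B^'-] --> (0 : R) ->
  mu.-integrable `]x0, B[ (EFin \o (fun y => w2 y * (y - x0) `^ (- p))) ->
  exists (F1 : R -> R) (u v : R), [/\ u < x0 < v,
    forall x, u < x < v -> is_derive x 1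
      (fun x => \int[mu]_(y in `]x, B[) (w y * (y - x) `^ (- p))) (F1 x) &
    is_derive x0 1 F1 (\int[mu]_(y in `]x0, B[) (w2 y * (y - x0) `^ (- p)))].
Proof.
move=> p01 /andP[Ax0 x0B] dw dw1 cw2 wB w1B iw2.
pose W x := w (- x); pose W1 x := - w1 (- x); pose W2 x := w2 (- x).
have NAB x : - B < x < - A -> A < - x < B by move=> /andP[? ?]; apply/andP; split; lra.
have dW x : - B < x < - A -> is_derive x 1 W (W1 x).
  by move=> /NAB /dw; exact: is_derive_compN.
have dW1 x : - B < x < - A -> is_derive x 1 W1 (W2 x).
  move=> /NAB /dw1 d1; rewrite /W2 -[w2 _]opprK.
  by apply: is_deriveN; exact: is_derive_compN.
have cW2 x : - B < x < - A -> {for x, continuous W2}.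
  by move=> /NAB /cw2; exact: continuous_compN.
have wN (f : R -> R) (l : R) : f x @[x --> B^'-] --> l -> f (- x) @[x --> (- B)^'+] --> l.
  by move=> /cvg_at_leftNP.
have WA : W x @[x --> (- B)^'+] --> (0 : R) by exact: wN.
have W1A : W1 x @[x --> (- B)^'+] --> (0 : R).
  by rewrite -[X in _ --> X]oppr0; apply: cvgN; exact: wN.
have cker x y : x < y -> {for y, continuous (fun y => (y - x) `^ (- p))}.
  by move=> xy; exact: is_derive_continuous (is_derive_powRN_subl _ xy).
have intE (f : R -> R) x : A < x < B -> (forall y, A < y < B -> {for y, continuous f}) ->
    \int[mu]_(y in `](- B), (- x)[) (f (- y) * (- x - y) `^ (- p)) =
    \int[mu]_(y in `]x, B[) (f y * (y - x) `^ (- p)).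
  move=> /andP[Ax xB] cf; rewrite [RHS]integral_oppr_itv.
    by apply: eq_Rintegral => y _; rewrite [- x - y]addrC.
  apply: measurable_fun_oo => y /andP[xy yB]; apply: cvgM; last exact: cker.
  by apply: cf; rewrite yB (lt_trans Ax).
have x0N : - B < - x0 < - A by rewrite !ltrN2 x0B.
have iW2 : mu.-integrable `](- B), (- x0)[ (EFin \o (fun y => W2 y * (- x0 - y) `^ (- p))).
  have := @integrable_reflect_itv _ (fun y => w2 y * (y - x0) `^ (- p)) (- B) (- x0) 0.
  rewrite !sub0r !opprK => /(_ iw2).
  rewrite (_ : (fun y => _) = fun y => W2 y * (- x0 - y) `^ (- p))//.
  by apply/funext => y; rewrite /W2 !sub0r [- y - x0]addrC.
have [F1 [u [v [/andP[ux xv] dF dF1]]]] := RL_caputo_left p01 x0N dW dW1 cW2 WA W1A iW2.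
(* The reflected interval is cut down to ]A, B[, where [intE] identifies the two integrals. *)
exists (fun x => - F1 (- x)), (Num.max (- v) A), (Num.min (- u) B); split.
- by rewrite gt_max lt_min; apply/andP; split; apply/andP; split; lra.
- move=> x; rewrite gt_max lt_min => /andP[/andP[vx Ax] /andP[xu xB]].
  have xuv : u < - x < v by apply/andP; split; lra.
  apply: near_is_derive (is_derive_compN (dF _ xuv)).
  near=> z; apply: (intE w).
    by apply/andP; split; near: z; [exact: lt_nbhsr|exact: lt_nbhsl].
  by move=> y /dw; exact: is_derive_continuous.
- rewrite -(intE w2)//; last by rewrite Ax0.
  by rewrite -[X in is_derive _ _ _ X]opprK; apply: is_deriveN; exact: is_derive_compN.
Unshelve. all: by end_near. Qed.

End riemann_liouville_right.

(** * Lines through a convex domain *)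

Section lines.
Context {R : realType} {d : nat}.
Notation Rd := 'rV[R]_d.
Notation e_ l := (delta_mx 0 l : Rd).
Implicit Types (Omega : set Rd) (v : Rd -> R) (x p : Rd) (l : 'I_d) (t xi : R).

Lemma on_lineD x l h t : h *: e_ l + on_line x l t = on_line x l (h + t).
Proof.
apply/rowP => j; rewrite !mxE eqxx/=.
by case: eqP => _; rewrite ?mulr1// mulr0 add0r.
Qed.

Lemma on_line_id x l : on_line x l (x ord0 l) = x.
Proof. by apply/rowP => j; rewrite !mxE; case: eqP => [->|]. Qed.

Lemma on_line_on_line x l t xi : on_line (on_line x l t) l xi = on_line x l xi.
Proof. by apply/rowP => j; rewrite !mxE; case: eqP. Qed.

Lemma on_line_coord x l t : on_line x l t ord0 l = t.
Proof. by rewrite mxE eqxx. Qed.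

Lemma on_lineE x l t : on_line x l t = x + (t - x ord0 l) *: e_ l.
Proof. by rewrite -{2}(on_line_id x l) addrC on_lineD subrK. Qed.

Lemma continuous_on_line x l : continuous (on_line x l).
Proof.
move=> t; rewrite (_ : on_line x l = fun t => x + (t - x ord0 l) *: e_ l).
  apply: cvgD; first exact: cvg_cst.
  by apply: cvgZr_tmp; apply: cvgB; [exact: cvg_id|exact: cvg_cst].
by apply/funext => z; exact: on_lineE.
Qed.

(** The directional and the one-variable difference quotients are the same function, so derivability
    and the value of the derivative transfer together, default values included. *)
Lemma quotient_on_line v x l t :
  (fun h : R => h^-1 *: ((v \o shift (on_line x l t)) (h *: e_ l) - v (on_line x l t))) =
  (fun h : R => h^-1 *: (((fun s => v (on_line x l s)) \o shift t) (h *: 1) - v (on_line x l t))).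
Proof.
apply/funext => h; rewrite /= /shift /= on_lineD; congr (_ *: (v (on_line x l (_ + _)) - _)).
by rewrite /GRing.scale/= mulr1.
Qed.

Lemma pderiv_on_line v x l t :
  pderiv l v (on_line x l t) = derive1 (fun s : R => v (on_line x l s)) t.
Proof. by rewrite derive1E /pderiv /derive quotient_on_line. Qed.

Lemma pderivE v x l : pderiv l v x = derive1 (fun s : R => v (on_line x l s)) (x ord0 l).
Proof. by rewrite -pderiv_on_line on_line_id. Qed.

Lemma is_derive_on_line v x l t : derivable v (on_line x l t) (e_ l) ->
  is_derive t 1 (fun s => v (on_line x l s)) (pderiv l v (on_line x l t)).
Proof.
move=> dv; apply: DeriveDef; last by rewrite pderiv_on_line derive1E.
by move: dv; rewrite /derivable quotient_on_line.
Qed.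

(** Convexity cannot be applied to p, which is only in the closure. A nearby p' of Omega replaces
    it, and x moves within a ball in Omega to compensate. *)
Lemma convex_open_segment Omega x p t : open Omega -> convex_set Omega ->
  Omega x -> closure Omega p -> 0 < t <= 1 -> Omega (p + t *: (x - p)).
Proof.
move=> oO cO Ox Op /andP[t0 t1].
have /nbhs_ballP[r /= r0 rO] : nbhs x Omega by exact: open_nbhs_nbhs.
have tr0 : 0 < t * r by rewrite mulr_gt0.
have [p' [Op' pp']] := Op _ (nbhsx_ballx p _ tr0).
have {}pp' : `|p - p'| < t * r by move: pp'; rewrite mx_norm_ball.
(* The solution of t x' + (1 - t) p' = t x + (1 - t) p; its distance from x is at most |p - p'| / t
   < r. *)
pose x' := x + ((1 - t) / t) *: (p - p').
have Ox' : Omega x'.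
  apply: rO; rewrite mx_norm_ball /ball_/= /x' opprD addrA subrr sub0r normrN.
  rewrite normrZ ger0_norm; last by rewrite divr_ge0 ?subr_ge0// ltW.
  apply: (@le_lt_trans _ _ (t^-1 * `|p - p'|)).
    by rewrite ler_wpM2r// ler_piMl ?invr_ge0 ?(ltW t0)//; lra.
  by rewrite mulrC ltr_pdivrMr// mulrC.
have := cO x' p' (Itv01 (ltW t0) t1); rewrite !inE => /(_ Ox' Op').
rewrite /conv/=; congr Omega.
rewrite /x' /unstable.onem scalerDr scalerA mulrCA divff ?gt_eqF// mulr1.
by rewrite !scalerBl !scalerBr !scale1r; apply/rowP => j; rewrite !mxE; ring.
Qed.

Lemma on_line_closure_bounded Omega l x : bounded_set Omega ->
  exists2 M : R, 0 <= M & forall y xi, closure Omega (on_line y l xi) -> `|xi| <= M.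
Proof.
(* One unit is for the strict bound in [bounded_set], the other for approximating a closure point
   from Omega. *)
move=> [M [_ HM]]; exists (`|M| + 2); first by rewrite addr_ge0.
move=> y xi Oxi.
have [z [Oz xiz]] := Oxi _ (nbhsx_ballx _ 1 ltr01).
have zM : `|z| <= `|M| + 1 by apply: HM => //; rewrite (le_lt_trans (ler_norm _))// ltrDl.
have zl : `|z ord0 l| <= `|z|.
  rewrite [leRHS]mx_normrE.
  exact: (@le_bigmax _ _ _ (0 : R) (fun ij : 'I_1 * 'I_d => `|z ij.1 ij.2|) (ord0, l)).
have : `|xi - z ord0 l| < 1 by case: xiz => _ /(_ ord0 l); rewrite on_line_coord.
have := ler_distD (z ord0 l) xi 0; rewrite !subr0 => h1 h2.
have -> : (2 : R) = 1 + 1 by ring.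
apply: (le_trans h1); rewrite addrA [leRHS]addrC lerD ?(ltW h2)//.
exact: le_trans zM.
Qed.

Lemma on_line_nbhs Omega x l t : open Omega -> Omega (on_line x l t) ->
  exists2 e : R, 0 < e & forall s, `|t - s| < e -> Omega (on_line x l s).
Proof.
move=> oO Ot; have /nbhs_ballP[e /= e0 eO] : nbhs t (on_line x l @^-1` Omega).
  by apply: continuous_on_line; exact: open_nbhs_nbhs.
by exists e => // s ts; exact: eO.
Qed.

Section convex_line.
Variables (Omega : set Rd) (l : 'I_d) (x : Rd).
Hypotheses (bcO : bounded_convex_domain Omega) (Ox : Omega x).
Let S := [set xi | closure Omega (on_line x l xi)].
Let L := XL Omega l x.
Let U := XR Omega l x.

Let closedS : closed S.
Proof.
have : closed (on_line x l @^-1` closure Omega).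
  apply: closed_comp; last exact: closed_closure.
  by move=> t _; exact: continuous_on_line.
by [].
Qed.

Let Sx : S (x ord0 l).
Proof. by rewrite /S/= on_line_id; exact: subset_closure. Qed.

Let has_infS : has_inf S.
Proof.
have [_ _ bO _] := bcO; have [M M0 HM] := on_line_closure_bounded l x bO.
split; first by exists (x ord0 l).
by exists (- M) => xi /HM; rewrite ler_norml => /andP[].
Qed.

Let has_supS : has_sup S.
Proof.
have [_ _ bO _] := bcO; have [M M0 HM] := on_line_closure_bounded l x bO.
split; first by exists (x ord0 l).
by exists M => xi /HM; rewrite ler_norml => /andP[].
Qed.

Lemma closure_XL : closure Omega (on_line x l L).
Proof.
have : closure S L.
  move=> B /nbhs_ballP[e /= e0 eB]; have [z Sz zL] := inf_adherent e0 has_infS.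
  exists z; split => //; apply: eB; rewrite /ball/= distrC ger0_norm; last first.
    by rewrite subr_ge0; apply: inf_lbound => //; case: has_infS.
  by rewrite ltrBlDl.
by rewrite -(closure_id S).1.
Qed.

Lemma closure_XR : closure Omega (on_line x l U).
Proof.
have : closure S U by case: has_supS => ? ?; exact: closure_sup.
by rewrite -(closure_id S).1.
Qed.

Lemma segment_from_closure xi t : closure Omega (on_line x l xi) -> 0 < t <= 1 ->
  Omega (on_line x l (xi + t * (x ord0 l - xi))).
Proof.
move=> Oxi t01; have [oO _ _ cO] := bcO.
have := convex_open_segment oO cO Ox Oxi t01; congr Omega.
apply/rowP => j; rewrite !mxE; case: eqP => [->//|_].
by rewrite subrr mulr0 addr0.
Qed.

Lemma XL_lb xi : closure Omega (on_line x l xi) -> L <= xi.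
Proof. by move=> Sxi; apply: inf_lbound => //; case: has_infS. Qed.

Lemma XR_ub xi : closure Omega (on_line x l xi) -> xi <= U.
Proof. by move=> Sxi; apply: ub_le_sup => //; case: has_supS. Qed.

Lemma XL_lt_inside xi : Omega (on_line x l xi) -> L < xi.
Proof.
have [oO _ _ _] := bcO => Oxi; have [e e0 eO] := on_line_nbhs oO Oxi.
apply: (@le_lt_trans _ _ (xi - e / 2)); last by rewrite ltrBlDr ltrDl divr_gt0.
apply: XL_lb; apply: subset_closure; apply: eO.
by rewrite subKr ger0_norm ?divr_ge0 ?ltW// ltr_pdivrMr// ltr_pMr// ltr1n.
Qed.

Lemma XR_gt_inside xi : Omega (on_line x l xi) -> xi < U.
Proof.
have [oO _ _ _] := bcO => Oxi; have [e e0 eO] := on_line_nbhs oO Oxi.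
apply: (@lt_le_trans _ _ (xi + e / 2)); first by rewrite ltrDl divr_gt0.
apply: XR_ub; apply: subset_closure; apply: eO.
rewrite opprD addrA subrr sub0r normrN.
by rewrite ger0_norm ?divr_ge0 ?ltW// ltr_pdivrMr// ltr_pMr// ltr1n.
Qed.

Lemma XL_lt : L < x ord0 l.
Proof. by apply: XL_lt_inside; rewrite on_line_id. Qed.

Lemma XR_gt : x ord0 l < U.
Proof. by apply: XR_gt_inside; rewrite on_line_id. Qed.

(** Every point of the open chord is a convex combination, with positive weight on x, of x and one
    of the two ends. *)
Lemma on_line_inside xi : L < xi < U -> Omega (on_line x l xi).
Proof.
move=> /andP[Lxi xiU]; have [xix|xxi] := leP xi (x ord0 l).
  have xL := XL_lt; have xL0 : 0 < x ord0 l - L by rewrite subr_gt0.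
  have := @segment_from_closure L ((xi - L) / (x ord0 l - L)) closure_XL.
  rewrite divfK ?gt_eqF// subrKC; apply.
  by rewrite divr_gt0 ?subr_gt0// ler_pdivrMr// mul1r lerD2r.
have xU := XR_gt; have xU0 : 0 < U - x ord0 l by rewrite subr_gt0.
have := @segment_from_closure U ((U - xi) / (U - x ord0 l)) closure_XR.
rewrite -[x ord0 l - U]opprB mulrN divfK ?gt_eqF// subKr; apply.
by rewrite divr_gt0 ?subr_gt0// ler_pdivrMr// mul1r lerB// ltW.
Qed.

(** The ends of a chord are where the boundary conditions on value and gradient enter the
    one-dimensional argument. *)
Lemma boundary_XL : boundary Omega (on_line x l L).
Proof.
split; first exact: closure_XL.
by move=> /interior_subset /XL_lt_inside; rewrite ltxx.
Qed.

Lemma boundary_XR : boundary Omega (on_line x l U).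
Proof.
split; first exact: closure_XR.
by move=> /interior_subset /XR_gt_inside; rewrite ltxx.
Qed.

End convex_line.
End lines.

(** * Riemann-Liouville and Caputo derivatives agree along the chords of the domain *)

Section riemann_liouville_caputo.
Context {R : realType} {d : nat}.
Notation Rd := 'rV[R]_d.
Notation mu := (@lebesgue_measure R).
Notation e_ l := (delta_mx 0 l : Rd).
Variables (Omega : set Rd) (alpha : 'I_d -> R) (l : 'I_d) (v : Rd -> R).
Hypotheses (bcO : bounded_convex_domain Omega) (alpha12 : 1 < alpha l <= 2).
Hypotheses (rv : space_regular Omega alpha v) (vv : vanishes_with_gradient Omega v).

Lemma XL_on_line (x : Rd) t : XL Omega l (on_line x l t) = XL Omega l x.
Proof.
have E : on_line (on_line x l t) l = on_line x l by apply/funext => xi; exact: on_line_on_line.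
by rewrite /XL E.
Qed.

Lemma XR_on_line (x : Rd) t : XR Omega l (on_line x l t) = XR Omega l x.
Proof.
have E : on_line (on_line x l t) l = on_line x l by apply/funext => xi; exact: on_line_on_line.
by rewrite /XR E.
Qed.

Lemma cvg_on_line_within (F : set_system R) (D : set Rd) (x : Rd) t :
  Filter F -> F --> nbhs t -> (\forall s \near F, D (on_line x l s)) ->
  on_line x l @ F --> within D (nbhs (on_line x l t)).
Proof.
move=> FF Ft FD B HB.
have H : nbhs (on_line x l t) [set q | D q -> B q] by [].
have := Ft _ (@continuous_on_line _ _ x l t _ H); apply: filterS2 FD => s Ds; exact.
Qed.

Let w (x : Rd) (s : R) := v (on_line x l s).
Let w1 (x : Rd) (s : R) := pderiv l v (on_line x l s).
Let w2 (x : Rd) (s : R) := pderiv l (pderiv l v) (on_line x l s).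

Let dw (x : Rd) s : Omega x -> XL Omega l x < s < XR Omega l x -> is_derive s 1 (w x) (w1 x s).
Proof.
move=> Ox sLU; apply: is_derive_on_line.
by have [_ H _] := rv; have [d1 d2 d3] := H l _ (on_line_inside bcO Ox sLU).
Qed.

Let dw1 (x : Rd) s : Omega x -> XL Omega l x < s < XR Omega l x -> is_derive s 1 (w1 x) (w2 x s).
Proof.
move=> Ox sLU; apply: is_derive_on_line.
by have [_ H _] := rv; have [d1 d2 d3] := H l _ (on_line_inside bcO Ox sLU).
Qed.

Let cw2 (x : Rd) s : Omega x -> XL Omega l x < s < XR Omega l x -> {for s, continuous (w2 x)}.
Proof.
move=> Ox sLU; apply: continuous_comp; first exact: continuous_on_line.
by have [_ H _] := rv; have [d1 d2 d3] := H l _ (on_line_inside bcO Ox sLU).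
Qed.

(** The two limits have different sources: continuity on the closure for the value, the prescribed
    limit from within Omega for the derivative. *)
Let w_boundary (x : Rd) t (F : set_system R) : Filter F -> F --> nbhs t ->
  (\forall s \near F, Omega (on_line x l s)) -> boundary Omega (on_line x l t) ->
  w x s @[s --> F] --> (0 : R) /\ w1 x s @[s --> F] --> (0 : R).
Proof.
move=> FF Ft FO bt; have [vt0 /(_ l) v1t0] := vv bt; split.
  rewrite -vt0 /w.
  have [+ _ _] := rv => /subspace_continuousP /(_ _ bt.1).
  apply: cvg_comp; apply: cvg_on_line_within => //.
  by apply: filterS FO => s; exact: subset_closure.
by apply: cvg_comp v1t0; exact: cvg_on_line_within.
Qed.

Let near_XL (x : Rd) : Omega x -> \forall s \near (XL Omega l x)^'+, Omega (on_line x l s).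
Proof.
move=> Ox; near=> s; apply: (on_line_inside bcO Ox); apply/andP; split; near: s.
  exact: nbhs_right_gt.
by apply: nbhs_right_lt; exact: lt_trans (XL_lt l bcO Ox) (XR_gt l bcO Ox).
Unshelve. all: by end_near. Qed.

Let near_XR (x : Rd) : Omega x -> \forall s \near (XR Omega l x)^'-, Omega (on_line x l s).
Proof.
move=> Ox; near=> s; apply: (on_line_inside bcO Ox); apply/andP; split; near: s.
  by apply: nbhs_left_gt; exact: lt_trans (XL_lt l bcO Ox) (XR_gt l bcO Ox).
exact: nbhs_left_lt.
Unshelve. all: by end_near. Qed.

(** The inner derivative must be known on a whole interval around x before the outer one can be
    taken, so the formula for [Phi] is local and not pointwise. *)
Lemma second_pderiv_on_line (Phi : Rd -> R) (F F1 : R -> R) (x : Rd) a b (c : R) :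
  a < x ord0 l < b -> (forall s, a < s < b -> Phi (on_line x l s) = F s) ->
  (forall s, a < s < b -> is_derive s 1 F (F1 s)) -> is_derive (x ord0 l) 1 F1 c ->
  pderiv l (pderiv l Phi) x = c.
Proof.
move=> xab PhiE dF dF1.
have nearab s : a < s < b -> \forall z \near s, a < z < b.
  move=> /andP[as_ sb]; near=> z; apply/andP; split; near: z; [exact: lt_nbhsr|exact: lt_nbhsl].
have P1 s : a < s < b -> pderiv l Phi (on_line x l s) = F1 s.
  move=> sab; rewrite pderiv_on_line derive1E.
  have E : {near s, F =1 fun s => Phi (on_line x l s)}.
    by apply: filterS (nearab s sab) => z zab; rewrite PhiE.
  by have d1 := near_is_derive E (dF s sab); rewrite derive_val.
rewrite pderivE derive1E.
have E : {near x ord0 l, F1 =1 fun s => pderiv l Phi (on_line x l s)}.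
  by apply: filterS (nearab _ xab) => z zab; rewrite P1.
by have d1 := near_is_derive E dF1; rewrite derive_val.
Unshelve. all: by end_near. Qed.

Lemma RL_left_caputo (x : Rd) : Omega x ->
  RL_left Omega (alpha l) l v x = caputo_left Omega (alpha l) l v x.
Proof.
move=> Ox; rewrite /RL_left /caputo_left; case: ifPn => // a2; congr (_ * _).
have a2lt : alpha l < 2 by case/andP: alpha12 => _; rewrite lt_neqAle a2.
have p01 : 0 < alpha l - 1 < 1 by case/andP: alpha12 => ? _; apply/andP; split; lra.
have xLU : XL Omega l x < x ord0 l < XR Omega l x by rewrite (XL_lt l bcO Ox) (XR_gt l bcO Ox).
have cL : (XL Omega l x)^'+ --> nbhs (XL Omega l x) by exact: cvg_within.
have [wA w1A] := w_boundary _ cL (near_XL Ox) (boundary_XL l bcO Ox).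
have CE : caputo_integrand_left (alpha l) l v x =
    fun y => w2 x y * (x ord0 l - y) `^ (- (alpha l - 1)).
  by apply/funext => y; rewrite powRN.
have iw2 : mu.-integrable `]XL Omega l x, x ord0 l[
    (EFin \o (fun y => w2 x y * (x ord0 l - y) `^ (- (alpha l - 1)))).
  have [_ _ /(_ l x Ox a2lt)[+ _]] := rv.
  by rewrite CE.
have [F1 [a [b [xab dF dF1]]]] := RL_caputo_left p01 xLU (fun s => dw Ox) (fun s => dw1 Ox)
  (fun s => cw2 Ox) wA w1A iw2.
rewrite CE.
apply: (second_pderiv_on_line xab _ dF dF1) => s _.
(* The base point is the same for all points of the line; only the upper limit and the kernel depend
   on s. *)
rewrite XL_on_line on_line_coord; apply: eq_Rintegral => y _.
by rewrite on_line_on_line powRN.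
Qed.

Lemma RL_right_caputo (x : Rd) : Omega x ->
  RL_right Omega (alpha l) l v x = caputo_right Omega (alpha l) l v x.
Proof.
move=> Ox; rewrite /RL_right /caputo_right; case: ifPn => // a2; congr (_ * _).
have a2lt : alpha l < 2 by case/andP: alpha12 => _; rewrite lt_neqAle a2.
have p01 : 0 < alpha l - 1 < 1 by case/andP: alpha12 => ? _; apply/andP; split; lra.
have xLU : XL Omega l x < x ord0 l < XR Omega l x by rewrite (XL_lt l bcO Ox) (XR_gt l bcO Ox).
have cU : (XR Omega l x)^'- --> nbhs (XR Omega l x) by exact: cvg_within.
have [wA w1A] := w_boundary _ cU (near_XR Ox) (boundary_XR l bcO Ox).
have CE : caputo_integrand_right (alpha l) l v x =
    fun y => w2 x y * (y - x ord0 l) `^ (- (alpha l - 1)).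
  by apply/funext => y; rewrite powRN.
have iw2 : mu.-integrable `]x ord0 l, XR Omega l x[
    (EFin \o (fun y => w2 x y * (y - x ord0 l) `^ (- (alpha l - 1)))).
  have [_ _ /(_ l x Ox a2lt)[_ +]] := rv.
  by rewrite CE.
have [F1 [a [b [xab dF dF1]]]] := RL_caputo_right p01 xLU (fun s => dw Ox) (fun s => dw1 Ox)
  (fun s => cw2 Ox) wA w1A iw2.
rewrite CE.
apply: (second_pderiv_on_line xab _ dF dF1) => s _.
rewrite XR_on_line on_line_coord; apply: eq_Rintegral => y _.
by rewrite on_line_on_line powRN.
Qed.

End riemann_liouville_caputo.

(** If K2 were positive near 0, K1 would increase strictly there; but the maximum at 0 and the mean
    value theorem give a < 0 < b with K1 a >= 0 >= K1 b. This handles alpha = 2. *)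
Lemma second_derive_max_le0 (R : realType) (K K1 K2 : R -> R) :
  (forall x : R, is_derive x 1 K (K1 x)) -> (forall x : R, is_derive x 1 K1 (K2 x)) ->
  continuous K2 -> (forall x, K x <= K 0) -> K2 0 <= 0.
Proof.
move=> dK dK1 cK2 K0; rewrite leNgt; apply/negP => K20.
have /nbhs_ballP[e /= e0 He] : \forall x \near (0 : R), 0 < K2 x.
  by apply: (cK2 0 (fun y => 0 < y)); exact: lt_nbhsr.
have mvt (F F1 : R -> R) a b : (forall x : R, is_derive x 1 F (F1 x)) -> a < b ->
    exists2 c, a < c < b & F b - F a = F1 c * (b - a).
  move=> dF ab; have [|c cab E] := @MVT _ F F1 a b ab (fun x _ => dF x).
  - by apply: continuous_subspaceT => x; exact: is_derive_continuous (dF x).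
  - by exists c => //; move: cab; rewrite in_itv.
have he0 : 0 < e / 2 by rewrite divr_gt0.
have [b /andP[b0 be] Eb] := mvt _ _ 0 (e / 2) dK he0.
have [a /andP[ae a0] Ea] := mvt _ _ (- (e / 2)) 0 dK ltac:(by rewrite oppr_lt0).
have [c /andP[ac cb] Ec] := mvt _ _ a b dK1 (lt_trans a0 b0).
have Kb : K1 b <= 0.
  by have := K0 (e / 2); rewrite -subr_le0 Eb subr0 pmulr_lle0.
have Ka : 0 <= K1 a.
  have := K0 (- (e / 2)); rewrite -subr_ge0 Ea sub0r opprK pmulr_lge0//.
have Kc : 0 < K2 c.
  apply: He; rewrite /ball /= sub0r normrN ltr_norml; apply/andP; split; lra.
have : 0 < K2 c * (b - a) by rewrite mulr_gt0// subr_gt0 (lt_trans a0 b0).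
by rewrite -Ec; lra.
Qed.

(** * Test functions *)

Section vanishing.
Context {R : realType} {d : nat}.
Notation Rd := 'rV[R]_d.
Implicit Types (K Omega : set Rd) (psi phi : Rd -> R) (l : 'I_d).

Lemma continuous_vanish_bounded K psi : compact K -> continuous psi ->
  (forall x, ~ K x -> psi x = 0) -> exists2 C : R, 0 <= C & forall x, `|psi x| <= C.
Proof.
move=> cK cpsi psi0.
have /compact_bounded[M [Mr MP]] : compact (psi @` K).
  by apply: continuous_compact => //; exact: continuous_subspaceT.
exists (`|M| + 1); first by rewrite addr_ge0.
move=> x; have [Kx|nKx] := pselect (K x).
  by apply: (MP _ _ (psi x)); [rewrite (le_lt_trans (ler_norm _))// ltrDl|exists x].
by rewrite psi0// normr0 addr_ge0.
Qed.

Lemma pderiv_vanish K psi l : closed K -> (forall x, ~ K x -> psi x = 0) ->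
  forall x, ~ K x -> pderiv l psi x = 0.
Proof.
move=> cK psi0 x nKx; rewrite /pderiv -[RHS](@derive_cst R Rd R (0 : R) x (delta_mx 0 l)).
apply: near_eq_derive.
have : open (~` K) by exact: closed_openC.
rewrite openE => /(_ _ nKx); apply: filterS => y nKy; exact: psi0.
Qed.

End vanishing.

Section test_functions.
Context {R : realType} {d : nat}.
Notation Rd := 'rV[R]_d.
Variables (Omega : set Rd) (l : 'I_d) (phi : Rd -> R).
Hypothesis tphi : test_function Omega phi.

Let K := closure [set x | phi x != 0].
Let phi_ k := iter k (pderiv l) phi.

Let phi_foldr k : phi_ k = foldr pderiv phi (nseq k l).
Proof. by rewrite /phi_; elim: k => //= k ->. Qed.

Lemma test_continuous k : continuous (iter k (pderiv l) phi).
Proof. by have [/(_ (nseq k l))[+ _] _ _] := tphi; rewrite -phi_foldr. Qed.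

Lemma test_derivable k x : derivable (iter k (pderiv l) phi) x (delta_mx 0 l).
Proof. by have [/(_ (nseq k l))[_ +] _ _] := tphi; rewrite -phi_foldr; exact. Qed.

Lemma test_is_derive k x (t : R) :
  is_derive t 1 (fun s => iter k (pderiv l) phi (on_line x l s))
    (iter k.+1 (pderiv l) phi (on_line x l t)).
Proof. exact/is_derive_on_line/test_derivable. Qed.

Lemma test_vanish_support k x : ~ K x -> iter k (pderiv l) phi x = 0.
Proof.
elim: k x => [|k IHk] x /=; last first.
  by apply: pderiv_vanish => //; exact: closed_closure.
by move=> nKx; apply/eqP; apply: contra_notT nKx => nphi; exact: subset_closure.
Qed.

Lemma test_vanish k x : ~ Omega x -> iter k (pderiv l) phi x = 0.
Proof. by have [_ _ KO] := tphi; move=> nOx; apply: test_vanish_support => /KO. Qed.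

Lemma test_bounded k : exists2 C : R, 0 <= C & forall x, `|iter k (pderiv l) phi x| <= C.
Proof.
have [_ cK _] := tphi; apply: (continuous_vanish_bounded cK).
  exact: test_continuous.
exact: test_vanish_support.
Qed.

End test_functions.

(** * Fubini for a bounded function times integrable factors *)

Section kernel.
Context {R : realType}.
Notation mu := (@lebesgue_measure R).

Lemma integrable_boundedM d (Y : measurableType d) (nu : {measure set Y -> \bar R})
  (D : set Y) (A k : Y -> R) (C : R) : measurable D -> measurable_fun D A ->
  (forall y, `|A y| <= C) -> nu.-integrable D (EFin \o k) ->
  nu.-integrable D (EFin \o (fun y => A y * k y)).
Proof.
move=> mD mA AC ik.
have mk : measurable_fun D k by apply/measurable_EFinP; exact: measurable_int ik.
apply: (le_integrable mD _ _ (integrable_EFinZ mD C ik)).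
  by apply/measurable_EFinP; exact: measurable_funM.
move=> y _ /=; rewrite lee_fin !normrM ler_wpM2r//.
by rewrite (le_trans (AC y))// ler_norm.
Qed.

Lemma EFin_Rintegral d (Y : measurableType d) (nu : {measure set Y -> \bar R})
  (D : set Y) (f : Y -> R) : measurable D -> nu.-integrable D (EFin \o f) ->
  ((\int[nu]_(y in D) f y)%:E = \int[nu]_(y in D) (f y)%:E)%E.
Proof. by move=> mD intf; rewrite fineK//; exact: integrable_fin_num. Qed.

Variables (d : measure_display) (X : measurableType d).
Variable lam : {sigma_finite_measure set X -> \bar R}.
Variables (A : X * measurableTypeR R -> R) (b : X -> R) (k : R -> R) (C : R).
Hypotheses (mA : measurable_fun setT A) (AC : forall z, `|A z| <= C).
Hypotheses (ib : lam.-integrable setT (EFin \o b)) (ik : mu.-integrable setT (EFin \o k)).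

Let G (z : X * measurableTypeR R) := b z.1 * (A z * k z.2).

Let mAt t : measurable_fun setT (fun s => A (t, s)).
Proof. exact: (measurableT_comp mA (pair1_measurable _)). Qed.

Let mAs s : measurable_fun setT (fun t => A (t, s)).
Proof. exact: (measurableT_comp mA (pair2_measurable _)). Qed.

Let mG : measurable_fun setT G.
Proof.
have mb : measurable_fun setT b by apply/measurable_EFinP; exact: measurable_int ib.
have mk : measurable_fun setT (k : measurableTypeR R -> R).
  by apply/measurable_EFinP; exact: measurable_int ik.
apply: measurable_funM; first exact: (measurableT_comp mb measurable_fst).
by apply: measurable_funM => //; exact: (measurableT_comp mk measurable_snd).
Qed.

(** Integrating |G| in s first leaves at most C |b t| times the integral of |k|, which is integrable
    in t. *)
Let iG : (lam \x mu)%E.-integrable setT (EFin \o G).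
Proof.
apply/(@integrable12ltyP _ _ _ _ _ lam mu (EFin \o G)).
  by apply/measurable_EFinP; exact: mG.
have ikn : mu.-integrable setT (EFin \o (fun s => `|k s|)).
  exact: integrable_norm.
have H t : (\int[mu]_s `|(EFin \o G) (t, s)| <=
    (`|b t| * (C * \int[mu]_s `|k s|))%:E)%E.
  have -> : (`|b t| * (C * \int[mu]_s `|k s|))%:E =
      (\int[mu]_s (`|b t| * (C * `|k s|))%:E)%E.
    rewrite -EFin_Rintegral//; last by apply: integrable_EFinZ => //; exact: integrable_EFinZ.
    rewrite RintegralZl//; last exact: integrable_EFinZ.
    by rewrite RintegralZl.
  apply: ge0_le_integral => //.
  - apply/measurable_EFinP; apply: measurableT_comp => //.
    exact: (measurableT_comp mG (pair1_measurable _)).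
  - apply: (measurable_int mu); apply: (@integrable_EFinZ _ _ _ mu _ _ _ (fun s => C * `|k s|)) => //.
    exact: integrable_EFinZ.
  - by move=> s _; rewrite /= lee_fin /G !normrM/= ler_wpM2l// ler_wpM2r.
have : lam.-integrable setT (EFin \o (fun t => (C * \int[mu]_s `|k s|) * `|b t|)).
  by apply: integrable_EFinZ => //; exact: integrable_norm.
move=> /integrableP[mB]; apply: le_lt_trans.
apply: ge0_le_integral => //.
- by move=> t _; exact: integral_ge0.
- apply: (measurable_fun_fubini_tonelli_F (fun z => `|(EFin \o G) z|%E)) => //.
  by apply: measurableT_comp => //; apply/measurable_EFinP.
- exact: measurableT_comp.
- move=> t _; rewrite (le_trans (H t))//= lee_fin mulrC; exact: ler_norm.
Qed.

Let FE t : (\int[mu]_s (G (t, s))%:E = (b t * \int[mu]_s (A (t, s) * k s))%:E)%E.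
Proof.
have iAk : mu.-integrable setT (EFin \o (fun s => A (t, s) * k s)).
  exact: (@integrable_boundedM _ _ mu setT (fun s => A (t, s)) k C).
rewrite -RintegralZl// EFin_Rintegral//; exact: integrable_EFinZ.
Qed.

(** Measurability of the inner integral in t is a by-product of integrability on the product
    space. *)
Lemma measurable_kernel_integral :
  measurable_fun setT (fun t => b t * \int[mu]_s (A (t, s) * k s)).
Proof.
apply/measurable_EFinP; rewrite (_ : _ \o _ = fubini_F mu (EFin \o G)).
  exact: (@measurable_fubini_F _ _ _ _ _ lam mu _ iG).
by apply/funext => t; rewrite /= /fubini_F /= FE.
Qed.

Lemma kernel_integral_exchange :
  \int[lam]_t (b t * \int[mu]_s (A (t, s) * k s)) =
  \int[mu]_s ((\int[lam]_t (A (t, s) * b t)) * k s).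
Proof.
apply: (congr1 fine).
transitivity (\int[lam]_t \int[mu]_s (EFin \o G) (t, s))%E.
  by apply: eq_integral => t _; rewrite /= FE.
rewrite Fubini//; apply: eq_integral => s _.
have iAb : lam.-integrable setT (EFin \o (fun t => A (t, s) * b t)).
  exact: (@integrable_boundedM _ _ lam setT (fun t => A (t, s)) b C).
rewrite mulrC -[X in (X * _)%:E]/(k s) -[Y in (_ * Y)%:E]/(\int[lam]_t (A (t, s) * b t)).
rewrite -RintegralZl// EFin_Rintegral//; last exact: integrable_EFinZ.
by apply: eq_integral => t _; congr EFin; rewrite /G/=; ring.
Qed.

End kernel.

(** * The autocorrelation of a test function *)

Section correlation.
Context {R : realType} {d : nat}.
Notation Rd := 'rV[R]_d.
Notation mR := (measurableTypeR R).
Notation mu := (@lebesgue_measure R).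
Notation lam := (@lebesgue_tuple R d).
Notation row := (@row_of_tuple R d).
Variables (Omega : set Rd) (l : 'I_d) (phi : Rd -> R) (sg : R).
Hypotheses (bcO : bounded_convex_domain Omega) (tphi : test_function Omega phi).
Hypothesis sg1 : sg ^+ 2 = 1.

Let D := row @^-1` Omega.
(** The sign [sg] is -1 for left derivatives and 1 for right ones, so that both are treated at
    once. *)
Let move_ (s : R) (x : Rd) := on_line x l (x ord0 l + sg * s).
Let phi_ k := iter k (pderiv l) phi.
(** [H k] is the k-th derivative of the autocorrelation [H 0]. Integrating over D captures all of
    it, since phi vanishes outside Omega. *)
Let H k (s : R) := \int[lam]_(t in D) (sg ^+ k * phi_ k (move_ s (row t)) * phi (row t)).

Let cphi k : continuous (phi_ k). Proof. exact: (@test_continuous _ _ _ l phi tphi k). Qed.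

Let phi_out k t : t \notin D -> phi_ k (row t) = 0.
Proof. by rewrite notin_setE => nOt; exact: (@test_vanish _ _ _ l phi tphi k). Qed.

Lemma domain_measurable : measurable D.
Proof. by have [oO _ _ _] := bcO; exact: measurable_row_open. Qed.

Lemma domain_finite : (lam D < +oo)%E.
Proof. by have [_ _ bO _] := bcO; exact: (lebesgue_row_bounded bO domain_measurable). Qed.

(** The same translation on tuples, where measurability and translation invariance are available. *)
Let move_tuple s (t : d.-tuple mR) : d.-tuple mR :=
  tshift (fun i => if i == l then sg * s else 0) t.

Let row_move s t : row (move_tuple s t) = move_ s (row t).
Proof.
apply/rowP => i; rewrite !mxE tnth_mktuple; case: ifPn => [/eqP ->|_]; last by rewrite addr0.
by [].
Qed.

Lemma measurable_move_pair (psi : Rd -> R) : continuous psi ->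
  measurable_fun setT (fun z : d.-tuple mR * mR =>
    psi (on_line (row z.1) l (row z.1 ord0 l + sg * z.2))).
Proof.
move=> cpsi.
have mm : measurable_fun setT (fun z : d.-tuple mR * mR => move_tuple z.2 z.1).
  apply/measurable_fun_tnthP => i.
  rewrite (_ : _ \o _ = fun z => tnth z.1 i + (if i == l then sg * z.2 else 0)).
    apply: measurable_funD.
      exact: (measurableT_comp (measurable_tnth i) measurable_fst).
    by case: (i == l) => //; apply: measurable_funM => //; exact: measurable_snd.
  by apply/funext => z /=; rewrite tnth_mktuple.
rewrite (_ : (fun _ => _) = (psi \o row) \o (fun z : d.-tuple mR * mR => move_tuple z.2 z.1)).
  by apply: measurableT_comp => //; exact: measurable_row_continuous.
by apply/funext => z /=; rewrite row_move.
Qed.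

Let measurable_move s (psi : Rd -> R) : continuous psi ->
  measurable_fun setT (fun t => psi (move_ s (row t))).
Proof.
move=> cpsi; exact: (measurableT_comp (measurable_move_pair cpsi) (pair2_measurable s)).
Qed.

Let integrable_phi : lam.-integrable D (EFin \o (phi \o row)).
Proof.
have [C C0 HC] := test_bounded l tphi 0.
apply: (@integrable_bounded _ _ _ lam D domain_measurable _ C domain_finite).
  by apply: measurable_funTS; apply: measurable_row_continuous; exact: (@cphi 0).
by move=> t _; exact: HC.
Qed.

Let is_derive_move k x (s : R) : is_derive s 1
  (fun s => sg ^+ k * phi_ k (move_ s x)) (sg ^+ k.+1 * phi_ k.+1 (move_ s x)).
Proof.
have d1 := @test_is_derive _ _ Omega l phi tphi k x (x ord0 l + sg * s).
have d2 : is_derive s 1 (fun s : R => x ord0 l + sg * s) sg.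
  have -> : sg = 0 + (sg * 1 + s * 0) by rewrite add0r mulr1 mulr0 addr0.
  rewrite mulr1 mulr0 addr0.
  apply: is_deriveD; apply: is_derive_eq; by rewrite /GRing.scale /=; ring.
have d3 := @is_derive1_comp _ (fun t => phi_ k (on_line x l t)) _ s _ _ d1 d2.
apply: is_derive_eq; rewrite /GRing.scale/= exprSr; ring.
Qed.

Let is_derive_H k (s : R) : is_derive s 1 (H k) (H k.+1 s).
Proof.
have [C C0 HC] := test_bounded l tphi k; have [C' C'0 HC'] := test_bounded l tphi k.+1.
have ge0 j : 0 <= `|sg| ^+ j by exact: exprn_ge0.
apply: (@derive_under_kernel _ _ _ lam _
    (fun s t => sg ^+ k.+1 * phi_ k.+1 (move_ s (row t))) D _
    (`|sg| ^+ k * C + `|sg| ^+ k.+1 * C') _ (s - 1) (s + 1)).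
- exact: domain_measurable.
- by rewrite ltrBlDr ltrDl ltr01.
- exact: integrable_phi.
- move=> x _; apply: measurable_funTS; apply: measurable_funM => //.
  by apply: measurable_move; exact: cphi.
- move=> x y _ _; split; first exact: is_derive_move.
  + by rewrite normrM normrX (le_trans (ler_wpM2l (ge0 k) (HC _)))// lerDl mulr_ge0.
  + by rewrite normrM normrX (le_trans (ler_wpM2l (ge0 k.+1) (HC' _)))// lerDr mulr_ge0.
Qed.

Let continuous_H k : continuous (H k).
Proof. by move=> s; exact: is_derive_continuous (is_derive_H k s). Qed.

Let move0 x : move_ 0 x = x.
Proof. by rewrite /move_ mulr0 addr0 on_line_id. Qed.

(* ab <= (a^2 + b^2)/2 and the invariance of the integral under translation *)
Let H_le s : H 0 s <= H 0 0.
Proof.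
have [C C0 HC] := test_bounded l tphi 0; rewrite /= in HC.
have cphi0 : continuous phi := @cphi 0.
have mphi r : measurable_fun D (fun t => phi (move_ r (row t))).
  by apply: measurable_funTS; exact: measurable_move.
have i2 r : lam.-integrable D (EFin \o (fun t => phi (move_ r (row t)) ^+ 2)).
  apply: (@integrable_bounded _ _ _ lam D domain_measurable _ (C ^+ 2) domain_finite).
    exact: measurable_funX.
  by move=> t _; rewrite normrX lerXn2r// nnegrE.
have ip r : lam.-integrable D (EFin \o (fun t => sg ^+ 0 * phi_ 0 (move_ r (row t)) * phi (row t))).
  apply: (@integrable_bounded _ _ _ lam D domain_measurable _ (C * C) domain_finite).
    apply: measurable_funM => //; first exact: measurable_funM.
    by apply: measurable_funTS; exact: measurable_row_continuous.
  by move=> t _; rewrite expr0 mul1r normrM ler_pM.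
(* Over all tuples the two integrals agree; restricting the shifted one to D can only lose mass. *)
have tr : \int[lam]_(t in D) (phi (move_ s (row t)) ^+ 2) <= \int[lam]_(t in D) (phi (row t) ^+ 2).
  have i20 := i2 0; rewrite (_ : (fun t => _) = fun t => phi (row t) ^+ 2) in i20; last first.
    by apply/funext => t; rewrite move0.
  rewrite -lee_fin EFin_Rintegral//; last exact: domain_measurable.
  rewrite EFin_Rintegral//; last exact: domain_measurable.
  have m2 : measurable_fun setT (fun t => (phi (row t) ^+ 2)%:E).
    by apply/measurable_EFinP; apply: measurable_funX; exact: measurable_row_continuous.
  have -> : (\int[lam]_(t in D) (phi (row t) ^+ 2)%:E =
      \int[lam]_t (phi (row t) ^+ 2)%:E)%E.
    rewrite integral_mkcond; apply: eq_integral => t _; rewrite patchE.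
    case: ifPn => // nDt; have -> : phi (row t) = 0.
      exact: (phi_out 0 nDt).
    by rewrite expr0n.
  rewrite -(ge0_integral_tshift (fun i => if i == l then sg * s else 0) m2); last first.
    by move=> t; rewrite lee_fin sqr_ge0.
  under [leRHS]eq_integral => t _ do rewrite -/(move_tuple s t) row_move.
  apply: ge0_subset_integral => //; first exact: domain_measurable.
    by apply/measurable_EFinP; apply: measurable_funX; exact: measurable_move.
  by move=> t _; rewrite lee_fin sqr_ge0.
have E0 : H 0 0 = \int[lam]_(t in D) (phi (row t) ^+ 2).
  by apply: eq_Rintegral => t _; rewrite expr0 mul1r move0 expr2.
have i20 := i2 0; rewrite (_ : (fun t => _) = fun t => phi (row t) ^+ 2) in i20; last first.
  by apply/funext => t; rewrite move0.
apply: (@le_trans _ _ (\int[lam]_(t in D)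
   (2^-1 * (phi (move_ s (row t)) ^+ 2) + 2^-1 * (phi (row t) ^+ 2)))).
  apply: le_Rintegral => //; first exact: domain_measurable.
  - by apply: integrable_EFinD; [exact: domain_measurable| |];
      (apply: integrable_EFinZ; first exact: domain_measurable).
  - move=> t _; rewrite expr0 mul1r.
    have amgm (a b : R) : a * b <= 2^-1 * a ^+ 2 + 2^-1 * b ^+ 2.
      by have := sqr_ge0 (a - b); lra.
    exact: amgm.
rewrite RintegralD; last first.
- by apply: integrable_EFinZ => //; exact: domain_measurable.
- by apply: integrable_EFinZ => //; exact: domain_measurable.
- exact: domain_measurable.
rewrite !RintegralZl//; try exact: domain_measurable.
rewrite E0; move: tr; move: (\int[lam]_(t in D) _) (\int[lam]_(t in D) _) => a b; lra.
Qed.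

Lemma inner_second_pderiv_le0 :
  inner lam D (pderiv l (pderiv l phi) \o row) (phi \o row) <= 0.
Proof.
have -> : inner lam D (pderiv l (pderiv l phi) \o row) (phi \o row) = H 2 0.
  by apply: eq_Rintegral => t _; rewrite sg1 mul1r move0.
apply: (@second_derive_max_le0 _ (H 0) (H 1) (H 2)).
- exact: is_derive_H.
- exact: is_derive_H.
- exact: continuous_H.
- exact: H_le.
Qed.

Variables (p M : R).
Hypotheses (p01 : 0 < p < 1) (M0 : 0 < M).
Hypothesis OM : forall x, Omega x -> ~ Omega (move_ M x).

(** For p = alpha - 1 and up to the factor 1/Gamma(2 - alpha), this is the one-sided derivative of
    phi. One interval ]0, M[ serves all x in Omega, because [phi_ 2] vanishes beyond the end of the
    chord. *)
Let B x := \int[mu]_(s in `]0, M[) (phi_ 2 (move_ s x) * s `^ (- p)).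

Let k := (fun s : R => s `^ (- p)) \_ `]0, M[.

Let ik : mu.-integrable setT (EFin \o k).
Proof.
have := integrable_powRN M p01; rewrite integrable_mkcond//.
by rewrite restrict_EFin.
Qed.

Let BE x : B x = \int[mu]_s (phi_ 2 (move_ s x) * k s).
Proof.
rewrite /B Rintegral_mkcond; apply: eq_Rintegral => s _.
by rewrite /k !patchE; case: ifP => // _; rewrite mulr0.
Qed.

Let A (z : d.-tuple mR * mR) := phi_ 2 (move_ z.2 (row z.1)).

Let mA : measurable_fun setT A.
Proof. by apply: measurable_move_pair; exact: cphi. Qed.

Lemma measurable_ray_integral : measurable_fun D (B \o row).
Proof.
have [C C0 HC] := test_bounded l tphi 2.
(* The integrable factor in t is the indicator of D, which has finite measure. *)
have i1 : lam.-integrable setT (EFin \o (\1_D : _ -> R)).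
  rewrite (_ : EFin \o _ = (EFin \o cst 1) \_ D); last first.
    by apply/funext => t; rewrite patchE /= indicE; case: (_ \in _).
  rewrite -integrable_mkcond; last exact: domain_measurable.
  by apply: (@integrable_bounded _ _ _ lam D domain_measurable _ 1 domain_finite) => // t _; rewrite normr1.
have := @measurable_kernel_integral _ _ _ lam A \1_D k C mA (fun z => HC _) i1 ik.
move=> mB; apply/(measurable_restrictT _ _).2; first exact: domain_measurable.
rewrite (_ : _ \_ _ = fun t => \1_D t * \int[mu]_s (A (t, s) * k s))//.
apply/funext => t; rewrite patchE indicE; case: ifP => _; last by rewrite mul0r.
by rewrite mul1r /= BE.
Qed.

Lemma bounded_ray_integral : exists C, forall x, `|B x| <= C.
Proof.
have [C C0 HC] := test_bounded l tphi 2.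
exists (\int[mu]_s (C * `|k s|)) => x; rewrite BE.
have ms : measurable_fun setT (fun s : mR => phi_ 2 (move_ s x)).
  have cm : continuous (fun s => phi_ 2 (move_ s x)).
    move=> s; apply: continuous_comp; last exact: cphi.
    apply: (@continuous_comp _ _ _ (fun s => x ord0 l + sg * s) (on_line x l)).
      by apply: cvgD; [exact: cvg_cst|apply: cvgM; [exact: cvg_cst|exact: cvg_id]].
    exact: continuous_on_line.
  exact: continuous_measurable_fun.
have iAk : mu.-integrable setT (EFin \o (fun s => phi_ 2 (move_ s x) * k s)).
  by apply: (@integrable_boundedM _ _ _ mu setT (fun s => phi_ 2 (move_ s x)) k C) => // s; exact: HC.
apply: (le_trans (le_normr_Rintegral _ iAk)) => //.
apply: le_Rintegral => //.
- exact: (integrable_norm iAk).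
- by apply: integrable_EFinZ => //; exact: (integrable_norm ik).
- by move=> s _ /=; rewrite normrM; apply: ler_wpM2r => //; exact: HC.
Qed.

Lemma inner_ray_integral_le0 : inner lam D (B \o row) (phi \o row) <= 0.
Proof.
have [C C0 HC] := test_bounded l tphi 2.
have ib : lam.-integrable setT (EFin \o (phi \o row)).
  have := integrable_phi; rewrite integrable_mkcond; last exact: domain_measurable.
  rewrite restrict_EFin (_ : _ \_ _ = phi \o row)//.
  apply/funext => t; rewrite patchE; case: ifPn => // nDt.
  exact/esym/(phi_out 0 nDt).
have exch := @kernel_integral_exchange _ _ _ lam A (phi \o row) k C mA (fun z => HC _) ib ik.
have E1 : inner lam D (B \o row) (phi \o row) =
    \int[lam]_t ((phi \o row) t * \int[mu]_s (A (t, s) * k s)).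
  rewrite /inner Rintegral_mkcond; apply: eq_Rintegral => t _; rewrite patchE.
  case: ifPn => [_|nDt]; first by rewrite /= mulrC BE.
  rewrite /= (_ : phi (row t) = 0) ?mul0r//.
  exact: (phi_out 0 nDt).
have E2 : \int[mu]_s ((\int[lam]_t (A (t, s) * (phi \o row) t)) * k s) =
    \int[mu]_(s in `]0, M[) (H 2 s * s `^ (- p)).
  rewrite [RHS]Rintegral_mkcond; apply: eq_Rintegral => s _.
  rewrite /k !patchE; case: ifP => _; last by rewrite mulr0.
  congr (_ * _); rewrite /H [RHS]Rintegral_mkcond; apply: eq_Rintegral => t _.
  rewrite patchE sg1 mul1r; case: ifPn => // nDt; rewrite /= (_ : phi (row t) = 0) ?mulr0//.
  exact: (phi_out 0 nDt).
rewrite E1 exch E2.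
(* Subtracting the constant H 0 0 gives the required maximum 0 at 0 and leaves the derivatives
   unchanged. *)
apply: (@integral_second_derive_powRN_le0 _ (fun s => H 0 s - H 0 0) (H 1) (H 2) p M p01 M0).
- move=> s; have d1 := is_derive_H 0 s.
  by apply: is_derive_eq; rewrite subr0.
- exact: is_derive_H.
- exact: continuous_H.
- by move=> s; rewrite subr_le0; exact: H_le.
- by rewrite subrr.
(* H 1 vanishes at M: a shift by M takes every point of Omega outside, where the derivative of phi
   is zero. *)
- transitivity (\int[lam]_(t in D) (0 : R)); last by rewrite /Rintegral integral0.
  apply: eq_Rintegral => t _; have [Ot|nOt] := pselect (Omega (row t)).
    by rewrite (_ : phi_ 1 _ = 0) ?mulr0 ?mul0r//; exact: (@test_vanish _ _ Omega l _ tphi 1 _ (OM Ot)).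
  by rewrite (_ : phi (row t) = 0) ?mulr0//; exact: (@test_vanish _ _ Omega l _ tphi 0 _ nOt).
Qed.

End correlation.

(** * Dissipativity of the fractional derivatives *)

Section half_plane_limit.
Context d (T : measurableType d) (R : realType) (mu : {measure set T -> \bar R}).
Variables (D : set T) (mD : measurable D).
Notation sqint := (sqint mu D).
Notation inner := (inner mu D).
Notation nrm := (nrm mu D).

Lemma sqint_bounded (f : T -> R) (C : R) : (mu D < +oo)%E -> measurable_fun D f ->
  (forall x, D x -> `|f x| <= C) -> sqint f.
Proof.
move=> foo mf fC; split => //.
apply: (@integrable_bounded _ _ _ mu D mD _ (C ^+ 2)) => //; first exact: measurable_funX.
move=> x Dx; rewrite normrX lerXn2r// ?nnegrE//; last exact: fC.
exact: le_trans (normr_ge0 _) (fC x Dx).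
Qed.

(** The condition (g,f) <= 0 is closed under simultaneous L^2 limits of f and g. *)
Lemma inner_le0_closed v w : sqint v -> sqint w ->
  (forall e : R, 0 < e -> exists f g, [/\ sqint f, sqint g, inner g f <= 0,
     nrm (fun x => v x - f x) < e & nrm (fun x => w x - g x) < e]) ->
  inner w v <= 0.
Proof.
move=> sv sw approx; rewrite leNgt; apply/negP => wv0.
pose S := nrm v + nrm w + 1.
have S0 : 0 < S by rewrite ltr_wpDl// addr_ge0// nrm_ge0.
(* With e <= 1 the three difference terms below add up to at most e S, and this e also makes e S <=
   (w,v)/2, a contradiction. *)
pose e := Num.min 1 (inner w v / (2 * S)).
have e0 : 0 < e by rewrite lt_min ltr01 divr_gt0// mulr_gt0.
have [f [g [sf sg gf nf ng]]] := approx e e0.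
have sv' := sqintB mD sv sf; have sw' := sqintB mD sw sg.
have E : inner w v = inner (fun x => w x - g x) v + inner w (fun x => v x - f x)
    - inner (fun x => w x - g x) (fun x => v x - f x) + inner g f.
  rewrite (innerBl mD sw sg sv) (innerBl mD sw sg sv').
  rewrite ![inner _ (fun x => v x - f x)]innerC (innerBl mD sv sf sw) (innerBl mD sv sf sg).
  rewrite (innerC _ _ v w) (innerC _ _ v g) (innerC _ _ f w) (innerC _ _ f g).
  ring.
have c1 : inner (fun x => w x - g x) v <= e * nrm v.
  rewrite (le_trans (ler_norm _))// (le_trans (cauchy_schwarz mD sw' sv))//.
  by rewrite ler_wpM2r ?nrm_ge0// ltW.
have c2 : inner w (fun x => v x - f x) <= nrm w * e.
  rewrite (le_trans (ler_norm _))// (le_trans (cauchy_schwarz mD sw sv'))//.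
  by rewrite ler_wpM2l ?nrm_ge0// ltW.
have c3 : - inner (fun x => w x - g x) (fun x => v x - f x) <= e * e.
  rewrite (le_trans (ler_norm _))// normrN (le_trans (cauchy_schwarz mD sw' sv'))//.
  by rewrite ler_pM ?nrm_ge0// ltW.
have e1 : e * e <= e * 1 by apply: ler_wpM2l; [exact: ltW|rewrite ge_min lexx].
have : inner w v <= e * S.
  have add5 (a b c q x y z t : R) : a <= x -> b <= y -> - c <= t -> t <= z -> q <= 0 ->
      a + b - c + q <= x + y + z by lra.
  by rewrite E /S !mulrDr (mulrC e (nrm w)); exact: add5 c1 c2 c3 e1 gf.
have : e * S <= inner w v / 2.
  rewrite -ler_pdivlMr// -mulrA -invfM ge_min; apply/orP; right; exact: lexx.
by move: wv0; move: (inner w v) (e * S) => *; lra.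
Qed.

End half_plane_limit.

Section L2_norm.
Context {R : realType} {d : nat}.
Notation Rd := 'rV[R]_d.
Notation lam := (@lebesgue_tuple R d).
Notation row := (@row_of_tuple R d).
Variable Omega : set Rd.
Let D := row @^-1` Omega.
Hypothesis mD : measurable D.

Lemma sqint_L2norm v : sqint lam D (v \o row) ->
  L2norm Omega v = (nrm lam D (v \o row))%:E.
Proof.
move=> [mv iv]; rewrite /L2norm /nrm.
have E : (\int[lam]_(t in D) ((v (row t)) ^+ 2)%:E)%E = (inner lam D (v \o row) (v \o row))%:E.
  by rewrite -EFin_Rintegral//; congr EFin; apply: eq_Rintegral => t _; rewrite expr2.
by rewrite E poweR_EFin powR12_sqrt// inner_ge0.
Qed.

Lemma inL2_sqint v : inL2 Omega v -> sqint lam D (v \o row).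
Proof.
move=> [mv voo]; split => //; apply/integrableP; split.
  by apply/measurable_EFinP; exact: measurable_funX.
rewrite (eq_integral (fun t => ((v (row t)) ^+ 2)%:E)); last first.
  by move=> t _; rewrite /= ger0_norm// sqr_ge0.
by apply: lty_poweRy voo; rewrite invr_eq0.
Qed.

Lemma graph_norm_lt v w (e : R) : sqint lam D (v \o row) -> sqint lam D (w \o row) ->
  (graph_norm Omega v w < e%:E)%E ->
  nrm lam D (v \o row) < e /\ nrm lam D (w \o row) < e.
Proof.
move=> sv sw; rewrite /graph_norm !sqint_L2norm// !poweR_EFin !powR_mulrn ?nrm_ge0//.
rewrite powR12_sqrt ?addr_ge0 ?sqr_ge0// lte_fin => H.
split; apply: le_lt_trans H.
  by rewrite -[leLHS]ger0_norm ?nrm_ge0// -sqrtr_sqr ler_wsqrtr// lerDl sqr_ge0.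
by rewrite -[leLHS]ger0_norm ?nrm_ge0// -sqrtr_sqr ler_wsqrtr// lerDr sqr_ge0.
Qed.

(** The graph norm dominates both |v - phi| and |L v - L phi|, so (v, L v) is a limit of pairs whose
    sign is known. *)
Lemma J0_inner_le0 (L : (Rd -> R) -> Rd -> R) v :
  (forall phi, test_function Omega phi -> [/\ sqint lam D (phi \o row),
     sqint lam D (L phi \o row) & inner lam D (L phi \o row) (phi \o row) <= 0]) ->
  J0 Omega L v -> [/\ sqint lam D (v \o row), sqint lam D (L v \o row) &
    inner lam D (L v \o row) (v \o row) <= 0].
Proof.
move=> Ltest [/inL2_sqint sv /inL2_sqint sLv approx]; split => //.
apply: inner_le0_closed => // e e0.
have [phi [tphi /graph_norm_lt lt_e]] := approx e e0.
have [sphi sLphi le0] := Ltest phi tphi.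
exists (phi \o row), (L phi \o row).
by have [||] := lt_e; [exact: sqintB| exact: sqintB|split].
Qed.

End L2_norm.

Section interval_integrals.
Context {R : realType}.
Notation mu := (@lebesgue_measure R).

(** A translation is the composition of two reflections. *)
Lemma integral_shift_itv (f : R -> R) a b c : mu.-integrable `]a, b[ (EFin \o f) ->
  \int[mu]_(x in `]a, b[) f x = \int[mu]_(x in `]a - c, b - c[) f (c + x).
Proof.
move=> intf; have mf : measurable_fun `]a, b[ f by apply/measurable_EFinP; exact: measurable_int intf.
rewrite (integral_reflect_itv c mf).
rewrite (@integral_reflect_itv _ (fun x => f (c - x)) _ _ 0); last first.
  apply/measurable_EFinP; apply: (measurable_int mu).
  by apply: integrable_reflect_itv; rewrite !subKr.
by rewrite !sub0r !opprB; apply: eq_Rintegral => x _; rewrite sub0r opprK.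
Qed.

Lemma integral_extend_itv (f : R -> R) a b : a <= b ->
  (forall x, a <= x < b -> f x = 0) ->
  \int[mu]_(x in `]0, a[) f x = \int[mu]_(x in `]0, b[) f x.
Proof.
move=> ab f0; rewrite Rintegral_mkcond [RHS]Rintegral_mkcond.
apply: eq_Rintegral => x _; rewrite !patchE.
have -> : (x \in `]0, a[%classic) = (0 < x < a) by apply/idP/idP; rewrite inE/= ?in_itv.
have -> : (x \in `]0, b[%classic) = (0 < x < b) by apply/idP/idP; rewrite inE/= ?in_itv.
case: ifP => [/andP[x0 xa]|].
  by rewrite x0 (lt_le_trans xa ab).
case: ifP => // /andP[x0 xb]; rewrite x0/= => /negbT; rewrite -leNgt => ax.
by rewrite f0// ax xb.
Qed.

Lemma Gamma_ge0 (z : R) : 0 <= Gamma z.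
Proof. by apply: Rintegral_ge0 => t _; rewrite mulr_ge0// ?powR_ge0// expR_ge0. Qed.

End interval_integrals.

Section test_functions_dissipative.
Context {R : realType} {d : nat}.
Notation Rd := 'rV[R]_d.
Notation mu := (@lebesgue_measure R).
Notation lam := (@lebesgue_tuple R d).
Notation row := (@row_of_tuple R d).
Variables (Omega : set Rd) (alpha : 'I_d -> R).
Hypotheses (bcO : bounded_convex_domain Omega) (alpha12 : forall l, 1 < alpha l <= 2).
Let D := row @^-1` Omega.
Let mD : measurable D := domain_measurable bcO.

(** A boundary point has a neighbourhood that misses the support. With this, test functions satisfy
    the conditions under which the two kinds of derivative agree. *)
Lemma test_vanishes_with_gradient phi : test_function Omega phi ->
  vanishes_with_gradient Omega phi.
Proof.
move=> tphi q [_]; have [oO _ _ _] := bcO; rewrite (interior_id _).1// => nOq.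
have [_ _ KO] := tphi.
have nKq : ~ closure [set x | phi x != 0] q by move=> /KO.
split => [|l].
  by apply/eqP; apply: contra_notT nKq => nphi; exact: subset_closure.
have oK : open (~` closure [set x | phi x != 0]) by apply: closed_openC; exact: closed_closure.
apply: cvg_near_cst; have := open_nbhs_nbhs (conj oK nKq).
by apply: filterS => y nKy _; exact: (@test_vanish_support _ _ l phi 1 y nKy).
Qed.

Lemma test_space_regular phi : test_function Omega phi -> space_regular Omega alpha phi.
Proof.
move=> tphi; split.
- by apply: continuous_subspaceT; have [/(_ [::])[]] := tphi.
- move=> l x _; split.
  + exact: (@test_derivable _ _ _ l _ tphi 0).
  + exact: (@test_derivable _ _ _ l _ tphi 1).
  + exact: (@test_continuous _ _ _ l _ tphi 2).
move=> l x Ox a2.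
have p01 : 0 < alpha l - 1 < 1.
  by have /andP[a1 _] := alpha12 l; rewrite subr_gt0 a1 ltrBlDr.
have [C C0 HC] := test_bounded l tphi 2.
have c2 (y : R) : {for y, continuous (fun y => pderiv l (pderiv l phi) (on_line x l y))}.
  apply: (@continuous_comp _ _ _ (on_line x l) (pderiv l (pderiv l phi))).
    exact: continuous_on_line.
  exact: (@test_continuous _ _ _ l _ tphi 2).
split.
  rewrite (_ : caputo_integrand_left _ _ _ _ = fun y =>
    pderiv l (pderiv l phi) (on_line x l y) * (x ord0 l - y) `^ (- (alpha l - 1))).
    by apply: (integrable_bounded_powRN p01 (lexx _) _ (fun y _ => HC _)).
  by apply/funext => y; rewrite powRN.
(* The right integrand is a left one, with singularity at 0, composed with y -> x_l - y. *)
rewrite (_ : caputo_integrand_right _ _ _ _ = fun y =>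
   (fun z => pderiv l (pderiv l phi) (on_line x l (x ord0 l - z)) * (0 - z) `^ (- (alpha l - 1)))
    (x ord0 l - y)).
  apply: (integrable_reflect_itv (f := fun z =>
    pderiv l (pderiv l phi) (on_line x l (x ord0 l - z)) * (0 - z) `^ (- (alpha l - 1)))).
  apply: (integrable_bounded_powRN p01 _ _ (fun y _ => HC _)); first by rewrite subrr.
  move=> y _; apply: (@continuous_comp _ _ _ (fun y => x ord0 l - y)
    (fun y => pderiv l (pderiv l phi) (on_line x l y))); last exact: c2.
  by apply: cvgB; [exact: cvg_cst|exact: cvg_id].
by apply/funext => y; rewrite /caputo_integrand_right subKr sub0r opprB powRN.
Qed.

Variable l : 'I_d.

Section ray_integral.
Variables (phi : Rd -> R).
Hypotheses (tphi : test_function Omega phi) (a2 : alpha l < 2).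
Let p01 : 0 < alpha l - 1 < 1.
Proof. by have /andP[a1 _] := alpha12 l; rewrite subr_gt0 a1 ltrBlDr. Qed.

(** One strict bound for all chords: a shift by M leaves Omega, and no ray inside Omega is longer
    than M. *)
Let diam : exists2 M : R, 0 < M & forall x y, Omega x -> Omega y ->
  (forall z, closure Omega (on_line x l z) -> `|z - y ord0 l| < M).
Proof.
have [_ _ bO _] := bcO.
have [B B0 HB] := on_line_closure_bounded l (0 : Rd) bO.
exists (B + B + 1); first by rewrite ltr_wpDl// addr_ge0.
move=> x y Ox Oy z Oz; rewrite (le_lt_trans (ler_normB _ _))// ltr_pwDr//.
apply: lerD; first exact: HB Oz.
by apply: (HB y); rewrite on_line_id; exact: subset_closure.
Qed.

(** Substitute s = x_l - xi, then lengthen the interval to M: beyond the end of the chord the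
    derivatives of phi vanish. The factor -1 is kept to match [sg]. *)
Lemma caputo_left_ray_integral : exists2 M : R, 0 < M &
  (forall x, Omega x -> ~ Omega (on_line x l (x ord0 l + -1 * M))) /\
  forall x, Omega x -> caputo_left Omega (alpha l) l phi x = (Gamma (2 - alpha l))^-1 *
    \int[mu]_(s in `]0, M[) (iter 2 (pderiv l) phi (on_line x l (x ord0 l + -1 * s)) *
       s `^ (- (alpha l - 1))).
Proof.
have [M M0 HM] := diam; exists M => //; split.
  move=> x Ox /subset_closure /(HM x x Ox Ox).
  by rewrite mulN1r addrAC subrr add0r normrN gtr0_norm// ltxx.
move=> x Ox; rewrite /caputo_left lt_eqF//; congr (_ * _).
have [_ _ /(_ l x Ox a2)[il _]] := test_space_regular tphi.
have mg : measurable_fun `]XL Omega l x, x ord0 l[ (caputo_integrand_left (alpha l) l phi x).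
  by apply/measurable_EFinP; exact: measurable_int il.
rewrite (integral_reflect_itv (x ord0 l) mg) subrr.
transitivity (\int[mu]_(s in `]0, x ord0 l - XL Omega l x[)
    (iter 2 (pderiv l) phi (on_line x l (x ord0 l + -1 * s)) * s `^ (- (alpha l - 1)))).
  by apply: eq_Rintegral => s _; rewrite /caputo_integrand_left subKr powRN mulN1r.
have XM : x ord0 l - XL Omega l x <= M.
  by rewrite (le_trans (ler_norm _))// distrC ltW// (HM x)//; exact: closure_XL.
apply: integral_extend_itv => // s /andP[sX _].
rewrite (test_vanish l tphi) ?mul0r// => /(XL_lt_inside bcO Ox).
by rewrite mulN1r ltrBrDr -ltrBrDl ltNge sX.
Qed.

Lemma caputo_right_ray_integral : exists2 M : R, 0 < M &
  (forall x, Omega x -> ~ Omega (on_line x l (x ord0 l + 1 * M))) /\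
  forall x, Omega x -> caputo_right Omega (alpha l) l phi x = (Gamma (2 - alpha l))^-1 *
    \int[mu]_(s in `]0, M[) (iter 2 (pderiv l) phi (on_line x l (x ord0 l + 1 * s)) *
       s `^ (- (alpha l - 1))).
Proof.
have [M M0 HM] := diam; exists M => //; split.
  move=> x Ox /subset_closure /(HM x x Ox Ox).
  by rewrite mul1r addrAC subrr add0r gtr0_norm// ltxx.
move=> x Ox; rewrite /caputo_right lt_eqF//; congr (_ * _).
have [_ _ /(_ l x Ox a2)[_ ir]] := test_space_regular tphi.
rewrite (integral_shift_itv (x ord0 l) ir) subrr.
transitivity (\int[mu]_(s in `]0, XR Omega l x - x ord0 l[)
    (iter 2 (pderiv l) phi (on_line x l (x ord0 l + 1 * s)) * s `^ (- (alpha l - 1)))).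
  by apply: eq_Rintegral => s _; rewrite /caputo_integrand_right (addrC (x ord0 l)) addrK powRN mul1r addrC.
have XM : XR Omega l x - x ord0 l <= M.
  by rewrite (le_trans (ler_norm _))// ltW// (HM x)//; exact: closure_XR.
apply: integral_extend_itv => // s /andP[sX _].
rewrite (test_vanish l tphi) ?mul0r// => /(XR_gt_inside bcO Ox).
by move: sX; rewrite mul1r lerBlDr addrC leNgt => /negP.
Qed.

End ray_integral.

(** Common to left and right derivatives. For alpha = 2 there is no singular kernel, and the sign
    comes from the second derivative of the autocorrelation at 0 instead. *)
Let dissipative (L : (Rd -> R) -> Rd -> R) (sg : R) : sg ^+ 2 = 1 ->
  (alpha l = 2 -> forall phi, L phi = pderiv l (pderiv l phi)) ->
  (alpha l < 2 -> forall phi, test_function Omega phi -> exists2 M : R, 0 < M &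
    (forall x, Omega x -> ~ Omega (on_line x l (x ord0 l + sg * M))) /\
    forall x, Omega x -> L phi x = (Gamma (2 - alpha l))^-1 *
      \int[mu]_(s in `]0, M[) (iter 2 (pderiv l) phi (on_line x l (x ord0 l + sg * s)) *
         s `^ (- (alpha l - 1)))) ->
  forall phi, test_function Omega phi -> [/\ sqint lam D (phi \o row),
     sqint lam D (L phi \o row) & inner lam D (L phi \o row) (phi \o row) <= 0].
Proof.
move=> sg1 L2 Llt phi tphi.
have Doo := domain_finite bcO.
have sk k : sqint lam D (iter k (pderiv l) phi \o row).
  have [C C0 HC] := test_bounded l tphi k.
  apply: (sqint_bounded mD Doo (C := C)) => [|t _]; last exact: HC.
  apply: measurable_funTS; apply: measurable_row_continuous.
  exact: (@test_continuous _ _ _ _ _ tphi k).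
have [a2|a2] := eqVneq (alpha l) 2.
  rewrite L2//; split; [exact: (sk 0)|exact: (sk 2)|].
  exact: (inner_second_pderiv_le0 l bcO tphi sg1).
have /andP[a1 a2'] := alpha12 l.
have {a2'}a2 : alpha l < 2 by rewrite lt_neqAle a2.
have p01 : 0 < alpha l - 1 < 1 by rewrite subr_gt0 a1 ltrBlDr.
have [M M0 [OM LE]] := Llt a2 phi tphi.
pose B x := \int[mu]_(s in `]0, M[) (iter 2 (pderiv l) phi (on_line x l (x ord0 l + sg * s)) *
         s `^ (- (alpha l - 1))).
have mB := measurable_ray_integral l sg bcO tphi M p01.
have [C HC] := bounded_ray_integral l sg tphi M p01.
have sB : sqint lam D (B \o row) by apply: (sqint_bounded mD Doo mB) => t _; exact: HC.
have E : {in D, (fun t => (Gamma (2 - alpha l))^-1 * B (row t)) =1 L phi \o row}.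
  by move=> t; rewrite inE => Ot; rewrite /= LE.
split; first exact: (sk 0).
  by apply: (eq_sqint mD E); exact: sqintZ.
rewrite -(eq_inner _ _ E) (innerZl mD)//; last exact: (sk 0).
rewrite mulr_ge0_le0 ?invr_ge0 ?Gamma_ge0//.
exact: (inner_ray_integral_le0 bcO tphi sg1 p01 M0 OM).
Qed.

Lemma test_RL_left_dissipative phi : test_function Omega phi ->
  [/\ sqint lam D (phi \o row), sqint lam D (RL_left Omega (alpha l) l phi \o row) &
     inner lam D (RL_left Omega (alpha l) l phi \o row) (phi \o row) <= 0].
Proof.
apply: (dissipative (sg := -1)) => [|a2 f|a2 f tf]; first by rewrite sqrrN expr1n.
  by rewrite /RL_left a2 eqxx.
have [M M0 [OM HM]] := caputo_left_ray_integral tf a2; exists M => //; split => // x Ox.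
rewrite (RL_left_caputo bcO (alpha12 l) (test_space_regular tf) (test_vanishes_with_gradient tf))//.
exact: HM.
Qed.

Lemma test_RL_right_dissipative phi : test_function Omega phi ->
  [/\ sqint lam D (phi \o row), sqint lam D (RL_right Omega (alpha l) l phi \o row) &
     inner lam D (RL_right Omega (alpha l) l phi \o row) (phi \o row) <= 0].
Proof.
apply: (dissipative (sg := 1)) => [|a2 f|a2 f tf]; first by rewrite expr1n.
  by rewrite /RL_right a2 eqxx.
have [M M0 [OM HM]] := caputo_right_ray_integral tf a2; exists M => //; split => // x Ox.
rewrite (RL_right_caputo bcO (alpha12 l) (test_space_regular tf) (test_vanishes_with_gradient tf))//.
exact: HM.
Qed.

End test_functions_dissipative.

(** * The error equation *)

Section space_linear.
Context {R : realType} {d : nat}.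
Notation Rd := 'rV[R]_d.
Notation mu := (@lebesgue_measure R).
Notation e_ l := (delta_mx 0 l : Rd).
Variables (Omega : set Rd) (alpha : 'I_d -> R).
Hypothesis bcO : bounded_convex_domain Omega.
Variables v w : Rd -> R.
Hypotheses (rv : space_regular Omega alpha v) (rw : space_regular Omega alpha w).
Let vw (x : Rd) := v x - w x.

Let near_Omega x : Omega x -> \forall y \near x, Omega y.
Proof. by have [oO _ _ _] := bcO => Ox; exact: open_nbhs_nbhs. Qed.

Let derivable_vw l x : Omega x -> derivable vw x (e_ l).
Proof.
move=> Ox; have [_ /(_ l x Ox)[dv _ _] _] := rv; have [_ /(_ l x Ox)[dw _ _] _] := rw.
exact: derivableB dv dw.
Qed.

Let pderivB l x : Omega x -> pderiv l vw x = pderiv l v x - pderiv l w x.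
Proof.
move=> Ox; have [_ /(_ l x Ox)[dv _ _] _] := rv; have [_ /(_ l x Ox)[dw _ _] _] := rw.
exact: (deriveB dv dw).
Qed.

(** The difference rule is known in Omega only, so its iteration relies on Omega being a
    neighbourhood of x. *)
Let near_pderivB l x : Omega x ->
  \forall y \near x, pderiv l v y - pderiv l w y = pderiv l vw y.
Proof. by move=> /near_Omega; apply: filterS => y Oy; rewrite pderivB. Qed.

Let derivable_pderiv_vw l x : Omega x -> derivable (pderiv l vw) x (e_ l).
Proof.
move=> Ox; have [_ /(_ l x Ox)[_ dv _] _] := rv; have [_ /(_ l x Ox)[_ dw _] _] := rw.
exact: near_eq_derivable (near_pderivB l Ox) (derivableB dv dw).
Qed.

Let pderiv2BE l x : Omega x ->
  pderiv l (pderiv l vw) x = pderiv l (pderiv l v) x - pderiv l (pderiv l w) x.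
Proof.
move=> Ox; have [_ /(_ l x Ox)[_ dv _] _] := rv; have [_ /(_ l x Ox)[_ dw _] _] := rw.
transitivity ('D_(e_ l) (fun y => pderiv l v y - pderiv l w y) x).
  exact/esym/near_eq_derive/near_pderivB.
exact: (deriveB dv dw).
Qed.

Let caputo_integrand_leftB l x y : Omega x -> XL Omega l x < y < x ord0 l ->
  caputo_integrand_left (alpha l) l vw x y =
  caputo_integrand_left (alpha l) l v x y - caputo_integrand_left (alpha l) l w x y.
Proof.
move=> Ox /andP[Ly yx]; rewrite /caputo_integrand_left pderiv2BE ?mulrBl//.
by apply: (on_line_inside bcO Ox); rewrite Ly (lt_trans yx (XR_gt l bcO Ox)).
Qed.

Let caputo_integrand_rightB l x y : Omega x -> x ord0 l < y < XR Omega l x ->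
  caputo_integrand_right (alpha l) l vw x y =
  caputo_integrand_right (alpha l) l v x y - caputo_integrand_right (alpha l) l w x y.
Proof.
move=> Ox /andP[xy yR]; rewrite /caputo_integrand_right pderiv2BE ?mulrBl//.
by apply: (on_line_inside bcO Ox); rewrite yR (lt_trans (XL_lt l bcO Ox) xy).
Qed.

Lemma space_regularB : space_regular Omega alpha vw.
Proof.
have [cv Hv Iv] := rv; have [cw Hw Iw] := rw; split.
- by move=> x; apply: cvgB; [exact: cv|exact: cw].
- move=> l x Ox; have [_ _ c2v] := Hv l x Ox; have [_ _ c2w] := Hw l x Ox; split.
  + exact: derivable_vw.
  + exact: derivable_pderiv_vw.
  + have lim : (fun y => pderiv l (pderiv l v) y - pderiv l (pderiv l w) y) @ x -->
        pderiv l (pderiv l vw) x.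
      by rewrite (pderiv2BE l Ox); exact: (cvgB c2v c2w).
    have nE : \forall y \near x, pderiv l (pderiv l v) y - pderiv l (pderiv l w) y =
        pderiv l (pderiv l vw) y.
      by have := near_Omega Ox; apply: filterS => y Oy; rewrite pderiv2BE.
    exact: (cvg_trans (near_eq_cvg nE) lim).
- move=> l x Ox a2; have [Ivl Ivr] := Iv l x Ox a2; have [Iwl Iwr] := Iw l x Ox a2; split.
    apply: (@eq_integrable _ _ _ mu `]XL Omega l x, x ord0 l[ _ (EFin \o (fun y =>
      caputo_integrand_left (alpha l) l v x y - caputo_integrand_left (alpha l) l w x y))) => //.
      by move=> y; rewrite inE/= in_itv/= => yI; rewrite caputo_integrand_leftB.
    by apply: (integrable_EFinB _ Ivl Iwl).
  apply: (@eq_integrable _ _ _ mu `]x ord0 l, XR Omega l x[ _ (EFin \o (fun y =>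
    caputo_integrand_right (alpha l) l v x y - caputo_integrand_right (alpha l) l w x y))) => //.
    by move=> y; rewrite inE/= in_itv/= => yI; rewrite caputo_integrand_rightB.
  by apply: (integrable_EFinB _ Ivr Iwr).
Qed.

Hypothesis alpha2 : forall l, alpha l <= 2.

Let caputo_leftB l x : Omega x -> caputo_left Omega (alpha l) l vw x =
  caputo_left Omega (alpha l) l v x - caputo_left Omega (alpha l) l w x.
Proof.
move=> Ox; rewrite /caputo_left.
have [_|an2] := eqVneq (alpha l) 2; first exact: pderiv2BE.
have a2 : alpha l < 2 by rewrite lt_neqAle an2 alpha2.
have [_ _ /(_ l x Ox a2)[Iv _]] := rv; have [_ _ /(_ l x Ox a2)[Iw _]] := rw.
rewrite -mulrBr; congr (_ * _); rewrite -RintegralB_oo//.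
by apply: eq_Rintegral => y; rewrite inE/= in_itv/= => yI; exact: caputo_integrand_leftB.
Qed.

Let caputo_rightB l x : Omega x -> caputo_right Omega (alpha l) l vw x =
  caputo_right Omega (alpha l) l v x - caputo_right Omega (alpha l) l w x.
Proof.
move=> Ox; rewrite /caputo_right.
have [_|an2] := eqVneq (alpha l) 2; first exact: pderiv2BE.
have a2 : alpha l < 2 by rewrite lt_neqAle an2 alpha2.
have [_ _ /(_ l x Ox a2)[_ Iv]] := rv; have [_ _ /(_ l x Ox a2)[_ Iw]] := rw.
rewrite -mulrBr; congr (_ * _); rewrite -RintegralB_oo//.
by apply: eq_Rintegral => y; rewrite inE/= in_itv/= => yI; exact: caputo_integrand_rightB.
Qed.

Lemma space_termB epsp epsm x : Omega x -> space_term Omega alpha epsp epsm vw x =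
  space_term Omega alpha epsp epsm v x - space_term Omega alpha epsp epsm w x.
Proof.
move=> Ox; have El : \sum_l epsp l * caputo_left Omega (alpha l) l vw x =
    \sum_l epsp l * caputo_left Omega (alpha l) l v x -
    \sum_l epsp l * caputo_left Omega (alpha l) l w x.
  by rewrite -sumrB; apply: eq_bigr => l _; rewrite (caputo_leftB l Ox) mulrBr.
have Er : \sum_l epsm l * caputo_right Omega (alpha l) l vw x =
    \sum_l epsm l * caputo_right Omega (alpha l) l v x -
    \sum_l epsm l * caputo_right Omega (alpha l) l w x.
  by rewrite -sumrB; apply: eq_bigr => l _; rewrite (caputo_rightB l Ox) mulrBr.
have swap (p q r t : R) : (p - q) + (r - t) = (p + r) - (q + t) by ring.
exact: etrans (congr2 +%R El Er) (swap _ _ _ _).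
Qed.

End space_linear.

Lemma inner_conic_le0 dT (T : measurableType dT) (R : realType)
    (mu : {measure set T -> \bar R}) (D : set T) (mD : measurable D)
    (I : Type) (r : seq I) (c : I -> R) (F : I -> T -> R) (v : T -> R) :
  (forall i, 0 <= c i) -> (forall i, sqint mu D (F i)) -> sqint mu D v ->
  (forall i, inner mu D (F i) v <= 0) ->
  sqint mu D (fun t => \sum_(i <- r) c i * F i t) /\
  inner mu D (fun t => \sum_(i <- r) c i * F i t) v <= 0.
Proof.
move=> c0 sF sv Fv; have sc i := sqintZ mD (c i) (sF i).
split; first exact: (sqint_sum mD r sc).
rewrite (inner_suml mD _ sc sv); apply: sumr_le0 => i _.
by rewrite (innerZl mD _ (sF i) sv) mulr_ge0_le0.
Qed.

(** * The energy inequality for the errors *)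

Section error_estimate.
Context {R : realType} {d s : nat}.
Notation Rd := 'rV[R]_d.
Notation lam := (@lebesgue_tuple R d).
Notation row := (@row_of_tuple R d).
Variables (Omega : set Rd) (T : R) (theta a : 'I_s.+1 -> R).
Variables (alpha epsp epsm : 'I_d -> R).
Variables (f g : Rd -> R -> R) (u0 : Rd -> R) (u : Rd -> R -> R).
Hypotheses (bcO : bounded_convex_domain Omega) (T0 : 0 < T).
Hypotheses (theta01 : forall r, 0 < theta r <= 1) (a0 : 0 < a ord0).
Hypotheses (ar : forall r, r != ord0 -> 0 <= a r) (alpha12 : forall l, 1 < alpha l <= 2).
Hypotheses (epsp0 : forall l, 0 <= epsp l) (epsm0 : forall l, 0 <= epsm l).
Hypotheses (d0 : (0 < d)%N) (exu : exact_solution Omega T theta a alpha epsp epsm f g u0 u).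
Let D := row @^-1` Omega.
Let mD : measurable D := domain_measurable bcO.

Lemma space_term_dissipative v : space_regular Omega alpha v ->
  vanishes_with_gradient Omega v ->
  (forall l, J0 Omega (RL_left Omega (alpha l) l) v /\ J0 Omega (RL_right Omega (alpha l) l) v) ->
  [/\ sqint lam D (v \o row), sqint lam D (space_term Omega alpha epsp epsm v \o row) &
     inner lam D (space_term Omega alpha epsp epsm v \o row) (v \o row) <= 0].
Proof.
move=> rv vv Jv.
have Hl l := J0_inner_le0 mD (test_RL_left_dissipative bcO alpha12 l) (Jv l).1.
have Hr l := J0_inner_le0 mD (test_RL_right_dissipative bcO alpha12 l) (Jv l).2.
(* Square integrability of v is part of each [J0] membership; d > 0 provides a direction to take it
   from. *)
have sv : sqint lam D (v \o row) by have [] := Hl (Ordinal d0).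
have sl l : sqint lam D (RL_left Omega (alpha l) l v \o row) by have [] := Hl l.
have sr l : sqint lam D (RL_right Omega (alpha l) l v \o row) by have [] := Hr l.
have l0 l : inner lam D (RL_left Omega (alpha l) l v \o row) (v \o row) <= 0 by have [] := Hl l.
have r0 l : inner lam D (RL_right Omega (alpha l) l v \o row) (v \o row) <= 0 by have [] := Hr l.
have [sL L0] := inner_conic_le0 mD (index_enum 'I_d) epsp0 sl sv l0.
have [sM M0] := inner_conic_le0 mD (index_enum 'I_d) epsm0 sr sv r0.
set L := (fun t => _) in sL L0; set M := (fun t => _) in sM M0.
have E : {in D, (fun t => L t + M t) =1 space_term Omega alpha epsp epsm v \o row}.
  move=> t; rewrite inE => Ot; rewrite /L /M /space_term /=; congr (_ + _).
    by apply: eq_bigr => l _; rewrite (RL_left_caputo bcO (alpha12 l) rv vv Ot).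
  by apply: eq_bigr => l _; rewrite (RL_right_caputo bcO (alpha12 l) rv vv Ot).
clearbody L M; split => //; first by apply: (eq_sqint mD E); exact: (sqintD mD).
by rewrite -(eq_inner _ _ E) (innerDl mD sL sM sv) (le_trans (lerD L0 M0))// addr0.
Qed.

Section one_step.
Variables (N n : nat) (U : nat -> Rd -> R).
Hypotheses (nN : (0 < n <= N)%N).
Hypothesis scU : scheme_solution Omega T theta a alpha epsp epsm f g u0 N U.
Let A r := a r / tau T N `^ theta r.
Let err := error T u N U.

Let A_ge0 r : 0 <= A r.
Proof.
rewrite divr_ge0 ?powR_ge0//; have [->|r0] := eqVneq r ord0; [exact: ltW|exact: ar].
Qed.

Let N0 : (0 < N)%N. Proof. by case/andP: nN; exact: leq_trans. Qed.

Let tgrid_in m : (0 < m <= N)%N -> 0 < tgrid T N m <= T.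
Proof.
move=> /andP[m0 mN]; rewrite /tgrid /tau mulr_gt0 ?ltr0n//=; last by rewrite divr_gt0// ltr0n.
by rewrite mulrCA ger_pMr// ler_pdivrMr ?ltr0n// mul1r ler_nat.
Qed.

Let err_regular : space_regular Omega alpha (err n).
Proof.
have [[_ ru] _ _ _] := exu; have [_ rU _ _] := scU.
by apply: space_regularB; [| exact: ru (tgrid_in nN)|exact: rU].
Qed.

(** In Omega u(.,0) = u_0 = U^0, so the initial values subtracted in the residual and in the scheme
    cancel, and the error of index 0 never occurs: n - k >= 1 throughout. *)
Lemma error_equation x : Omega x -> time_residual T theta a u N n x =
  space_term Omega alpha epsp epsm (err n) x -
  \sum_r A r * \sum_(0 <= k < n) GLcoef (theta r) k * err (n - k)%N x.
Proof.
move=> Ox; have [[_ ru] pde u_0 _] := exu; have [U_0 rU _ sch] := scU.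
have alpha2 l : alpha l <= 2 by case/andP: (alpha12 l).
rewrite (space_termB bcO (ru _ (tgrid_in nN)) (rU _ nN) alpha2 epsp epsm Ox).
have := sch n x nN Ox; have := pde x _ Ox (tgrid_in nN).
have u0E : u x 0 = U 0%N x by rewrite u_0// U_0.
have n0 : (0 < n)%N by case/andP: nN.
have -> : time_residual T theta a u N n x = \sum_r a r * caputo_time T (theta r) (u x) (tgrid T N n)
    - (\sum_r A r * (\sum_(0 <= k < n) GLcoef (theta r) k * u x (tgrid T N (n - k)))
       - \sum_r A r * (\sum_(0 <= k < n) GLcoef (theta r) k * U 0%N x)).
  rewrite /time_residual -!sumrB; apply: eq_bigr => r _.
  rewrite mulrBr mulrA u0E -/(A r) -mulrBr -sumrB; congr (_ - _ * _).
  by apply: eq_bigr => k _; rewrite mulrBr.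
have -> : \sum_r A r * (\sum_(0 <= k < n) GLcoef (theta r) k * err (n - k)%N x) =
    \sum_r A r * (\sum_(0 <= k < n) GLcoef (theta r) k * u x (tgrid T N (n - k)))
    - (\sum_r a r * GLcoef (theta r) 0 / tau T N `^ theta r * U n x
       + \sum_r A r * (\sum_(1 <= k < n) GLcoef (theta r) k * U (n - k)%N x)).
  rewrite -big_split -sumrB; apply: eq_bigr => r _ /=.
  (* The implicit term, with [GLcoef _ 0] computed to 1, becomes the summand k = 0 that completes
     the sum over 1 <= k < n. *)
  rewrite (_ : a r * 1 / _ * U n x = A r * (1 * U (n - 0)%N x)); last first.
    by rewrite /A subn0; ring.
  rewrite -mulrDr -[X in _ * (X + _)]/(GLcoef (theta r) 0 * U (n - 0)%N x).
  rewrite -(big_ltn (F := fun k => GLcoef (theta r) k * U (n - k)%N x))// -mulrBr -sumrB.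
  by congr (_ * _); apply: eq_bigr => k _; rewrite -mulrBr.
move: (\sum_r a r * caputo_time _ _ _ _) (space_term _ _ _ _ _ _) (space_term _ _ _ _ _ _).
move: (\sum_r a r * GLcoef (theta r) 0 / _ * _).
move: (\sum_r A r * _) (\sum_r A r * _) (\sum_r A r * _) (f _ _) => *; lra.
Qed.

Hypothesis zU : zero_gradient_errors Omega T alpha u N U.
Let e m := nrm lam D (err m \o row).

Let sq_err m : (0 < m <= N)%N -> sqint lam D (err m \o row).
Proof. by move=> /zU[_ /(_ (Ordinal d0))[[/inL2_sqint]]]. Qed.

Lemma error_inequality (CR : R) : 0 <= CR ->
  (L2norm Omega (time_residual T theta a u N n) <= (CR * tau T N)%:E)%E ->
  \sum_r A r * \sum_(0 <= k < n) GLcoef (theta r) k * e (n - k)%N <= CR * tau T N.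
Proof.
move=> CR0 resCR.
have n0 : (0 < n)%N by case/andP: nN.
have tau0 : 0 <= tau T N by rewrite divr_ge0// ltW.
have [vv Jv] := zU nN.
have [sn sS Sle0] := space_term_dissipative err_regular vv Jv.
have nkN k : (k < n)%N -> (0 < n - k <= N)%N.
  by move=> kn; rewrite subn_gt0 kn (leq_trans (leq_subr _ _))//; case/andP: nN.
pose G r t := \sum_(0 <= k < n) GLcoef (theta r) k * err (n - k)%N (row t).
pose W t := \sum_r A r * G r t.
have ksum (F : nat -> R) : \sum_(0 <= k < n) F k = \sum_(k < n) F k by rewrite big_mkord.
have sG r : sqint lam D (G r).
  have -> : G r = fun t => \sum_(k < n) GLcoef (theta r) k * (err (n - k)%N \o row) t.
    by apply/funext => t; rewrite /G ksum.
  by apply: (sqint_sum mD) => k; apply: (sqintZ mD); exact/sq_err/nkN.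
have sW : sqint lam D W by apply: (sqint_sum mD) => r; exact: (sqintZ mD).
have resE : {in D, (fun t => (space_term Omega alpha epsp epsm (err n) \o row) t - W t) =1
    time_residual T theta a u N n \o row}.
  by move=> t; rewrite inE => Ot; rewrite /= error_equation.
(* The smoothness assumption only bounds [L2norm]; measurability of the residual comes from the
   error equation. *)
have sres : sqint lam D (time_residual T theta a u N n \o row).
  by apply: (eq_sqint mD resE); exact: (sqintB mD).
have res_le : nrm lam D (time_residual T theta a u N n \o row) <= CR * tau T N.
  by move: resCR; rewrite (sqint_L2norm mD sres) lee_fin.
have WE : inner lam D W (err n \o row) =
    \sum_r A r * \sum_(0 <= k < n) GLcoef (theta r) k *
      inner lam D (err (n - k)%N \o row) (err n \o row).
  rewrite (inner_suml mD) => [|r|]; [|exact: (sqintZ mD)|exact: sn].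
  apply: eq_bigr => r _; rewrite (innerZl mD (A r) (sG r) sn) ksum; congr (_ * _).
  have -> : G r = fun t => \sum_(k < n) GLcoef (theta r) k * (err (n - k)%N \o row) t.
    by apply/funext => t; rewrite /G ksum.
  have sk (k : 'I_n) : sqint lam D (err (n - k)%N \o row) by exact/sq_err/nkN.
  rewrite (inner_suml mD) => [|k|]; [|exact: (sqintZ mD)|exact: sn].
  by apply: eq_bigr => k _; rewrite (innerZl mD).
have Wle : inner lam D W (err n \o row) <= CR * tau T N * e n.
  have : inner lam D (time_residual T theta a u N n \o row) (err n \o row) =
      inner lam D (space_term Omega alpha epsp epsm (err n) \o row) (err n \o row)
      - inner lam D W (err n \o row).
    by rewrite -(eq_inner _ _ resE) (innerBl mD).
  have := cauchy_schwarz mD sres sn; rewrite ler_norml => /andP[+ _].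
  have : nrm lam D (time_residual T theta a u N n \o row) * e n <= CR * tau T N * e n.
    by rewrite ler_wpM2r// nrm_ge0.
  move: Sle0; rewrite /e.
  move: (nrm lam D _ * _) (CR * _ * _) (inner _ _ _ _) (inner _ _ W _) (inner _ _ _ _) => *; lra.
(* the weights of the past errors are nonpositive *)
have lower : (\sum_r A r * \sum_(0 <= k < n) GLcoef (theta r) k * e (n - k)%N) * e n <=
    inner lam D W (err n \o row).
  rewrite WE mulr_suml; apply: ler_sum => r _; rewrite -mulrA ler_wpM2l//.
  rewrite mulr_suml big_nat [leRHS]big_nat; apply: ler_sum => -[|k] kn.
    by rewrite subn0 !mul1r -nrm_sqr expr2.
  rewrite -mulrA; apply: ler_wnM2l; first exact: GLcoef_le0.
  apply: le_trans (ler_norm _) _; apply: (cauchy_schwarz mD _ sn).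
  exact/sq_err/nkN.
(* The energy inequality is divided by the norm of e^n. If that norm is zero, the summand k = 0
   vanishes and all others are nonpositive. *)
have [e0|en0] := eqVneq (e n) 0; last first.
  have epos : 0 < e n by rewrite lt_neqAle eq_sym en0 nrm_ge0.
  by rewrite -(ler_pM2r epos); exact: le_trans lower Wle.
apply: (@le_trans _ _ 0); last exact: mulr_ge0.
apply: sumr_le0 => r _; rewrite mulr_ge0_le0// big_nat; apply: sumr_le0 => -[|k] kn.
  by rewrite subn0 e0 mulr0.
by rewrite mulr_le0_ge0 ?nrm_ge0//; exact: GLcoef_le0.
Qed.

End one_step.
End error_estimate.

Theorem theorem4 (R : realType) (d s : nat) (Omega : set 'rV[R]_d) (T : R)
  (theta a : 'I_s.+1 -> R) (alpha epsp epsm : 'I_d -> R)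
  (f g : 'rV[R]_d -> R -> R) (u0 : 'rV[R]_d -> R) (u : 'rV[R]_d -> R -> R) :
  d = 2%N \/ d = 3%N ->
  bounded_convex_domain Omega ->
  0 < T ->
  (forall r, 0 < theta r <= 1) ->
  0 < a ord0 ->
  (forall r, r != ord0 -> 0 <= a r) ->
  (forall l, 1 < alpha l <= 2) ->
  (forall l, 0 <= epsp l) ->
  (forall l, 0 <= epsm l) ->
  exact_solution Omega T theta a alpha epsp epsm f g u0 u ->
  smooth_enough_in_time Omega T theta a u ->
  exists C : R, forall (N : nat) (U : nat -> 'rV[R]_d -> R), (0 < N)%N ->
    scheme_solution Omega T theta a alpha epsp epsm f g u0 N U ->
    zero_gradient_errors Omega T alpha u N U ->
    forall n : nat, (1 <= n <= N)%N ->
      (L2norm Omega (fun x => (u x (tgrid T N n) - U n x)%R)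
         <= (C * tau T N)%:E)%E.
Proof.
move=> d23 bcO T0 theta01 a0 ar alpha12 epsp0 epsm0 exu [CR resCR].
have d0 : (0 < d)%N by case: d23 => ->.
(* The constant of the smoothness assumption comes without a sign, while the stability bound is
   stated for a nonnegative one. *)
have [|C HC] := GL_stability T0 theta01 a0 ar (CR := Num.max CR 0).
  by rewrite le_max lexx orbT.
exists C => N U N0 scU zU n nN.
have sn : sqint (lebesgue_tuple d) (row_of_tuple @^-1` Omega) (error T u N U n \o row_of_tuple).
  by have [_ /(_ (Ordinal d0))[[/inL2_sqint]]] := zU n nN.
rewrite (sqint_L2norm (domain_measurable bcO) sn) lee_fin.
apply: (HC N (fun m => nrm (lebesgue_tuple d) (row_of_tuple @^-1` Omega)
  (error T u N U m \o row_of_tuple)) N0) => // m mN.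
apply: (error_inequality bcO T0 theta01 a0 ar alpha12 epsp0 epsm0 d0 exu mN scU zU).
  by rewrite le_max lexx orbT.
rewrite (le_trans (resCR N m mN))// lee_fin ler_wpM2r ?le_max ?lexx//.
by rewrite divr_ge0// ltW.
Qed.
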